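(* Assume (H1)–(H4) as described in the context, and let $\mu$ be the Borel measure on $\mathbb{R}^4$ defined by $\mu(E)=\int_{V_1^{c,d}}\chi_E(x,\varphi(x))\,dx$, with Fourier transform $$\widehat{\mu}(\xi',\xi'')=\int_{V_1^{c,d}} e^{-i(\langle x,\xi'\rangle+\langle\varphi(x),\xi''\rangle)}\,dx,\qquad \xi',\xi''\in\mathbb{R}^2.$$ Then there exists a constant $C>0$ such that $$|\widehat{\mu}(\xi',\xi'')|\le C\,|\xi''|^{-\frac{\alpha_1+\alpha_2}{m}}\quad\text{for all }\xi'\in\mathbb{R}^2\text{ and all }\xi''\in\mathbb{R}^2\setminus\{\mathbf 0\}.$$
   Context: Fix $\alpha_1,\alpha_2>0$ with $\alpha_1\neq\alpha_2$. For $t>0$ and $x=(x_1,x_2)\in\mathbb{R}^2$ put $t\bullet x=(t^{\alpha_1}x_1,t^{\alpha_2}x_2)$. For reals $a<b$ let $V^{a,b}=\{t\bullet(1,s): a<s<b,\ t>0\}$, and for $a<c<d<b$ let $V^{c,d}=\{t\bullet(1,s):c<s<d,\ t>0\}$ and $V_1^{c,d}=\{t\bullet(1,s): c<s<d,\ 0<t<1\}$. Let $\varphi=(\varphi_1,\varphi_2):V^{a,b}\to\mathbb{R}^2$. For $x\in V^{a,b}$ let $\varphi_j''(x)$ be the Hessian matrix of $\varphi_j$ at $x$, let $Q_x(\zeta)=\det(\zeta_1\varphi_1''(x)+\zeta_2\varphi_2''(x))$ for $\zeta=(\zeta_1,\zeta_2)\in\mathbb{R}^2$, and let $K(x)$ be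 the symmetric $2\times 2$ matrix with $Q_x(\zeta)=\langle K(x)\zeta,\zeta\rangle$. A point $x$ is elliptic for $\varphi$ if $\min_{\zeta\in S^1}|Q_x(\zeta)|>0$. Assumptions: (H1) $\varphi$ is real analytic on $V^{a,b}$. (H2) For some $m\ge 3(\alpha_1+\alpha_2)$, $\varphi(t\bullet x)=t^m\varphi(x)$ for all $x\in V^{a,b}$, $t>0$. (H3) $a<c<d<b$ and $\sigma\in[c,d]$ are such that the set of nonelliptic points of $\varphi$ in $\overline{V^{c,d}}\setminus\{\mathbf 0\}$ is exactly the curve $\{t\bullet(1,\sigma):t>0\}$. (H4) With $\beta=2(m-\alpha_1-\alpha_2)$, there are positive integers $n_1,n_2$ and constants $D>0$, $\delta>0$ such that: if $\sigma\in(c,d]$ then $\min_{\zeta\in S^1}|Q_{t\bullet(1,s)}(\zeta)|\ge D\,t^\beta|s-\sigma|^{n_1}$ for all $s\in(\sigma-\delta,\sigma)$, $t>0$; if $\sigma\in[c,d)$ then $\min_{\zeta\in S^1}|Q_{t\bullet(1,s)}(\zeta)|\ge D\,t^\beta|s-\sigma|^{n_2}$ for all $s\in(\sigma,\sigma+\delta)$, $t>0$; and $\max\{n_1,n_2\}<\frac{2m}{\alpha_1+\alpha_2}-3$. *)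

(* Defs.v *)
From HB Require Import structures.
From mathcomp Require Import all_boot all_order all_algebra.
From mathcomp Require Import all_classical all_reals all_analysis.
Set Implicit Arguments. Unset Strict Implicit. Unset Printing Implicit Defensive.
Import Order.TTheory GRing.Theory Num.Theory.
Import numFieldNormedType.Exports.
Local Open Scope classical_set_scope.
Local Open Scope ring_scope.

Section Defs.
Variable R : realType.
Notation P := (R * R)%type.

(* Euclidean norm on R^2 (not the max-norm of the product type). *)
Definition enorm (x : P) : R := Num.sqrt (x.1 ^+ 2 + x.2 ^+ 2).
Definition dot (x y : P) : R := x.1 * y.1 + x.2 * y.2.
Definition S1 : set P := [set z | z.1 ^+ 2 + z.2 ^+ 2 = 1].

Definition dil (a1 a2 t : R) (x : P) : P := (t `^ a1 * x.1, t `^ a2 * x.2).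

Definition Vcone (a1 a2 a b : R) : set P :=
  [set x | exists t s, 0 < t /\ a < s /\ s < b /\ x = dil a1 a2 t (1, s)].
Definition Vcone1 (a1 a2 c d : R) : set P :=
  [set x | exists t s, 0 < t /\ t < 1 /\ c < s /\ s < d /\ x = dil a1 a2 t (1, s)].
Definition curve (a1 a2 sigma : R) : set P :=
  [set x | exists t, 0 < t /\ x = dil a1 a2 t (1, sigma)].

Definition real_analytic_on (U : set P) (f : P -> R) : Prop :=
  forall p, U p -> exists r : R, 0 < r /\ exists c : nat -> nat -> R,
    forall y : P, `|y.1 - p.1| < r -> `|y.2 - p.2| < r ->
      cvg ((fun N : nat => \sum_(k < N) \sum_(l < N)
              `|c k l| * `|y.1 - p.1| ^+ k * `|y.2 - p.2| ^+ l) @ \oo) /\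
      ((fun N : nat => \sum_(k < N) \sum_(l < N)
              c k l * (y.1 - p.1) ^+ k * (y.2 - p.2) ^+ l) @ \oo --> f y).

Definition dpart (i : 'I_2) (f : P -> R) : P -> R :=
  if val i == 0%N then (fun x => derive1 (fun t => f (t, x.2)) x.1)
  else (fun x => derive1 (fun t => f (x.1, t)) x.2).

Definition hessian (f : P -> R) (x : P) : 'M[R]_2 :=
  \matrix_(i < 2, j < 2) dpart i (dpart j f) x.

Definition Qform (phi1 phi2 : P -> R) (x zeta : P) : R :=
  \det (zeta.1 *: hessian phi1 x + zeta.2 *: hessian phi2 x).

(* min over zeta in S^1 of |Q_x(zeta)| (the minimum is attained; we use inf) *)
Definition minQ (phi1 phi2 : P -> R) (x : P) : R :=
  inf [set `|Qform phi1 phi2 x z| | z in S1].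

Definition elliptic (phi1 phi2 : P -> R) (x : P) : Prop := 0 < minQ phi1 phi2 x.

Definition leb2 := ((@lebesgue_measure R) \x (@lebesgue_measure R))%E.

Definition phase (phi1 phi2 : P -> R) (xi1 xi2 : P) (x : P) : R :=
  dot x xi1 + dot (phi1 x, phi2 x) xi2.

(* real and imaginary part of hat mu(xi',xi'') = int_{V1} e^{-i phase} dx *)
Definition muhat_re (a1 a2 c d : R) (phi1 phi2 : P -> R) (xi1 xi2 : P) : R :=
  Rintegral leb2 (Vcone1 a1 a2 c d) (fun x => cos (phase phi1 phi2 xi1 xi2 x)).
Definition muhat_im (a1 a2 c d : R) (phi1 phi2 : P -> R) (xi1 xi2 : P) : R :=
  - Rintegral leb2 (Vcone1 a1 a2 c d) (fun x => sin (phase phi1 phi2 xi1 xi2 x)).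
Definition muhat_abs (a1 a2 c d : R) (phi1 phi2 : P -> R) (xi1 xi2 : P) : R :=
  Num.sqrt (muhat_re a1 a2 c d phi1 phi2 xi1 xi2 ^+ 2
            + muhat_im a1 a2 c d phi1 phi2 xi1 xi2 ^+ 2).

End Defs.

(* Main.v *)
(** Put [g(s) = phi(1, s)].  By homogeneity, in the coordinates
    [x = (u, u^(a2/a1) s)] the transform becomes the integral over [c < s < d] of
      [J(s) = \int_0^1 u^(a2/a1) e^(-i (A u + B s u^(a2/a1) + h(s) u^(m/a1))) du],
    where [h = <g, xi''>].

    (1) After [v = u^(1 + a2/a1)] the phase of [J] has three distinct exponents, the
    largest being [r = m/(a1+a2) >= 3].  On a short dyadic-type interval a Vandermonde
    argument makes one of its first three derivatives large, and van der Corput's lemma,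
    summed geometrically, gives [|J(s)| <= K |h(s)|^(-1/r)] uniformly in [A] and [B].

    (2) The Hessian determinant at [(1, s)] is a combination of [h h''], [h'^2] and
    [s h' h''].  Ellipticity and the lower bounds near [sigma] therefore force [h] to
    vanish to order at most [k = (max(n1, n2) + 3) / 2] everywhere, uniformly over the
    unit circle of directions.  Since [k / r < 1], [|h|^(-1/r)] is integrable over
    [[c, d]] with integral [O(|xi''|^(-1/r))]. *)
Require Import Defs.
From HB Require Import structures.
From mathcomp Require Import all_boot all_order all_algebra.
From mathcomp Require Import all_classical all_reals all_analysis.
From mathcomp Require Import measurable_realfun.
From mathcomp Require Import ring lra zify.
Import Order.TTheory GRing.Theory Num.Theory.
Import numFieldNormedType.Exports.
Local Open Scope classical_set_scope.
Local Open Scope ring_scope.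

(** * Van der Corput estimates *)

(** Nothing is known about [A] and [B], which carry [xi'], so oscillatory constants may depend on
    the exponents only. Hence a test with three derivatives, whose weakest outcome is decay of order
    1/3; [r >= 3] ensures that this loss, summed up to the scale where the top term takes over,
    stays within [|h|^(-1/r)].

    Oscillatory integrals appear as increments of a primitive [Phi] with derivative [cos f], so
    integrations by parts become mean value arguments. A constant [th] in the phase lets one
    estimate serve the real and the imaginary part.

    The zeros of [h] may move and merge as the direction turns, so they are not followed. What is
    uniform is the size of a finite set [Z] of centres and the constant in [|h(s)| >= c |s - w|^K]
    for some [w] in [Z]. As the bound on [J] says nothing where [h = 0], it is blended with
    [|J| <= 1] into the weight [(tau + |s - w|)^(-e)], [e = K / r < 1].

    Two demands are made on the integer [K]: [n < 2 K - 1] contradicts degeneracy at [sigma], and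
    [K < r] gives integrability. The threshold [n + 3 < 2 r] of (H4) leaves room for such a [K]. *)

Lemma mvt_ex (R : realType) (f df : R -> R) (x y : R) : x <= y ->
  (forall z, x <= z <= y -> is_derive z 1 f (df z)) ->
  exists2 z, x <= z <= y & f y - f x = df z * (y - x).
Proof.
move=> xy fd; have [||z] := @MVT_segment R f df x y xy.
- by move=> z; rewrite in_itv/= => /andP[xz zy]; apply: fd; rewrite !ltW.
- apply: derivable_within_continuous => z; rewrite in_itv/= => zxy.
  by have [] := fd _ zxy.
by rewrite in_itv/= => zxy e; exists z.
Qed.

Lemma mvt_norm_le (R : realType) (f df : R -> R) (x y K : R) : x <= y ->
  (forall z, x <= z <= y -> is_derive z 1 f (df z)) ->
  (forall z, x <= z <= y -> `|df z| <= K) -> `|f y - f x| <= K * (y - x).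
Proof.
move=> xy fd fK; have [z zxy ->] := @mvt_ex R f df x y xy fd.
by rewrite normrM (ger0_norm (_ : 0 <= y - x)) ?subr_ge0// ler_wpM2r ?subr_ge0 ?fK.
Qed.

Lemma mvt_ge (R : realType) (f df : R -> R) (x y K : R) : x <= y ->
  (forall z, x <= z <= y -> is_derive z 1 f (df z)) ->
  (forall z, x <= z <= y -> K <= df z) -> K * (y - x) <= f y - f x.
Proof.
move=> xy fd fK; have [z zxy ->] := @mvt_ex R f df x y xy fd.
by rewrite ler_wpM2r ?subr_ge0 ?fK.
Qed.

Lemma derive_ivt0 (R : realType) (f df : R -> R) (x y : R) : x <= y ->
  (forall z, x <= z <= y -> is_derive z 1 f (df z)) ->
  f x <= 0 -> 0 <= f y -> exists2 z, x <= z <= y & f z = 0.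
Proof.
move=> xy fd fx fy; have [||z] := @IVT R f x y 0 xy.
- apply: derivable_within_continuous => z; rewrite in_itv/= => zxy.
  by have [] := fd _ zxy.
- have xfy : f x <= f y by exact: le_trans fy.
  by rewrite ge_min fx le_max fy orbT.
by rewrite in_itv/= => zxy e; exists z.
Qed.

(** The point [z0] is a zero of the increasing function [g], or the endpoint where [|g|] is smallest
    if [g] has no zero. The second and third derivative tests cut a window around it. *)
Lemma pivot_point (R : realType) (g dg : R -> R) (x y l : R) :
  x <= y -> 0 < l ->
  (forall z, x <= z <= y -> is_derive z 1 g (dg z)) ->
  (forall z, x <= z <= y -> l <= dg z) ->
  exists2 z0, x <= z0 <= y &
    (forall z, x <= z -> z < z0 -> g z <= - (l * (z0 - z))) /\
    (forall z, z0 < z -> z <= y -> l * (z - z0) <= g z).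
Proof.
move=> xy l0 gd gl.
have gM z w : x <= z -> z <= w -> w <= y -> l * (w - z) <= g w - g z.
  move=> xz zw wy; apply: (@mvt_ge R g dg) => // t /andP[zt tw].
    by apply: gd; rewrite (le_trans xz zt) (le_trans tw wy).
  by apply: gl; rewrite (le_trans xz zt) (le_trans tw wy).
have [gx|gx] := leP 0 (g x).
  exists x; first by rewrite lexx.
  split=> z h1 h2; first lra.
  by have := gM x z (lexx x) (ltW h1) h2; lra.
have [gy|gy] := leP (g y) 0.
  exists y; first by rewrite lexx xy.
  split=> z h1 h2; last lra.
  by have := gM z y h1 (ltW h2) (lexx y); lra.
have [z0 /andP[xz0 z0y] gz0] := @derive_ivt0 R g dg x y xy gd (ltW gx) (ltW gy).
exists z0; first by rewrite xz0.
split=> z h1 h2.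
- by have := gM z z0 h1 (ltW h2) z0y; lra.
- by have := gM z0 z xz0 (ltW h1) h2; lra.
Qed.

(** Inside the window of radius [del] only [|dPhi| <= 1] is used, at a cost of at most [2 * del].
    The two side bounds are conditional because the window may stick out of [[x, y]]. *)
Lemma excise (R : realType) (Phi dPhi : R -> R) (x y z0 del B : R) :
  x <= z0 <= y -> 0 < del -> 0 <= B ->
  (forall z, x <= z <= y -> is_derive z 1 Phi (dPhi z)) ->
  (forall z, x <= z <= y -> `|dPhi z| <= 1) ->
  (x <= z0 - del -> `|Phi (z0 - del) - Phi x| <= B) ->
  (z0 + del <= y -> `|Phi y - Phi (z0 + del)| <= B) ->
  `|Phi y - Phi x| <= 2 * B + 2 * del.
Proof.
move=> /andP[xz0 z0y] d0 B0 Pd P1 hl hr.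
have PM u v : x <= u -> u <= v -> v <= y -> `|Phi v - Phi u| <= v - u.
  move=> xu uv vy; rewrite -[leRHS]mul1r.
  apply: (@mvt_norm_le R Phi dPhi) => // t /andP[ut tv].
    by apply: Pd; rewrite (le_trans xu ut) (le_trans tv vy).
  by apply: P1; rewrite (le_trans xu ut) (le_trans tv vy).
have L : `|Phi z0 - Phi x| <= B + del.
  have [h|h] := leP x (z0 - del).
    have -> : Phi z0 - Phi x = (Phi z0 - Phi (z0 - del)) + (Phi (z0 - del) - Phi x).
      by ring.
    apply: (le_trans (ler_normD _ _)); have := hl h; have := PM (z0 - del) z0 h.
    by move=> /(_ ltac:(lra) z0y); lra.
  by have := PM x z0 (lexx x) xz0 z0y; lra.
have U : `|Phi y - Phi z0| <= B + del.
  have [h|h] := leP (z0 + del) y.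
    have -> : Phi y - Phi z0 = (Phi y - Phi (z0 + del)) + (Phi (z0 + del) - Phi z0).
      by ring.
    apply: (le_trans (ler_normD _ _)); have := hr h; have := PM z0 (z0 + del) xz0.
    by move=> /(_ ltac:(lra) h); lra.
  by have := PM z0 y xz0 z0y (lexx y); lra.
have -> : Phi y - Phi x = (Phi y - Phi z0) + (Phi z0 - Phi x) by ring.
by apply: (le_trans (ler_normD _ _)); lra.
Qed.

(** The mean value theorem replaces integration by parts. For [e = 1] and [e = -1] the function
    [Phi - (sin f + e) / f1] has derivative [(sin f + e) f2 / f1^2], of constant sign because
    [sin f + e] has the sign of [e] and [f2] does not change sign. The two monotonicities are
    opposite and bound [Phi y - Phi x] from both sides, the correction terms being at most [2 / mu]
    in absolute value. *)
Lemma van_der_corput1_pos (R : realType) (Phi f f1 f2 : R -> R) (x y mu : R) :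
  x <= y -> 0 < mu ->
  (forall z, x <= z <= y -> is_derive z 1 Phi (cos (f z))) ->
  (forall z, x <= z <= y -> is_derive z 1 f (f1 z)) ->
  (forall z, x <= z <= y -> is_derive z 1 f1 (f2 z)) ->
  (forall z, x <= z <= y -> mu <= f1 z) ->
  (forall z, x <= z <= y -> 0 <= f2 z) \/ (forall z, x <= z <= y -> f2 z <= 0) ->
  `|Phi y - Phi x| <= 2 / mu.
Proof.
move=> xy mu0 Pd fd f1d f1mu f2s.
have key (e : R) : e = 1 \/ e = -1 ->
    forall z, x <= z <= y ->
    is_derive z 1 (fun z => (sin (f z) + e) / f1 z - Phi z)
      (- ((sin (f z) + e) * f2 z / (f1 z) ^+ 2)).
  move=> _ z hz; have f1n : f1 z != 0 by apply: lt0r_neq0; apply: lt_le_trans (f1mu _ hz).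
  have := Pd _ hz; have := fd _ hz; have := f1d _ hz => h1 h2 h3.
  apply: is_derive_eq.
  by rewrite /GRing.scale/=; field.
have vb (e z : R) : x <= z <= y -> e = 1 \/ e = -1 ->
   0 <= e * ((sin (f z) + e) / f1 z) <= 2 / mu.
  move=> hz he; have m0 := f1mu _ hz.
  have hs : 0 <= e * (sin (f z) + e) <= 2.
    by case: he => ->; have := sin_le1 (f z); have := sin_geN1 (f z); lra.
  have f10 : 0 < f1 z by exact: lt_le_trans m0.
  rewrite mulrA; apply/andP; split.
    by rewrite divr_ge0 ?(ltW f10)//; case/andP: hs.
  rewrite ler_pM ?invr_ge0 ?(ltW f10)//; [|by case/andP: hs..| ].
    by case/andP: hs.
  by rewrite lef_pV2 ?posrE.
have xx : x <= x <= y by rewrite lexx.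
have yy : x <= y <= y by rewrite lexx xy.
have main (e : R) : e = 1 \/ e = -1 -> forall s : R, s = 1 \/ s = -1 ->
   (forall z, x <= z <= y -> 0 <= s * f2 z) ->
   0 <= e * s * ((Phi y - (sin (f y) + e) / f1 y) - (Phi x - (sin (f x) + e) / f1 x)).
  move=> he s hs h2.
  have [z hz E] := @mvt_ex R _ _ x y xy (key e he).
  have -> : e * s * ((Phi y - (sin (f y) + e) / f1 y) - (Phi x - (sin (f x) + e) / f1 x))
     = e * s * (((sin (f z) + e) * f2 z / (f1 z) ^+ 2) * (y - x)).
    by rewrite -[in RHS](opprK (_ / f1 z ^+ 2)) mulNr -E; ring.
  have -> : e * s * ((sin (f z) + e) * f2 z / f1 z ^+ 2 * (y - x)) =
     (e * (sin (f z) + e)) * (s * f2 z) / f1 z ^+ 2 * (y - x) by ring.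
  apply: mulr_ge0; last by rewrite subr_ge0.
  apply: divr_ge0; last exact: sqr_ge0.
  apply: mulr_ge0; last exact: h2.
  by case: he => ->; have := sin_le1 (f z); have := sin_geN1 (f z); lra.
have f2s' : exists s : R, (s = 1 \/ s = -1) /\ forall z, x <= z <= y -> 0 <= s * f2 z.
  case: f2s => h; [exists 1|exists (-1)]; split; auto => z /h; lra.
case: f2s' => s [hs h2].
have e1 : 1 = 1 :> R \/ 1 = -1 :> R by left.
have e2 : -1 = 1 :> R \/ -1 = -1 :> R by right.
have := main 1 e1 s hs h2; have := main (-1) e2 s hs h2.
have := vb 1 x xx e1; have := vb 1 y yy e1; have := vb (-1) x xx e2; have := vb (-1) y yy e2.
move: ((sin (f y) + 1) / f1 y) ((sin (f x) + 1) / f1 x) ((sin (f y) + -1) / f1 y)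
  ((sin (f x) + -1) / f1 x) (2 / mu) => a1 a2 a3 a4 B.
by move=> *; rewrite ler_norml; case: hs => ?; subst s; lra.
Qed.

Lemma van_der_corput1 (R : realType) (Phi f f1 f2 : R -> R) (x y mu : R) :
  x <= y -> 0 < mu ->
  (forall z, x <= z <= y -> is_derive z 1 Phi (cos (f z))) ->
  (forall z, x <= z <= y -> is_derive z 1 f (f1 z)) ->
  (forall z, x <= z <= y -> is_derive z 1 f1 (f2 z)) ->
  (forall z, x <= z <= y -> mu <= f1 z) \/ (forall z, x <= z <= y -> f1 z <= - mu) ->
  (forall z, x <= z <= y -> 0 <= f2 z) \/ (forall z, x <= z <= y -> f2 z <= 0) ->
  `|Phi y - Phi x| <= 2 / mu.
Proof.
move=> xy mu0 Pd fd f1d [f1s|f1s] f2s.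
  exact: (@van_der_corput1_pos R Phi f f1 f2).
apply: (@van_der_corput1_pos R Phi (\- f) (\- f1) (\- f2)) => //.
- by move=> z /Pd; rewrite /= cosN.
- by move=> z /fd h; apply: is_deriveN.
- by move=> z /f1d h; apply: is_deriveN.
- by move=> z /f1s /=; lra.
- by case: f2s => h; [right|left] => z /h /=; lra.
Qed.

(** Variant for an [f1] that need not be monotone: the derivative of [Phi - sin f / f1] is at most
    [L / mu^2] in absolute value. This is affordable on an interval of bounded length when [L] and
    [mu] are of the same order. *)
Lemma van_der_corput1_bounded (R : realType) (Phi f f1 f2 : R -> R) (x y mu L : R) :
  x <= y -> 0 < mu ->
  (forall z, x <= z <= y -> is_derive z 1 Phi (cos (f z))) ->
  (forall z, x <= z <= y -> is_derive z 1 f (f1 z)) ->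
  (forall z, x <= z <= y -> is_derive z 1 f1 (f2 z)) ->
  (forall z, x <= z <= y -> mu <= `|f1 z|) ->
  (forall z, x <= z <= y -> `|f2 z| <= L) ->
  `|Phi y - Phi x| <= 2 / mu + L / mu ^+ 2 * (y - x).
Proof.
move=> xy mu0 Pd fd f1d f1mu f2L.
have xx : x <= x <= y by rewrite lexx.
have yy : x <= y <= y by rewrite lexx xy.
have key z : x <= z <= y ->
    is_derive z 1 (fun z => Phi z - sin (f z) / f1 z) (sin (f z) * f2 z / (f1 z) ^+ 2).
  move=> hz; have f1n : f1 z != 0 by rewrite -normr_gt0; apply: lt_le_trans (f1mu _ hz).
  have := Pd _ hz; have := fd _ hz; have := f1d _ hz => h1 h2 h3.
  apply: is_derive_eq.
  by rewrite /GRing.scale/=; field.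
have sb z : `|sin (f z)| <= 1 by rewrite ler_norml sin_le1 sin_geN1.
have := @mvt_norm_le R _ _ x y (L / mu ^+ 2) xy key _ => /(_ _)/wrap[].
  move=> z hz; rewrite !normrM normfV normrX ler_pM ?invr_ge0 ?exprn_ge0//.
    by rewrite -[leRHS]mul1r ler_pM// f2L.
  rewrite lef_pV2 ?posrE ?exprn_gt0//; last by apply: lt_le_trans (f1mu _ hz).
  by rewrite lerXn2r ?nnegrE ?f1mu// ltW.
have vb z : x <= z <= y -> `|sin (f z) / f1 z| <= 1 / mu.
  move=> hz; rewrite normrM normfV ler_pM ?invr_ge0//.
  by rewrite lef_pV2 ?posrE ?f1mu//; apply: lt_le_trans (f1mu _ hz).
have := vb x xx; have := vb y yy.
move: (sin (f x) / f1 x) (sin (f y) / f1 y) => u v hu hv h.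
have -> : Phi y - Phi x = (Phi y - v - (Phi x - u)) + (v - u) by ring.
apply: (le_trans (ler_normD _ _)); rewrite addrC lerD//.
apply: (le_trans (ler_normB _ _)); have -> : 2 / mu = 1 / mu + 1 / mu by lra.
by rewrite lerD.
Qed.

(** Away from the window around the pivot of [f1], [|f1| >= l * del] and [f1] is monotone, so the
    first derivative test gives [2 / (l * del)] on each side. The radius stays free so that all the
    tests can later share one value. *)
Lemma van_der_corput2_pos (R : realType) (Phi f f1 f2 : R -> R) (x y l del : R) :
  x <= y -> 0 < l -> 0 < del ->
  (forall z, x <= z <= y -> is_derive z 1 Phi (cos (f z))) ->
  (forall z, x <= z <= y -> is_derive z 1 f (f1 z)) ->
  (forall z, x <= z <= y -> is_derive z 1 f1 (f2 z)) ->
  (forall z, x <= z <= y -> l <= f2 z) ->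
  `|Phi y - Phi x| <= 4 / (l * del) + 2 * del.
Proof.
move=> xy l0 d0 Pd fd f1d f2l.
have [z0 z0xy [gl gr]] := @pivot_point R f1 f2 x y l xy l0 f1d f2l.
have ld0 : 0 < l * del by rewrite mulr_gt0.
have -> : 4 / (l * del) = 2 * (2 / (l * del)) by field; rewrite !gt_eqF.
have /andP[z0x z0y] := z0xy.
apply: (@excise R Phi (fun z => cos (f z)) x y z0) => //.
- by rewrite divr_ge0 ?(ltW ld0)//; lra.
- by move=> z _; rewrite ler_norml cos_le1 cos_geN1.
- move=> h.
  have sub z : x <= z <= z0 - del -> x <= z <= y by move=> /andP[? ?]; apply/andP; split; lra.
  apply: (@van_der_corput1 R Phi f f1 f2) => //; try by move=> z /sub; auto.
    right=> z /andP[h1 h2]; have := gl z h1 ltac:(lra).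
    have : l * del <= l * (z0 - z) by rewrite ler_pM2l//; lra.
    lra.
  by left=> z /sub/f2l; lra.
- move=> h.
  have sub z : z0 + del <= z <= y -> x <= z <= y by move=> /andP[? ?]; apply/andP; split; lra.
  apply: (@van_der_corput1 R Phi f f1 f2) => //; try by move=> z /sub; auto.
    left=> z /andP[h1 h2]; have := gr z ltac:(lra) h2.
    have : l * del <= l * (z - z0) by rewrite ler_pM2l//; lra.
    lra.
  by left=> z /sub/f2l; lra.
Qed.

Lemma van_der_corput2 (R : realType) (Phi f f1 f2 : R -> R) (x y l del : R) :
  x <= y -> 0 < l -> 0 < del ->
  (forall z, x <= z <= y -> is_derive z 1 Phi (cos (f z))) ->
  (forall z, x <= z <= y -> is_derive z 1 f (f1 z)) ->
  (forall z, x <= z <= y -> is_derive z 1 f1 (f2 z)) ->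
  (forall z, x <= z <= y -> l <= f2 z) \/ (forall z, x <= z <= y -> f2 z <= - l) ->
  `|Phi y - Phi x| <= 4 / (l * del) + 2 * del.
Proof.
move=> xy l0 d0 Pd fd f1d [f2s|f2s].
  exact: (@van_der_corput2_pos R Phi f f1 f2).
apply: (@van_der_corput2_pos R Phi (\- f) (\- f1) (\- f2)) => //.
- by move=> z /Pd; rewrite /= cosN.
- by move=> z /fd h; apply: is_deriveN.
- by move=> z /f1d h; apply: is_deriveN.
- by move=> z /f2s /=; lra.
Qed.

(** The same excision one derivative higher, around the pivot of [f2]; the same [del] is reused in
    the second derivative test on either side. *)
Lemma van_der_corput3_pos (R : realType) (Phi f f1 f2 f3 : R -> R) (x y l del : R) :
  x <= y -> 0 < l -> 0 < del ->
  (forall z, x <= z <= y -> is_derive z 1 Phi (cos (f z))) ->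
  (forall z, x <= z <= y -> is_derive z 1 f (f1 z)) ->
  (forall z, x <= z <= y -> is_derive z 1 f1 (f2 z)) ->
  (forall z, x <= z <= y -> is_derive z 1 f2 (f3 z)) ->
  (forall z, x <= z <= y -> l <= f3 z) ->
  `|Phi y - Phi x| <= 8 / (l * del ^+ 2) + 6 * del.
Proof.
move=> xy l0 d0 Pd fd f1d f2d f3l.
have [z0 z0xy [gl gr]] := @pivot_point R f2 f3 x y l xy l0 f2d f3l.
have ld0 : 0 < l * del by rewrite mulr_gt0.
have -> : 8 / (l * del ^+ 2) + 6 * del =
    2 * (4 / ((l * del) * del) + 2 * del) + 2 * del by field; rewrite !gt_eqF.
have /andP[z0x z0y] := z0xy.
apply: (@excise R Phi (fun z => cos (f z)) x y z0) => //.
- by rewrite addr_ge0// ?divr_ge0 ?mulr_ge0 ?(ltW ld0) ?(ltW d0)//; lra.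
- by move=> z _; rewrite ler_norml cos_le1 cos_geN1.
- move=> h.
  have sub z : x <= z <= z0 - del -> x <= z <= y by move=> /andP[? ?]; apply/andP; split; lra.
  apply: (@van_der_corput2 R Phi f f1 f2) => //; try by move=> z /sub; auto.
  right=> z /andP[h1 h2]; have := gl z h1 ltac:(lra).
  have : l * del <= l * (z0 - z) by rewrite ler_pM2l//; lra.
  lra.
- move=> h.
  have sub z : z0 + del <= z <= y -> x <= z <= y by move=> /andP[? ?]; apply/andP; split; lra.
  apply: (@van_der_corput2 R Phi f f1 f2) => //; try by move=> z /sub; auto.
  left=> z /andP[h1 h2]; have := gr z ltac:(lra) h2.
  have : l * del <= l * (z - z0) by rewrite ler_pM2l//; lra.
  lra.
Qed.

Lemma van_der_corput3 (R : realType) (Phi f f1 f2 f3 : R -> R) (x y l del : R) :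
  x <= y -> 0 < l -> 0 < del ->
  (forall z, x <= z <= y -> is_derive z 1 Phi (cos (f z))) ->
  (forall z, x <= z <= y -> is_derive z 1 f (f1 z)) ->
  (forall z, x <= z <= y -> is_derive z 1 f1 (f2 z)) ->
  (forall z, x <= z <= y -> is_derive z 1 f2 (f3 z)) ->
  (forall z, x <= z <= y -> l <= f3 z) \/ (forall z, x <= z <= y -> f3 z <= - l) ->
  `|Phi y - Phi x| <= 8 / (l * del ^+ 2) + 6 * del.
Proof.
move=> xy l0 d0 Pd fd f1d f2d [f3s|f3s].
  exact: (@van_der_corput3_pos R Phi f f1 f2 f3).
apply: (@van_der_corput3_pos R Phi (\- f) (\- f1) (\- f2) (\- f3)) => //.
- by move=> z /Pd; rewrite /= cosN.
- by move=> z /fd h; apply: is_deriveN.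
- by move=> z /f1d h; apply: is_deriveN.
- by move=> z /f2d h; apply: is_deriveN.
- by move=> z /f3s /=; lra.
Qed.

(** * Phases with three exponents *)

Lemma is_derive_powR (R : realType) (p x : R) : 0 < x ->
  is_derive x 1 (fun y : R => y `^ p) (p * x `^ (p - 1)).
Proof.
move=> x0; have xin : x \in `]0, +oo[%R by rewrite in_itv/= andbT.
apply: DeriveDef; first exact: derivable_powR.
by rewrite -derive1E powR_derive1.
Qed.

(** [z^e] lies between [z^(-E)] and [z^E], and [2 - t <= 1/t] for [t > 0] makes the deviation below
    1 no larger than the one above. *)
Lemma powR_near1 (R : realType) (E e z : R) : `|e| <= E -> 1 <= z ->
  `|z `^ e - 1| <= z `^ E - 1.
Proof.
rewrite ler_norml => /andP[e1 e2] z1.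
have z0 : 0 < z by apply: lt_le_trans z1.
have h1 : z `^ e <= z `^ E by apply: ler_powR.
have h2 : z `^ (- E) <= z `^ e by apply: ler_powR.
have h3 : 1 <= z `^ E.
  by rewrite -(powRr0 z); apply: ler_powR => //; lra.
rewrite powRN in h2.
have h4 : 2 - z `^ E <= (z `^ E)^-1.
  have h0 : 0 < z `^ E by lra.
  rewrite -(ler_pM2r h0) mulVf ?gt_eqF//.
  by rewrite -subr_ge0 (_ : 1 - _ = (z `^ E - 1) ^+ 2) ?sqr_ge0//; ring.
by rewrite ler_norml; apply/andP; split; lra.
Qed.

(** The three right-hand expressions are the first three derivatives of [a z^p + b z^q + c z^r] at
    [z = 1]. Their matrix is row equivalent to a Vandermonde matrix with columns scaled by [p], [q],
    [r], hence invertible. *)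
Lemma vandermonde_lower (R : realType) (p q r : R) :
  p != 0 -> q != 0 -> r != 0 -> p != q -> p != r -> q != r ->
  exists2 c0 : R, 0 < c0 & forall a b c : R,
    c0 * (`|a| + `|b| + `|c|) <=
      `|p * a + q * b + r * c| +
      `|p * (p - 1) * a + q * (q - 1) * b + r * (r - 1) * c| +
      `|p * (p - 1) * (p - 2) * a + q * (q - 1) * (q - 2) * b +
        r * (r - 1) * (r - 2) * c|.
Proof.
move=> p0 q0 r0 pq pr qr.
have key (x y z : R) : x != 0 -> x != y -> x != z -> exists2 k : R, 0 < k &
    forall a b c, `|a| <= k * (`|x * a + y * b + z * c| +
      `|x * (x - 1) * a + y * (y - 1) * b + z * (z - 1) * c| +
      `|x * (x - 1) * (x - 2) * a + y * (y - 1) * (y - 2) * b +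
        z * (z - 1) * (z - 2) * c|).
  move=> x0 xy xz.
  (* A row of the inverse matrix: the coefficients of the Lagrange polynomial
     [t (t - y) (t - z) / (x (x - y) (x - z))], which is 1 at [x] and 0 at [y] and [z], in the basis
     [t], [t (t - 1)], [t (t - 1) (t - 2)]. *)
  pose k1 := (1 - (y + z) + y * z) / (x * (x - y) * (x - z)).
  pose k2 := (3 - (y + z)) / (x * (x - y) * (x - z)).
  pose k3 := (x * (x - y) * (x - z))^-1.
  exists (`|k1| + `|k2| + `|k3| + 1).
    by rewrite ltr_wpDl// !addr_ge0.
  move=> a b c; set F1 := x * a + y * b + z * c.
  set F2 := x * (x - 1) * a + y * (y - 1) * b + z * (z - 1) * c.
  set F3 := x * (x - 1) * (x - 2) * a + y * (y - 1) * (y - 2) * b + _.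
  rewrite [a in `|a|](_ : a = k1 * F1 + k2 * F2 + k3 * F3); last first.
    by rewrite /k1 /k2 /k3 /F1 /F2 /F3; field; rewrite x0 !subr_eq0 xy xz.
  move: k1 k2 k3 F1 F2 F3 => k1 k2 k3 F1 F2 F3.
  apply: (le_trans (ler_normD _ _)).
  apply: (le_trans (lerD (ler_normD _ _) (lexx _))).
  rewrite !normrM.
  have t (u v : R) := mulr_ge0 (normr_ge0 u) (normr_ge0 v).
  have := t k1 F2; have := t k1 F3; have := t k2 F1; have := t k2 F3.
  have := t k3 F1; have := t k3 F2.
  by have := normr_ge0 F1; have := normr_ge0 F2; have := normr_ge0 F3; lra.
have [ka ka0 Ha] := key p q r p0 pq pr.
have [kb kb0 Hb] := key q p r q0 ltac:(by rewrite eq_sym) qr.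
have [kc kc0 Hc] := key r p q r0 ltac:(by rewrite eq_sym) ltac:(by rewrite eq_sym).
have k0 : 0 < ka + kb + kc by rewrite !addr_gt0.
exists (ka + kb + kc)^-1; first by rewrite invr_gt0.
move=> a b c; rewrite ler_pdivrMl//.
have := Ha a b c; have := Hb b a c; have := Hc c a b.
have -> : r * c + p * a + q * b = p * a + q * b + r * c by ring.
have -> : r * (r - 1) * c + p * (p - 1) * a + q * (q - 1) * b =
  p * (p - 1) * a + q * (q - 1) * b + r * (r - 1) * c by ring.
have -> : r * (r - 1) * (r - 2) * c + p * (p - 1) * (p - 2) * a + q * (q - 1) * (q - 2) * b =
  p * (p - 1) * (p - 2) * a + q * (q - 1) * (q - 2) * b + r * (r - 1) * (r - 2) * c by ring.
have -> : q * b + p * a + r * c = p * a + q * b + r * c by ring.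
have -> : q * (q - 1) * b + p * (p - 1) * a + r * (r - 1) * c =
  p * (p - 1) * a + q * (q - 1) * b + r * (r - 1) * c by ring.
have -> : q * (q - 1) * (q - 2) * b + p * (p - 1) * (p - 2) * a + r * (r - 1) * (r - 2) * c =
  p * (p - 1) * (p - 2) * a + q * (q - 1) * (q - 2) * b + r * (r - 1) * (r - 2) * c by ring.
lra.
Qed.

Lemma is_derive_trinomial (R : realType) (p q r a b c th z : R) : 0 < z ->
  is_derive z 1 (fun z => a * z `^ p + b * z `^ q + c * z `^ r + th)
    (p * a * z `^ (p - 1) + q * b * z `^ (q - 1) + r * c * z `^ (r - 1)).
Proof.
move=> z0; have h1 := @is_derive_powR R p z z0; have h2 := @is_derive_powR R q z z0.
have h3 := @is_derive_powR R r z z0.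
by apply: is_derive_eq; rewrite /GRing.scale/=; ring.
Qed.

Lemma is_derive_trinomial0 (R : realType) (p q r a b c z : R) : 0 < z ->
  is_derive z 1 (fun z => a * z `^ p + b * z `^ q + c * z `^ r)
    (p * a * z `^ (p - 1) + q * b * z `^ (q - 1) + r * c * z `^ (r - 1)).
Proof.
move=> z0; have h1 := @is_derive_powR R p z z0; have h2 := @is_derive_powR R q z z0.
have h3 := @is_derive_powR R r z z0.
by apply: is_derive_eq; rewrite /GRing.scale/=; ring.
Qed.

Lemma trinomial_perturb (R : realType) (al be ga a b c x y z ep k : R) :
  0 <= ep -> `|al| <= k -> `|be| <= k -> `|ga| <= k ->
  `|x - 1| <= ep -> `|y - 1| <= ep -> `|z - 1| <= ep ->
  `|(al * a * x + be * b * y + ga * c * z) - (al * a + be * b + ga * c)|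
    <= ep * k * (`|a| + `|b| + `|c|).
Proof.
move=> ep0 ka kb kc hx hy hz.
have -> : (al * a * x + be * b * y + ga * c * z) - (al * a + be * b + ga * c) =
  al * a * (x - 1) + be * b * (y - 1) + ga * c * (z - 1) by ring.
apply: (le_trans (ler_normD _ _)).
apply: (le_trans (lerD (ler_normD _ _) (lexx _))).
rewrite !normrM !mulrDr.
have t (u v w : R) : `|u| <= k -> `|w - 1| <= ep -> `|u| * `|v| * `|w - 1| <= ep * k * `|v|.
  move=> hu hw; have -> : ep * k * `|v| = k * `|v| * ep by ring.
  by rewrite ler_pM// ?mulr_ge0// ler_pM.
by rewrite !lerD// t.
Qed.

Lemma sign_stable (R : realType) (P : R -> bool) (F w : R) (g : R -> R) :
  2 * w <= `|F| -> (forall z, P z -> `|g z - F| <= w) ->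
  (forall z, P z -> w <= g z) \/ (forall z, P z -> g z <= - w).
Proof.
move=> hF hg; have [F0|F0] := leP 0 F.
  by left=> z /hg; rewrite (ger0_norm F0) in hF; rewrite ler_norml; lra.
by right=> z /hg; rewrite (ltr0_norm F0) in hF; rewrite ler_norml; lra.
Qed.

Lemma one_third_large (R : realType) (c w x y z : R) :
  6 * c * w <= x + y + z -> 2 * (c * w) <= x \/ 2 * (c * w) <= y \/ 2 * (c * w) <= z.
Proof.
have [h1 _|h1] := leP (2 * (c * w)) x; first by left.
have [h2 _|h2] := leP (2 * (c * w)) y; first by right; left.
by move=> h3; right; right; lra.
Qed.

Lemma mvt_cos_le (R : realType) (Phi f : R -> R) (x y : R) : x <= y ->
  (forall z, x <= z <= y -> is_derive z 1 Phi (cos (f z))) ->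
  `|Phi y - Phi x| <= y - x.
Proof.
move=> xy Pd; rewrite -[leRHS]mul1r.
apply: (@mvt_norm_le R Phi (fun z => cos (f z))) => // z _.
by rewrite ler_norml cos_le1 cos_geN1.
Qed.

(** The relation [1 <= W * del ^+ 3] is calibrated on the third derivative test, the weakest one. If
    [del < 1] it gives [W^-1 <= del ^+ 3], so that the first and second derivative tests also yield
    a multiple of [del]; if [del >= 1] the length of [[1, lam]] is bound enough. *)
Lemma osc_piece_core (R : realType) (c1 k : R) : 0 < c1 -> 0 < k ->
  exists2 K : R, 0 < K & forall (Phi f f1 f2 f3 : R -> R) (lam W del : R),
  1 <= lam -> lam <= 2 -> 0 < W -> 0 < del -> 1 <= W * del ^+ 3 ->
  (forall z, 1 <= z <= lam -> is_derive z 1 Phi (cos (f z))) ->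
  (forall z, 1 <= z <= lam -> is_derive z 1 f (f1 z)) ->
  (forall z, 1 <= z <= lam -> is_derive z 1 f1 (f2 z)) ->
  (forall z, 1 <= z <= lam -> is_derive z 1 f2 (f3 z)) ->
  (forall z, 1 <= z <= lam -> `|f2 z| <= k * W) ->
  (exists2 g, g \in [:: f1; f2; f3] & (forall z, 1 <= z <= lam -> c1 * W <= g z) \/
      (forall z, 1 <= z <= lam -> g z <= - (c1 * W))) ->
  `|Phi lam - Phi 1| <= K * del.
Proof.
move=> c10 k0.
have [K2 K4 K8 Kk] : [/\ 0 <= 2 / c1, 0 <= 4 / c1, 0 <= 8 / c1 & 0 <= k / c1 ^+ 2].
  by rewrite !divr_ge0 ?exprn_ge0 ?ltW.
pose K := 1 + (2 / c1 + k / c1 ^+ 2) + (4 / c1 + 2) + (8 / c1 + 6).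
have KK : [/\ 0 < K, 1 <= K, 2 / c1 + k / c1 ^+ 2 <= K, 4 / c1 + 2 <= K & 8 / c1 + 6 <= K].
  by rewrite /K; split; lra.
case: KK; move: K => K K0 K1 Ka Kb Kc.
exists K => // Phi f f1 f2 f3 lam W del lam1 lam2 W0 d0 Wd Pd d1 d2 d3 f2k hg.
have [d1'|d1'] := leP 1 del.
  apply: (le_trans (@mvt_cos_le R Phi f 1 lam lam1 Pd)).
  apply: (@le_trans _ _ (1 * del)); last by rewrite ler_pM2r.
  by clear -d1' lam2; lra.
have W1 : W^-1 <= del ^+ 3 by rewrite -(ler_pM2l W0) mulfV ?gt_eqF.
have cW0 : 0 < c1 * W by rewrite mulr_gt0.
have del31 : del ^+ 3 <= del by rewrite -[leRHS]expr1 ler_wiXn2l// ltW.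
case: hg => g; rewrite !inE => /orP[/eqP -> s|/orP[/eqP ->|/eqP ->] s].
(* Nothing fixes the sign of [f2] when [f1] is the large derivative, hence the variant that works
   with a bound on [f2]. *)
- have h := @van_der_corput1_bounded R Phi f f1 f2 1 lam (c1 * W) (k * W) lam1 cW0 Pd d1 d2.
  apply: (le_trans (h _ _)) => //.
    move=> z hz; rewrite ler_normr; case: s => s; have := s z hz.
      by move=> ->.
    by rewrite lerNr => ->; rewrite orbT.
  have -> : 2 / (c1 * W) = 2 / c1 * W^-1 by field; rewrite !gt_eqF.
  have -> : k * W / (c1 * W) ^+ 2 * (lam - 1) = k / c1 ^+ 2 * W^-1 * (lam - 1).
    by field; rewrite !gt_eqF.
  have Wdel : W^-1 <= del by exact: le_trans del31.
  have t1 : 2 / c1 * W^-1 <= 2 / c1 * del by rewrite ler_wpM2l.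
  have t2 : k / c1 ^+ 2 * W^-1 * (lam - 1) <= k / c1 ^+ 2 * del * 1.
    rewrite ler_pM// ?subr_ge0//; first by rewrite mulr_ge0// invr_ge0 ltW.
      by rewrite ler_wpM2l.
    by clear -lam2; lra.
  by apply: (le_trans (lerD t1 t2)); rewrite mulr1 -mulrDl ler_pM2r.
- have h := @van_der_corput2 R Phi f f1 f2 1 lam (c1 * W) del lam1 cW0 d0 Pd d1 d2 s.
  apply: (le_trans h).
  have -> : 4 / (c1 * W * del) = 4 / c1 * (W^-1 / del) by field; rewrite !gt_eqF.
  have t1 : 4 / c1 * (W^-1 / del) <= 4 / c1 * del.
    rewrite ler_wpM2l// ler_pdivrMr// -expr2.
    by apply: (le_trans W1); rewrite exprS ler_piMl ?exprn_ge0// ltW.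
  by apply: (le_trans (lerD t1 (lexx _))); rewrite -mulrDl ler_pM2r.
- have h := @van_der_corput3 R Phi f f1 f2 f3 1 lam (c1 * W) del lam1 cW0 d0 Pd d1 d2 d3 s.
  apply: (le_trans h).
  have -> : 8 / (c1 * W * del ^+ 2) = 8 / c1 * (W^-1 / del ^+ 2) by field; rewrite !gt_eqF.
  have t1 : 8 / c1 * (W^-1 / del ^+ 2) <= 8 / c1 * del.
    by rewrite ler_wpM2l// ler_pdivrMr ?exprn_gt0// -exprS.
  by apply: (le_trans (lerD t1 (lexx _))); rewrite -mulrDl ler_pM2r.
Qed.

Lemma powR_near1_uniform (R : realType) (E ep : R) : 1 <= E -> 0 < ep -> ep <= 1 ->
  exists lam : R, [/\ 1 < lam, lam <= 2 &
    forall e z, `|e| <= E -> 1 <= z <= lam -> `|z `^ e - 1| <= ep].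
Proof.
move=> E1 ep0 ep1; have E0 : 0 < E by lra.
pose lam := (1 + ep) `^ E^-1.
have lamE : lam `^ E = 1 + ep.
  by rewrite /lam -powRrM mulVf ?gt_eqF// powRr1//; lra.
have lam1 : 1 < lam.
  rewrite /lam -[ltLHS](powRr0 (1 + ep)) /powR ifF ?ifF; try by apply/negbTE; lra.
  by rewrite ltr_expR ltr_pM2r ?invr_gt0// ln_gt0//; lra.
exists lam; split => //.
  have : lam <= lam `^ E by apply: le1r_powR => //; exact: ltW.
  by rewrite lamE; clear -ep1; lra.
move=> e z he /andP[z1 zl]; apply: le_trans (@powR_near1 R E e z he z1) _.
rewrite lerBlDr addrC -lamE; apply: ge0_ler_powR; rewrite ?nnegrE//.
- exact: ltW.
- exact: le_trans z1.
- by apply: ltW; exact: lt_trans lam1.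
Qed.

(** [[1, lam]] is so short, in terms of the exponents only, that each derivative stays within a
    small multiple of [|a| + |b| + |c|] of its value at 1. The derivative that the Vandermonde bound
    makes large at 1 therefore stays large, with one sign. *)
Lemma osc_piece (R : realType) (p q r : R) :
  p != 0 -> q != 0 -> r != 0 -> p != q -> p != r -> q != r ->
  exists lam K : R, [/\ 1 < lam, 0 < K & forall (a b c th : R) (Phi : R -> R),
    (forall z, 1 <= z <= lam ->
       is_derive z 1 Phi (cos (a * z `^ p + b * z `^ q + c * z `^ r + th))) ->
    forall del, 0 < del -> 1 <= (`|a| + `|b| + `|c|) * del ^+ 3 ->
    `|Phi lam - Phi 1| <= K * del].
Proof.
move=> p0 q0 r0 pq pr qr.
have [c0 c00 Hc] := @vandermonde_lower R p q r p0 q0 r0 pq pr qr.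
pose cs := [:: p; q; r; p * (p - 1); q * (q - 1); r * (r - 1);
  p * (p - 1) * (p - 2); q * (q - 1) * (q - 2); r * (r - 1) * (r - 2)].
pose k := \sum_(x <- cs) `|x| + 1.
have k0 : 0 < k by rewrite ltr_wpDl// sumr_ge0.
have kb (x : R) : x \in cs -> `|x| <= k.
  move=> xcs; rewrite /k (perm_big _ (perm_to_rem xcs))/= big_cons -addrA lerDl.
  by rewrite addr_ge0// sumr_ge0.
(* Of the total [6 * c1 * W], one of the three derivatives receives at least [2 * c1 * W] at 1; half
   of this is given up to the variation on [[1, lam]]. *)
pose c1 := c0 / 6.
have c0E : c0 = 6 * c1 by rewrite /c1; field.
have c10 : 0 < c1 by rewrite divr_gt0.
pose ep := Num.min 1 (c1 / k).
have ep0 : 0 < ep by rewrite lt_min ltr01 divr_gt0.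
have ep1 : ep <= 1 by rewrite ge_min lexx.
have epk : ep * k <= c1 by rewrite -ler_pdivlMr// ge_min lexx orbT.
(* Bounds every exponent that up to three differentiations produce. *)
pose E := `|p| + `|q| + `|r| + 3.
have E1 : 1 <= E by rewrite /E -[leLHS]add0r lerD ?addr_ge0// ler1n.
have [lam [lam1 lam2 pw]] := @powR_near1_uniform R E ep E1 ep0 ep1.
have Eb (x j : R) : x \in [:: p; q; r] -> 0 <= j <= 3 -> `|x - j| <= E.
  move=> hx /andP[j0 j3]; apply: (le_trans (ler_normB _ _)); rewrite (ger0_norm j0) lerD//.
  by move: hx; rewrite !inE => /orP[/eqP ->|/orP[/eqP ->|/eqP ->]];
    rewrite ?lerDr ?addr_ge0// -?addrA ?lerDl ?addr_ge0// addrCA lerDl addr_ge0.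
have j1 : 0 <= (1 : R) <= 3 by rewrite ?ler0n ?ler01 ?lexx ?ler1n ?ler_nat.
have j2 : 0 <= (2 : R) <= 3 by rewrite ?ler0n ?ler01 ?lexx ?ler1n ?ler_nat.
have j3 : 0 <= (3 : R) <= 3 by rewrite ?ler0n ?ler01 ?lexx ?ler1n ?ler_nat.
have tk0 : 0 < 2 * k by rewrite mulr_gt0.
have [K K0 core] := @osc_piece_core R c1 (2 * k) c10 tk0.
exists lam, K; split => // a b c th Phi Pd del d0; set W := (`|a| + `|b| + `|c|) => Wd.
have W0 : 0 < W.
  have : 0 <= W by rewrite /W !addr_ge0.
  rewrite le_eqVlt => /orP[/eqP W0|//]; move: Wd.
  by rewrite -W0 mul0r ler10.
have zpos z : 1 <= z <= lam -> 0 < z by move=> /andP[h _]; exact: lt_le_trans h.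
pose f z := a * z `^ p + b * z `^ q + c * z `^ r + th.
pose f1 z := p * a * z `^ (p - 1) + q * b * z `^ (q - 1) + r * c * z `^ (r - 1).
pose f2 z := (p * (p - 1)) * a * z `^ (p - 2) + (q * (q - 1)) * b * z `^ (q - 2) +
  (r * (r - 1)) * c * z `^ (r - 2).
pose f3 z := (p * (p - 1) * (p - 2)) * a * z `^ (p - 3) +
  (q * (q - 1) * (q - 2)) * b * z `^ (q - 3) + (r * (r - 1) * (r - 2)) * c * z `^ (r - 3).
set F1 := p * a + q * b + r * c.
set F2 := p * (p - 1) * a + q * (q - 1) * b + r * (r - 1) * c.
set F3 := p * (p - 1) * (p - 2) * a + q * (q - 1) * (q - 2) * b +
        r * (r - 1) * (r - 2) * c.
have n1 z : 1 <= z <= lam -> `|f1 z - F1| <= c1 * W.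
  move=> hz; apply: (le_trans _ (_ : ep * k * W <= _)); last by rewrite ler_pM2r.
  by apply: trinomial_perturb; rewrite ?(ltW ep0) ?kb ?inE ?eqxx ?orbT// pw// Eb// !inE eqxx ?orbT.
have n2 z : 1 <= z <= lam -> `|f2 z - F2| <= c1 * W.
  move=> hz; apply: (le_trans _ (_ : ep * k * W <= _)); last by rewrite ler_pM2r.
  by apply: trinomial_perturb; rewrite ?(ltW ep0) ?kb ?inE ?eqxx ?orbT// pw// Eb// !inE eqxx ?orbT.
have n3 z : 1 <= z <= lam -> `|f3 z - F3| <= c1 * W.
  move=> hz; apply: (le_trans _ (_ : ep * k * W <= _)); last by rewrite ler_pM2r.
  by apply: trinomial_perturb; rewrite ?(ltW ep0) ?kb ?inE ?eqxx ?orbT// pw// Eb// !inE eqxx ?orbT.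
apply: (core Phi f f1 f2 f3 lam W del (ltW lam1) lam2 W0 d0 Wd Pd).
- by move=> z /zpos z0; apply: is_derive_trinomial.
- move=> z /zpos z0; have := @is_derive_trinomial0 R (p-1) (q-1) (r-1) (p*a) (q*b) (r*c) z z0.
  rewrite /f2 /f1; have t (x : R) : x - 1 - 1 = x - 2 by ring.
  by rewrite !t => h; apply: is_derive_eq; ring.
- move=> z /zpos z0; have := @is_derive_trinomial0 R (p-2) (q-2) (r-2) (p*(p-1)*a) (q*(q-1)*b)
    (r*(r-1)*c) z z0.
  rewrite /f3 /f2; have t (x : R) : x - 2 - 1 = x - 3 by ring.
  by rewrite !t => h; apply: is_derive_eq; ring.
- move=> z hz; rewrite /f2.
  apply: (le_trans (ler_normD _ _)).
  apply: (le_trans (lerD (ler_normD _ _) (lexx _))).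
  have t (u v w : R) : `|u| <= k -> `|w - 1| <= ep -> `|u * v * w| <= 2 * k * `|v|.
    move=> hu hw; rewrite !normrM; have -> : 2 * k * `|v| = k * `|v| * 2 by ring.
    rewrite ler_pM// ?mulr_ge0//; first by rewrite ler_pM.
    have -> : w = (w - 1) + 1 by ring.
    apply: (le_trans (ler_normD _ _)); rewrite normr1.
    by have -> : 2 = 1 + 1 :> R by []; rewrite lerD// (le_trans hw).
  rewrite [leRHS](_ : _ = 2 * k * `|a| + 2 * k * `|b| + 2 * k * `|c|); last by rewrite /W; ring.
  apply: lerD; first apply: lerD.
  + by apply: t; rewrite ?kb ?inE ?eqxx ?orbT// pw// Eb// !inE eqxx ?orbT.
  + by apply: t; rewrite ?kb ?inE ?eqxx ?orbT// pw// Eb// !inE eqxx ?orbT.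
  + by apply: t; rewrite ?kb ?inE ?eqxx ?orbT// pw// Eb// !inE eqxx ?orbT.
have := Hc a b c; rewrite -/W -/F1 -/F2 -/F3 c0E => /one_third_large[hF|[hF|hF]].
- by exists f1; rewrite ?inE ?eqxx//; exact: sign_stable hF n1.
- by exists f2; rewrite ?inE ?eqxx ?orbT//; exact: sign_stable hF n2.
- by exists f3; rewrite ?inE ?eqxx ?orbT//; exact: sign_stable hF n3.
Qed.

(** [K * w^e] equals [K' * ((lam * w)^e - w^e)] with [K' = K / (lam^e - 1)], so the bounds on the
    pieces from [X / lam^(n+1)] to [X / lam^n] telescope. The bound [|Phi u - Phi 0| <= u] closes
    the gap at 0, where [Phi] is not assumed differentiable. *)
Lemma geometric_telescope (R : realType) (Phi : R -> R) (lam K e : R) :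
  1 < lam -> 0 < e -> 0 <= K ->
  (forall w, 0 < w -> `|Phi (lam * w) - Phi w| <= K * w `^ e) ->
  (forall u, 0 < u -> `|Phi u - Phi 0| <= u) ->
  forall X, 0 < X -> `|Phi X - Phi 0| <= K / (lam `^ e - 1) * X `^ e.
Proof.
move=> lam1 e0 K0 HP H0 X X0.
have lam0 : 0 < lam by lra.
have le1 : 1 < lam `^ e.
  rewrite -[ltLHS](powRr0 lam) /powR !ifF ?gt_eqF//.
  by rewrite ltr_expR ltr_pM2r ?ln_gt0.
set K' := K / (lam `^ e - 1).
have KE : K = K' * (lam `^ e - 1) by rewrite /K' divfK// gt_eqF// subr_gt0.
have K'0 : 0 <= K' by rewrite divr_ge0// subr_ge0 ltW.
have tele n : `|Phi X - Phi (X / lam ^+ n)| <= K' * (X `^ e - (X / lam ^+ n) `^ e).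
  elim: n => [|n IH]; first by rewrite expr0 divr1 !subrr normr0 mulr0.
  have -> : Phi X - Phi (X / lam ^+ n.+1) =
    (Phi X - Phi (X / lam ^+ n)) + (Phi (X / lam ^+ n) - Phi (X / lam ^+ n.+1)) by ring.
  apply: (le_trans (ler_normD _ _)).
  have w0 : 0 < X / lam ^+ n.+1 by rewrite divr_gt0// exprn_gt0.
  have wE : X / lam ^+ n = lam * (X / lam ^+ n.+1).
    by rewrite exprS; field; rewrite ?expf_neq0 ?gt_eqF.
  have := HP _ w0; rewrite -wE => h; apply: (le_trans (lerD IH h)).
  rewrite {1}KE wE powRM ?(ltW lam0) ?(ltW w0)//.
  by rewrite le_eqVlt; apply/orP; left; apply/eqP; ring.
have lim : (fun n => X / lam ^+ n) @ \oo --> (0 : R).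
  rewrite -[0](mulr0 X); apply: cvgMr.
  have -> : (fun n => (lam ^+ n)^-1) = (fun n => lam^-1 ^+ n).
    by apply/funext => n; rewrite exprVn.
  by apply: cvg_expr; rewrite ger0_norm ?invr_ge0 ?(ltW lam0)// invf_lt1.
apply/ler_addgt0Pr => eps eps0.
have /cvgrPdist_le /(_ _ eps0)[N _ /(_ N (leqnn N))] := lim.
rewrite /= sub0r normrN => hN.
have w0 : 0 < X / lam ^+ N by rewrite divr_gt0// exprn_gt0.
have -> : Phi X - Phi 0 = (Phi X - Phi (X / lam ^+ N)) + (Phi (X / lam ^+ N) - Phi 0) by ring.
apply: (le_trans (ler_normD _ _)); apply: lerD.
  apply: (le_trans (tele N)); rewrite ler_wpM2l// lerBlDr lerDl powR_ge0//.
by apply: (le_trans (H0 _ w0)); apply: le_trans (ler_norm _) hN.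
Qed.

Lemma is_derive_rescale (R : realType) (Phi : R -> R) (w z l : R) : w != 0 ->
  is_derive (w * z) 1 Phi l -> is_derive z 1 (fun y => Phi (w * y) / w) l.
Proof.
move=> w0 h.
have h2 : is_derive z 1 (fun y : R => w * y) w.
  by apply: is_derive_eq; rewrite /GRing.scale/= mulr1.
have h3 : is_derive z 1 (fun y => Phi (w * y)) (l * w).
  exact: (@is_derive1_comp R Phi (fun y => w * y) z l w h h2).
by apply: is_derive_eq; rewrite /GRing.scale/=; field.
Qed.

(** Rescaling [[w, lam * w]] to [[1, lam]] turns [A] into [A w^p]. Keeping only this coefficient
    permits [del = (|A| w^p)^(-1/3)], and the piece contributes a multiple of
    [w * del = |A|^(-1/3) w^(1 - p/3)]. The exponent of [w] is positive since [p < 3], so the pieces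
    sum geometrically. *)
Lemma osc_initial (R : realType) (p q r : R) :
  0 < p -> p < 3 -> q != 0 -> r != 0 -> p != q -> p != r -> q != r ->
  exists2 K : R, 0 < K & forall (A B C th : R) (Phi : R -> R), A != 0 ->
    (forall z : R, 0 < z ->
       is_derive z 1 Phi (cos (A * z `^ p + B * z `^ q + C * z `^ r + th))) ->
    (forall u, 0 < u -> `|Phi u - Phi 0| <= u) ->
    forall X, 0 < X -> `|Phi X - Phi 0| <= K * (`|A| `^ (- 3^-1) * X `^ (1 - p / 3)).
Proof.
move=> p0 p3 q0 r0 pq pr qr.
have [lam [K [lam1 K0 HP]]] := @osc_piece R p q r (lt0r_neq0 p0) q0 r0 pq pr qr.
have e0 : 0 < 1 - p / 3 by lra.
have le1 : 1 < lam `^ (1 - p / 3).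
  rewrite -[ltLHS](powRr0 lam) /powR !ifF ?gt_eqF//; try by apply: lt_trans lam1.
  by rewrite ltr_expR ltr_pM2r ?ln_gt0.
exists (K / (lam `^ (1 - p / 3) - 1)).
  by rewrite divr_gt0// subr_gt0.
move=> A B C th Phi A0 Pd P0 X X0.
have nA : 0 < `|A| by rewrite normr_gt0.
rewrite mulrA [K / _ * _]mulrAC.
apply: (@geometric_telescope R Phi lam (K * `|A| `^ (- 3^-1)) (1 - p / 3)) => //.
  by rewrite mulr_ge0 ?powR_ge0// ltW.
move=> w w0.
pose del := (`|A| * w `^ p) `^ (- 3^-1).
have wp0 : 0 < `|A| * w `^ p by rewrite mulr_gt0// powR_gt0.
have d0 : 0 < del by rewrite powR_gt0.
have d3 : del ^+ 3 = (`|A| * w `^ p)^-1.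
  rewrite -powR_mulrn ?(ltW d0)// /del -powRrM (_ : - 3^-1 * 3%:R = -1); last by field.
  by rewrite powR_inv1 ?(ltW wp0).
have hd (z : R) : 1 <= z <= lam -> is_derive z 1 (fun y => Phi (w * y) / w)
    (cos (A * w `^ p * z `^ p + B * w `^ q * z `^ q + C * w `^ r * z `^ r + th)).
  move=> /andP[z1 _]; have z0 : 0 < z by apply: lt_le_trans z1.
  apply: is_derive_rescale; first exact: lt0r_neq0.
  have := Pd (w * z) ltac:(by rewrite mulr_gt0).
  by rewrite !powRM ?(ltW w0) ?(ltW z0)// !mulrA.
have hW : 1 <= (`|A * w `^ p| + `|B * w `^ q| + `|C * w `^ r|) * del ^+ 3.
  rewrite d3 !normrM (ger0_norm (powR_ge0 w p)) -ler_pdivrMr ?invr_gt0// invrK mul1r.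
  by rewrite -addrA lerDl addr_ge0// mulr_ge0.
have := HP _ _ _ _ _ hd del d0 hW.
rewrite mulr1 -mulrBl normrM normfV (gtr0_norm w0) ler_pdivrMr// [w * lam]mulrC.
move=> h; apply: (le_trans h).
have wE : w `^ (1 - p / 3) = (w `^ p) `^ (- 3^-1) * w.
  rewrite -powRrM (_ : 1 - p / 3 = p * - 3^-1 + 1); last by field.
  by rewrite powRD ?powRr1 ?(ltW w0)// (gt_eqF w0) implybT.
by rewrite /del powRM ?powR_ge0// wE !mulrA.
Qed.

(** Past [u0] the top term is at least twice each of the other two, which makes [f1] at least
    [C * u0^(r - 1)] and [f2] nonnegative. The first derivative test then gives a bound free of the
    length of the interval. *)
Lemma osc_tail (R : realType) (p q r A B C th : R) (Phi : R -> R) (u0 : R) :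
  0 < p -> p < 1 -> 0 < q -> q < 1 -> 3 <= r -> 0 < C -> 0 < u0 -> u0 <= 1 ->
  (forall z : R, 0 < z ->
     is_derive z 1 Phi (cos (A * z `^ p + B * z `^ q + C * z `^ r + th))) ->
  (forall u, u0 <= u -> `|A| * u `^ p <= C * u `^ r / 2) ->
  (forall u, u0 <= u -> `|B| * u `^ q <= C * u `^ r / 2) ->
  `|Phi 1 - Phi u0| <= 2 / (C * u0 `^ (r - 1)).
Proof.
move=> p0 p1 q0 q1 r3 C0 u00 u01 Pd HA HB.
pose f z := A * z `^ p + B * z `^ q + C * z `^ r + th.
pose f1 z := p * A * z `^ (p - 1) + q * B * z `^ (q - 1) + r * C * z `^ (r - 1).
pose f2 z := (p - 1) * (p * A) * z `^ (p - 1 - 1) + (q - 1) * (q * B) * z `^ (q - 1 - 1) +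
  (r - 1) * (r * C) * z `^ (r - 1 - 1).
have pos z : u0 <= z <= 1 -> 0 < z by move=> /andP[h _]; apply: lt_le_trans h.
have mA z (k : R) : u0 <= z -> `|k| <= 1 -> - (C * z `^ r / 2) <= k * A * z `^ p.
  move=> hz hk; have z0 : 0 < z by apply: lt_le_trans hz.
  rewrite lerNl; apply: le_trans (HA z hz); apply: le_trans (ler_norm _) _.
  rewrite normrN !normrM (ger0_norm (powR_ge0 _ _)) ler_wpM2r ?powR_ge0//.
  by rewrite ler_piMl.
have mB z (k : R) : u0 <= z -> `|k| <= 1 -> - (C * z `^ r / 2) <= k * B * z `^ q.
  move=> hz hk; have z0 : 0 < z by apply: lt_le_trans hz.
  rewrite lerNl; apply: le_trans (HB z hz); apply: le_trans (ler_norm _) _.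
  rewrite normrN !normrM (ger0_norm (powR_ge0 _ _)) ler_wpM2r ?powR_ge0//.
  by rewrite ler_piMl.
have pB1 (e z : R) : 0 < z -> z `^ (e - 1) = z `^ e / z.
  by move=> z0; rewrite powRB ?powRr1 ?(ltW z0)// (gt_eqF z0) implybT.
have Cz z : 0 < z -> 0 < C * z `^ r by move=> ?; rewrite mulr_gt0 ?powR_gt0.
apply: (@van_der_corput1 R Phi f f1 f2 u0 1) => //.
- by rewrite mulr_gt0// powR_gt0.
- by move=> z /pos; exact: Pd.
- by move=> z /pos z0; apply: is_derive_trinomial.
- by move=> z /pos z0; apply: is_derive_trinomial0.
- left=> z hz; have z0 := pos z hz; have /andP[uz _] := hz.
  have C1 : C * u0 `^ (r - 1) <= C * z `^ (r - 1).
    rewrite ler_pM2l//; apply: ge0_ler_powR; rewrite ?nnegrE ?(ltW u00) ?(ltW z0)//.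
    by clear -r3; lra.
  apply: (le_trans C1); rewrite /f1 !pB1// !mulrA -!mulrDl ler_pM2r ?invr_gt0//.
  have := mA z p uz ltac:(by rewrite gtr0_norm// ltW).
  have := mB z q uz ltac:(by rewrite gtr0_norm// ltW).
  have := Cz z z0; have : 0 <= (r - 3) * (C * z `^ r).
    by rewrite mulr_ge0 ?subr_ge0// ltW// Cz.
  by clear; lra.
- left=> z hz; have z0 := pos z hz; have /andP[uz _] := hz.
  rewrite /f2 !pB1// !mulrA -!mulrDl !mulr_ge0 ?invr_ge0 ?(ltW z0)//.
  have h (e : R) : 0 < e -> e < 1 -> `|(e - 1) * e| <= 1.
    move=> e0 e1; rewrite normrM ltr0_norm ?subr_lt0// gtr0_norm//.
    by rewrite mulr_ile1// ?(ltW e0) ?(ltW e1)//; clear -e0 e1; lra.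
  have := mA z _ uz (h p p0 p1); have := mB z _ uz (h q q0 q1).
  have := Cz z z0; have : 0 <= (r - 3) * (C * z `^ r).
    by rewrite mulr_ge0 ?subr_ge0// ltW// Cz.
  have : 0 <= (r - 3) * (r - 3) * (C * z `^ r).
    by rewrite !mulr_ge0 ?subr_ge0// ltW ?powR_gt0.
  by clear; lra.
Qed.

Lemma dominated_beyond (R : realType) (p r A C u0 u : R) : p < r -> 0 < C ->
  (2 * `|A| / C) `^ (r - p)^-1 <= u0 -> 0 < u0 -> u0 <= u ->
  `|A| * u `^ p <= C * u `^ r / 2.
Proof.
move=> pr C0 hu u00 u0u; have u0' : 0 < u by apply: lt_le_trans u0u.
have rp : 0 < r - p by rewrite subr_gt0.
have x0 : 0 <= 2 * `|A| / C by rewrite divr_ge0 ?mulr_ge0 ?(ltW C0).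
have h : 2 * `|A| / C <= u `^ (r - p).
  have -> : 2 * `|A| / C = ((2 * `|A| / C) `^ (r - p)^-1) `^ (r - p).
    by rewrite -powRrM mulVf ?gt_eqF// powRr1.
  apply: ge0_ler_powR; rewrite ?nnegrE ?powR_ge0 ?(ltW rp) ?(ltW u0')//.
  exact: le_trans u0u.
have -> : u `^ r = u `^ (r - p) * u `^ p.
  by rewrite -powRD ?subrK// (gt_eqF u0') implybT.
have -> : C * (u `^ (r - p) * u `^ p) / 2 = (C * u `^ (r - p) / 2) * u `^ p by ring.
rewrite ler_wpM2r ?powR_ge0//.
by move: h; rewrite ler_pdivrMr// ler_pdivlMr// [_ * 2]mulrC [C * _]mulrC.
Qed.

(** Solving the definition of [uA] for [|A|] gives [|A| = (C / 2) uA^(r - p)], so at [X = uA] the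
    left side is [(C / 2)^(-1/3) uA^(-(r - 3)/3)]. The last exponent is nonpositive because
    [r >= 3], and [uA >= C^(-1/r)] finishes, the surplus factor being [2^(1/3) <= 2]. *)
Lemma initial_scale (R : realType) (p r A C X uA : R) :
  0 < p -> p < 1 -> 3 <= r -> 0 < C -> A != 0 ->
  uA = (2 * `|A| / C) `^ (r - p)^-1 -> C `^ (- r^-1) <= uA -> 0 < X -> X <= uA ->
  `|A| `^ (- 3^-1) * X `^ (1 - p / 3) <= 2 * C `^ (- r^-1).
Proof.
move=> p0 p1 r3 C0 A0 uE Tu X0 Xu.
have r0 : 0 < r by lra.
have rp : 0 < r - p by lra.
have nA : 0 < `|A| by rewrite normr_gt0.
have u0 : 0 < uA by rewrite uE powR_gt0// divr_gt0// mulr_gt0.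
have T0 : 0 < C `^ (- r^-1) by rewrite powR_gt0.
have AE : `|A| = C / 2 * uA `^ (r - p).
  by rewrite uE -powRrM mulVf ?gt_eqF// powRr1 ?divr_ge0 ?mulr_ge0 ?(ltW C0)//; field; rewrite gt_eqF.
apply: (@le_trans _ _ (`|A| `^ (- 3^-1) * uA `^ (1 - p / 3))).
  rewrite ler_wpM2l ?powR_ge0//; apply: ge0_ler_powR; rewrite ?nnegrE ?(ltW X0) ?(ltW u0)//; lra.
have C2 : 0 < C / 2 by rewrite divr_gt0.
rewrite AE powRM ?powR_ge0 ?(ltW C2)// -powRrM -mulrA -powRD; last first.
  by rewrite (gt_eqF u0) implybT.
have -> : (r - p) * - 3^-1 + (1 - p / 3) = - ((r - 3) / 3) by field.
have h1 : uA `^ (- ((r - 3) / 3)) <= (C `^ (- r^-1)) `^ (- ((r - 3) / 3)).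
  rewrite !powRN lef_pV2 ?posrE ?powR_gt0//; last by rewrite invr_gt0 powR_gt0.
  rewrite -powRN; apply: ge0_ler_powR; rewrite ?nnegrE ?(ltW T0) ?(ltW u0)//.
  by rewrite divr_ge0// subr_ge0.
apply: (le_trans (ler_wpM2l (powR_ge0 _ _) h1)).
rewrite powRM ?invr_ge0 ?(ltW C0)//.
have -> : 2^-1 `^ (- 3^-1) = 2 `^ 3^-1 :> R 
  by rewrite -[2^-1]powR_inv1// -powRrM mulN1r opprK.
have h2 : 2 `^ 3^-1 <= 2 :> R.
  by apply: ler1_powR; lra.
rewrite -powRrM [C `^ _ * _]mulrC -mulrA -powRD; last by rewrite (gt_eqF C0) implybT.
rewrite (_ : - 3^-1 + - r^-1 * - ((r - 3) / 3) = - r^-1); last by field; rewrite gt_eqF.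
by rewrite ler_pM2r.
Qed.

(** The range is cut at [us]. The points [uA] and [uB] are where a lower term has half the size of
    the top one, and [T = C^(-1/r)] is where the top term is 1. Beyond [us] the tail bound applies.
    Before it, the trivial bound does if [us = T], and otherwise the summed estimate for the lower
    term that determines [us]. *)
Lemma osc_trinomial_pos (R : realType) (p q r : R) :
  0 < p -> p < 1 -> 0 < q -> q < 1 -> p != q -> 3 <= r ->
  exists2 K : R, 0 < K & forall (A B C th : R) (Phi : R -> R), 0 < C ->
    (forall z : R, 0 < z ->
       is_derive z 1 Phi (cos (A * z `^ p + B * z `^ q + C * z `^ r + th))) ->
    (forall u, 0 < u -> `|Phi u - Phi 0| <= u) ->
    `|Phi 1 - Phi 0| <= K * C `^ (- r^-1).
Proof.
move=> p0 p1 q0 q1 pq r3.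
have r0 : 0 < r by lra.
have [pr qr] : p != r /\ q != r by split; apply/eqP; lra.
have [KA KA0 HA] := @osc_initial R p q r p0 ltac:(lra) (lt0r_neq0 q0) (lt0r_neq0 r0) pq pr qr.
have [KB KB0 HB] := @osc_initial R q p r q0 ltac:(lra) (lt0r_neq0 p0) (lt0r_neq0 r0)
  ltac:(by rewrite eq_sym) qr pr.
exists (2 * KA + 2 * KB + 3); first by rewrite !addr_gt0// mulr_gt0.
move=> A B C th Phi C0 Pd P0.
set T := C `^ (- r^-1).
have T0 : 0 < T by rewrite powR_gt0.
set uA := (2 * `|A| / C) `^ (r - p)^-1.
set uB := (2 * `|B| / C) `^ (r - q)^-1.
pose us := Num.max T (Num.max uA uB).
have usT : T <= us by rewrite /us le_max lexx.
have usA : uA <= us by rewrite /us !le_max lexx orbT.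
have usB : uB <= us by rewrite /us !le_max lexx !orbT.
have us0 : 0 < us by apply: lt_le_trans usT.
pose X := Num.min us 1.
have X0 : 0 < X by rewrite lt_min us0 ltr01.
have X1 : X <= 1 by rewrite ge_min lexx orbT.
have Xus : X <= us by rewrite ge_min lexx.
have tail : `|Phi 1 - Phi X| <= 2 * T.
  rewrite /X; case: (leP us 1) => us1; last first.
    by rewrite subrr normr0 mulr_ge0// ltW.
  apply: (le_trans (@osc_tail R p q r A B C th Phi us p0 p1 q0 q1 r3 C0 us0 us1 Pd _ _)).
  - by move=> u hu; apply: (@dominated_beyond R p r A C us) => //; lra.
  - by move=> u hu; apply: (@dominated_beyond R q r B C us) => //; lra.
  - rewrite ler_pM2l// -[T]invrK lef_pV2 ?posrE ?invr_gt0 ?mulr_gt0 ?powR_gt0//.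
    (* This is [C * T^r = 1], the choice of [T]. *)
    have -> : T^-1 = C * T `^ (r - 1).
      rewrite /T -powRrM -powRN opprK -[X in X * _](powRr1 (ltW C0)) -powRD.
        by congr (_ `^ _); field; rewrite gt_eqF.
      by rewrite (gt_eqF C0) implybT.
    rewrite ler_pM2l//; apply: ge0_ler_powR; rewrite ?nnegrE ?(ltW T0) ?(ltW us0)//.
    by rewrite subr_ge0; clear -r3; lra.
have KAT : 0 < KA * T by rewrite mulr_gt0.
have KBT : 0 < KB * T by rewrite mulr_gt0.
have head : `|Phi X - Phi 0| <= T + 2 * (KA * T) + 2 * (KB * T).
  have [usE|[usE|usE]] : us = T \/ us = uA \/ us = uB.
    rewrite /us; case: (leP T _) => _; last by left.
    by case: (leP uA uB) => _; right; [right|left].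
  - apply: (le_trans (P0 X X0)); apply: (le_trans Xus); rewrite usE.
    by clear -KAT KBT; lra.
  - have A0 : A != 0.
      apply: contraTneq us0 => A0; rewrite usE /uA A0 normr0 mulr0 mul0r powR0 ?ltxx//.
      by rewrite invr_eq0 subr_eq0 eq_sym.
    apply: (le_trans (HA A B C th Phi A0 Pd P0 X X0)).
    have h := @initial_scale R p r A C X uA p0 p1 r3 C0 A0 erefl.
    have {}h := h ltac:(by rewrite -/T -usE) X0 ltac:(by rewrite -usE).
    apply: (le_trans (ler_wpM2l (ltW KA0) h)); rewrite -/T.
    by clear -KAT KBT T0; lra.
  - have B0 : B != 0.
      apply: contraTneq us0 => B0; rewrite usE /uB B0 normr0 mulr0 mul0r powR0 ?ltxx//.
      by rewrite invr_eq0 subr_eq0 eq_sym.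
    have Pd' (z : R) : 0 < z ->
        is_derive z 1 Phi (cos (B * z `^ q + A * z `^ p + C * z `^ r + th)).
      by move=> /Pd; rewrite [A * _ + _]addrC.
    apply: (le_trans (HB B A C th Phi B0 Pd' P0 X X0)).
    have h := @initial_scale R q r B C X uB q0 q1 r3 C0 B0 erefl.
    have {}h := h ltac:(by rewrite -/T -usE) X0 ltac:(by rewrite -usE).
    apply: (le_trans (ler_wpM2l (ltW KB0) h)); rewrite -/T.
    by clear -KAT KBT T0; lra.
have -> : Phi 1 - Phi 0 = (Phi 1 - Phi X) + (Phi X - Phi 0) by ring.
apply: (le_trans (ler_normD _ _)); apply: (le_trans (lerD tail head)).
by rewrite le_eqVlt; apply/orP; left; apply/eqP; ring.
Qed.

Lemma osc_trinomial (R : realType) (p q r : R) :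
  0 < p -> p < 1 -> 0 < q -> q < 1 -> p != q -> 3 <= r ->
  exists2 K : R, 0 < K & forall (A B C th : R) (Phi : R -> R), C != 0 ->
    (forall z : R, 0 < z ->
       is_derive z 1 Phi (cos (A * z `^ p + B * z `^ q + C * z `^ r + th))) ->
    (forall u, 0 < u -> `|Phi u - Phi 0| <= u) ->
    `|Phi 1 - Phi 0| <= K * `|C| `^ (- r^-1).
Proof.
move=> p0 p1 q0 q1 pq r3.
have [K K0 H] := @osc_trinomial_pos R p q r p0 p1 q0 q1 pq r3.
exists K => // A B C th Phi C0 Pd P0.
have [Cp|Cn|CE] := ltgtP 0 C.
- by rewrite (gtr0_norm Cp); apply: (H A B C th).
- rewrite (ltr0_norm Cn); apply: (H (- A) (- B) (- C) (- th)) => //; first by rewrite oppr_gt0.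
  move=> z /Pd; rewrite -cosN; congr (is_derive _ _ _ (cos _)); ring.
- by rewrite -CE eqxx in C0.
Qed.

(** * Lower bounds for functions of finite type *)

Lemma mvt_oo (R : realType) (f df : R -> R) (x y : R) : x < y ->
  (forall z, x <= z <= y -> is_derive z 1 f (df z)) ->
  exists2 z, x < z < y & f y - f x = df z * (y - x).
Proof.
move=> xy fd; have [||z] := @MVT R f df x y xy.
- by move=> z; rewrite in_itv/= => /andP[xz zy]; apply: fd; rewrite !ltW.
- apply: derivable_within_continuous => z; rewrite in_itv/= => zxy.
  by have [] := fd _ zxy.
by rewrite in_itv/= => zxy e; exists z.
Qed.

(** [h0] is monotone, and [w0] is a zero of it, or an endpoint if there is none. Let [rho] be the
    distance from [z] to the nearest of [x], [y], [w0]. A step of length [rho / 2] from [z] towards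
    [w0] does not change the sign of [h0] and stays [rho / 2] away from both ends, where
    [h1 >= c (rho / 2)^k]. The change of [h0] along the step bounds [|h0 z|] from below. *)
Lemma gap_lower_nneg (R : realType) (k : nat) (h0 h1 : R -> R) (x y c : R) :
  x <= y -> 0 < c ->
  (forall z, x <= z <= y -> is_derive z 1 h0 (h1 z)) ->
  (forall z, x < z < y -> 0 <= h1 z) ->
  (forall z, x <= z <= y -> exists2 w, w \in [:: x; y] & c * `|z - w| ^+ k <= `|h1 z|) ->
  exists w0, forall z, x <= z <= y ->
    exists2 w, w \in [:: x; y; w0] & c / 2 ^+ k.+1 * `|z - w| ^+ k.+1 <= `|h0 z|.
Proof.
move=> xy c0 d0 h1p H.
have mono u v : x <= u -> u <= v -> v <= y -> h0 u <= h0 v.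
  move=> xu; rewrite le_eqVlt => /orP[/eqP -> //|uv] vy.
  have [t|z /andP[uz zv] E] := @mvt_oo R h0 h1 u v uv.
    by move=> /andP[ut tv]; apply: d0; rewrite (le_trans xu ut) (le_trans tv vy).
  rewrite -subr_ge0 E mulr_ge0 ?subr_ge0 ?(ltW uv)//; apply: h1p.
  by rewrite (le_lt_trans xu uz) (lt_le_trans zv vy).
have [w0 [xw wy wl wr]] : exists w0, [/\ x <= w0, w0 <= y,
    (forall z, x <= z -> z <= w0 -> z < w0 -> h0 z <= 0) &
    (forall z, w0 < z -> z <= y -> 0 <= h0 z)].
  have [hx|hx] := leP 0 (h0 x).
    exists x; split => // z.
      by move=> xz zx; rewrite ltNge xz.
    by move=> xz zy; apply: (le_trans hx); apply: mono => //; exact: ltW.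
  have [hy|hy] := leP (h0 y) 0.
    exists y; split => // z.
      by move=> xz zy _; apply: le_trans hy; apply: mono.
    by move=> yz; rewrite leNgt yz.
  have [w /andP[xw wy] w0] := @derive_ivt0 R h0 h1 x y xy d0 (ltW hx) (ltW hy).
  exists w; split => // z.
    by move=> xz zw _; rewrite -w0; apply: mono.
  by move=> wz zy; rewrite -w0; apply: mono => //; exact: ltW.
exists w0 => z /andP[xz zy].
pose rho := Num.min (z - x) (Num.min (y - z) `|z - w0|).
have [w wl' wE] : exists2 w, w \in [:: x; y; w0] & `|z - w| = rho.
  rewrite /rho; case: (leP (z - x)) => _.
    by exists x; rewrite ?inE ?eqxx// ger0_norm ?subr_ge0.
  case: (leP (y - z)) => _.
    by exists y; rewrite ?inE ?eqxx ?orbT// distrC ger0_norm ?subr_ge0.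
  by exists w0; rewrite ?inE ?eqxx ?orbT.
exists w => //; rewrite wE.
have r1 : rho <= z - x by rewrite ge_min lexx.
have r2 : rho <= y - z by rewrite !ge_min lexx orbT.
have r3 : rho <= `|z - w0| by rewrite !ge_min lexx !orbT.
have r0 : 0 <= rho by rewrite !le_min !subr_ge0 xz zy normr_ge0.
have cE : c / 2 ^+ k.+1 * rho ^+ k.+1 = c * (rho / 2) ^+ k * (rho / 2).
  by rewrite -[RHS]mulrA -exprSr expr_div_n mulrAC -mulrA.
move: r0; rewrite le_eqVlt => /orP[/eqP r0|r0].
  by rewrite -r0 expr0n/= mulr0.
have h1big t : x < t < y -> rho / 2 <= t - x -> rho / 2 <= y - t -> c * (rho / 2) ^+ k <= h1 t.
  move=> /andP[xt ty] t1 t2; rewrite -(@ger0_norm _ (h1 t)); last by apply: h1p; rewrite xt.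
  have [|v vin] := H t; first by rewrite !ltW.
  apply: le_trans; rewrite ler_pM2l// lerXn2r ?nnegrE ?divr_ge0 ?(ltW r0)//.
  move: vin; rewrite !inE => /orP[/eqP ->|/eqP ->].
    by rewrite ger0_norm// subr_ge0 ltW.
  by rewrite distrC ger0_norm// subr_ge0 ltW.
rewrite cE.
case: (ltgtP z w0) r3 => [zw|zw|->]; last by rewrite subrr normr0; clear -r0; lra.
  rewrite ltr0_norm ?subr_lt0// => r3.
  have u1 : z < z + rho / 2 by rewrite ltrDl divr_gt0.
  have [t|t /andP[t1 t2] E] := @mvt_oo R h0 h1 z (z + rho / 2) u1.
    by move=> /andP[t1 t2]; apply: d0; apply/andP; split; clear -t1 t2 r0 r2 xz; lra.
  have hu : h0 (z + rho / 2) <= 0.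
    by apply: wl; clear -r0 r3 xz; lra.
  have hz : h0 z <= 0 by apply: wl => //; exact: ltW.
  rewrite (ler0_norm hz); apply: (@le_trans _ _ (h0 (z + rho / 2) - h0 z)); last first.
    by clear -hu; lra.
  rewrite E addrC addKr ler_wpM2r ?divr_ge0 ?(ltW r0)//.
  apply: h1big; [apply/andP; split| |]; clear -t1 t2 r0 r1 r2 xz; lra.
rewrite gtr0_norm ?subr_gt0// => r3.
have u1 : z - rho / 2 < z by rewrite ltrBlDr ltrDl divr_gt0.
have [t|t /andP[t1 t2] E] := @mvt_oo R h0 h1 (z - rho / 2) z u1.
  by move=> /andP[t1 t2]; apply: d0; apply/andP; split; clear -t1 t2 r0 r1 zy; lra.
have hu : 0 <= h0 (z - rho / 2).
  by apply: wr; clear -r0 r3 zy; lra.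
have hz : 0 <= h0 z by apply: wr.
rewrite (ger0_norm hz); apply: (@le_trans _ _ (h0 z - h0 (z - rho / 2))); last first.
  by clear -hu; lra.
rewrite E opprB addrC subrK ler_wpM2r ?divr_ge0 ?(ltW r0)//.
apply: h1big; [apply/andP; split| |]; clear -t1 t2 r0 r1 r2 zy; lra.
Qed.

(** The lower bound keeps [h1] from vanishing inside the interval, so by continuity it has one sign
    there, and the monotone case applies to [h0] or to its opposite. *)
Lemma gap_lower (R : realType) (k : nat) (h0 h1 h2 : R -> R) (x y c : R) :
  x <= y -> 0 < c ->
  (forall z, x <= z <= y -> is_derive z 1 h0 (h1 z)) ->
  (forall z, x <= z <= y -> is_derive z 1 h1 (h2 z)) ->
  (forall z, x <= z <= y -> exists2 w, w \in [:: x; y] & c * `|z - w| ^+ k <= `|h1 z|) ->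
  exists w0, forall z, x <= z <= y ->
    exists2 w, w \in [:: x; y; w0] & c / 2 ^+ k.+1 * `|z - w| ^+ k.+1 <= `|h0 z|.
Proof.
move=> xy c0 d0 d1 H.
have nz z : x < z < y -> h1 z != 0.
  move=> /andP[xz zy]; rewrite -normr_gt0; have [|w wl] := H z; first by rewrite !ltW.
  apply: lt_le_trans; rewrite mulr_gt0// exprn_gt0// normr_gt0 subr_eq0.
  by move: wl; rewrite !inE => /orP[/eqP ->|/eqP ->]; rewrite ?(gt_eqF xz) ?(lt_eqF zy).
have [hp|[u /andP[xu uy] hu]] : (forall z, x < z < y -> 0 <= h1 z) \/
    (exists2 u, x < u < y & h1 u < 0).
  have [[u ux hu]|hn] := pselect (exists2 u, x < u < y & h1 u < 0); first by right; exists u.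
  by left=> z hz; rewrite leNgt; apply/negP => hz'; apply: hn; exists z.
  exact: (@gap_lower_nneg R k h0 h1).
have hn z : x < z < y -> h1 z <= 0.
  move=> /andP[xz zy]; rewrite leNgt; apply/negP => hz.
  have [zu|uz] := leP z u.
    have [t|||t /andP[t1 t2] t0] := @derive_ivt0 R (\- h1) (\- h2) z u zu.
    - move=> /andP[t1 t2]; apply: is_deriveN; apply: d1.
      by rewrite (le_trans (ltW xz))// (le_trans t2)// ltW.
    - by rewrite oppr_le0 ltW.
    - by rewrite oppr_ge0 ltW.
    move/eqP: t0; rewrite oppr_eq0; apply/negP; apply: nz.
    by rewrite (lt_le_trans xz)// (le_lt_trans t2).
  have [t|||t /andP[t1 t2] t0] := @derive_ivt0 R h1 h2 u z (ltW uz).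
  - move=> /andP[t1 t2]; apply: d1.
    by rewrite (le_trans (ltW xu))// (le_trans t2)// ltW.
  - by rewrite ltW.
  - by rewrite ltW.
  move/eqP: t0; apply/negP; apply: nz.
  by rewrite (lt_le_trans xu)// (le_lt_trans t2).
have [|||w0 Hw] := @gap_lower_nneg R k (\- h0) (\- h1) x y c xy c0.
- by move=> z /d0 dd; apply: is_deriveN.
- by move=> z /hn; rewrite oppr_ge0.
- by move=> z /H [w ? ?]; exists w => //; rewrite normrN.
by exists w0 => z /Hw[w ? hw]; exists w => //; move: hw; rewrite normrN.
Qed.

Lemma closer_left (R : realType) (x z w : R) : w <= x -> x <= z -> `|z - x| <= `|z - w|.
Proof. by move=> wx xz; rewrite !ger0_norm ?subr_ge0// ?(le_trans wx)// lerB. Qed.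

Lemma closer_right (R : realType) (x z w : R) : x <= w -> z <= x -> `|z - x| <= `|z - w|.
Proof.
by move=> xw zx; rewrite ![`|z - _|]distrC !ger0_norm ?subr_ge0// ?(le_trans zx)// lerB.
Qed.

(** The centres cut the interval into gaps. After a cut at [v], a centre beyond the end of a
    subinterval is replaced by that end, which is closer. A single gap needs three centres, and each
    cut at most doubles their number. *)
Lemma list_lower (R : realType) (k : nat) (h0 h1 h2 : R -> R) (c : R) (Z : seq R) (x y : R) :
  x <= y -> 0 < c ->
  (forall z, x <= z <= y -> is_derive z 1 h0 (h1 z)) ->
  (forall z, x <= z <= y -> is_derive z 1 h1 (h2 z)) ->
  (forall z, x <= z <= y ->
    exists2 w, w \in [:: x, y & Z] & c * `|z - w| ^+ k <= `|h1 z|) ->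
  exists2 Z', (size Z' <= 3 * 2 ^ size Z)%N & forall z, x <= z <= y ->
    exists2 w, w \in Z' & c / 2 ^+ k.+1 * `|z - w| ^+ k.+1 <= `|h0 z|.
Proof.
move=> xy c0; elim: Z x y xy => [|v Z IH] x y xy d0 d1 H.
  have [w0 Hw] := @gap_lower R k h0 h1 h2 x y c xy c0 d0 d1 H.
  by exists [:: x; y; w0].
have cl z w w' : `|z - w'| <= `|z - w| -> c * `|z - w| ^+ k <= `|h1 z| ->
    c * `|z - w'| ^+ k <= `|h1 z|.
  by move=> hw; apply: le_trans; rewrite ler_pM2l// lerXn2r ?nnegrE.
have sz : (3 * 2 ^ size Z <= 3 * 2 ^ size (v :: Z))%N.
  by rewrite leq_mul2l/= leq_exp2l.
have [vx|xv] := leP v x.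
  have [z|Z' Z's HZ'] := IH x y xy d0 d1; last by exists Z' => //; exact: leq_trans sz.
  move=> /[dup] /andP[xz zy] /H [w]; rewrite !inE.
  case/or4P=> [/eqP ->|/eqP ->|/eqP ->|wZ] hw; [exists x|exists y|exists x|exists w];
    rewrite ?inE ?eqxx ?wZ ?orbT//.
  by apply: cl hw; apply: closer_left.
have [yv|vy] := leP y v.
  have [z|Z' Z's HZ'] := IH x y xy d0 d1; last by exists Z' => //; exact: leq_trans sz.
  move=> /[dup] /andP[xz zy] /H [w]; rewrite !inE.
  case/or4P=> [/eqP ->|/eqP ->|/eqP ->|wZ] hw; [exists x|exists y|exists y|exists w];
    rewrite ?inE ?eqxx ?wZ ?orbT//.
  by apply: cl hw; apply: closer_right.
have s1 z : x <= z <= v -> x <= z <= y.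
  by move=> /andP[-> zv]; rewrite (le_trans zv)// ltW.
have s2 z : v <= z <= y -> x <= z <= y.
  by move=> /andP[vz ->]; rewrite andbT (le_trans _ vz)// ltW.
have [||z|Z1 Z1s HZ1] := IH x v (ltW xv).
- by move=> z /s1; exact: d0.
- by move=> z /s1; exact: d1.
- move=> /[dup] /andP[xz zv] /s1/H [w]; rewrite !inE.
  case/or4P=> [/eqP ->|/eqP ->|/eqP ->|wZ] hw; [exists x|exists v|exists v|exists w];
    rewrite ?inE ?eqxx ?wZ ?orbT//.
  by apply: cl hw; apply: closer_right => //; exact: ltW.
have [||z|Z2 Z2s HZ2] := IH v y (ltW vy).
- by move=> z /s2; exact: d0.
- by move=> z /s2; exact: d1.
- move=> /[dup] /andP[vz zy] /s2/H [w]; rewrite !inE.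
  case/or4P=> [/eqP ->|/eqP ->|/eqP ->|wZ] hw; [exists v|exists y|exists v|exists w];
    rewrite ?inE ?eqxx ?wZ ?orbT//.
  by apply: cl hw; apply: closer_left => //; exact: ltW.
exists (Z1 ++ Z2).
  by rewrite size_cat /= expnS mul2n -addnn mulnDr leq_add.
move=> z /andP[xz zy]; have [zv|vz] := leP z v.
  have [|w wZ hw] := HZ1 z; first by rewrite xz.
  by exists w => //; rewrite mem_cat wZ.
have [|w wZ hw] := HZ2 z; first by rewrite zy ltW.
by exists w => //; rewrite mem_cat wZ orbT.
Qed.

(** Descent from the large derivative [h j] to [h 0], one order at a time. The point is that [N] and
    [c] depend on [K] alone and not on [h], which later gives uniformity over all directions. *)
Lemma finite_type_lower (R : realType) (K : nat) :
  exists (N : nat) (c : R), 0 < c /\ forall (j : nat), (j <= K)%N ->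
  forall (h : nat -> R -> R) (x y l : R), x <= y -> 0 < l ->
  (forall i z, x <= z <= y -> is_derive z 1 (h i) (h i.+1 z)) ->
  (forall z, x <= z <= y -> l <= `|h j z|) ->
  exists2 Z : seq R, (size Z <= N)%N & forall z, x <= z <= y ->
    exists2 w, w \in Z & c * l * `|z - w| ^+ j <= `|h 0%N z|.
Proof.
elim: K => [|K [N [c [c0 IH]]]].
  exists 1%N, 1; split=> // j; rewrite leqn0 => /eqP -> h x y l xy l0 _ H.
  by exists [:: x] => // z hz; exists x; rewrite ?inE// expr0 mulr1 mul1r H.
exists (3 * 2 ^ N)%N, (Num.min 1 (c / 2 ^+ K.+1)); split.
  by rewrite lt_min ltr01 divr_gt0// exprn_gt0.
have m1 : Num.min 1 (c / 2 ^+ K.+1) <= 1 by rewrite ge_min lexx.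
have m2 : Num.min 1 (c / 2 ^+ K.+1) <= c / 2 ^+ K.+1 by rewrite ge_min lexx orbT.
move: (Num.min _ _) m1 m2 => cm m1 m2.
case=> [_|j jK] h x y l xy l0 hd H.
  exists [:: x]; first by rewrite muln_gt0 expn_gt0.
  move=> z hz; exists x; rewrite ?inE// expr0 mulr1.
  by apply: le_trans (H z hz); rewrite ler_piMl// ltW.
have hd' i z : x <= z <= y -> is_derive z 1 (h i.+1) (h i.+2 z) by exact: hd.
have [Z Zs HZ] := IH j jK (fun i => h i.+1) x y l xy l0 hd' H.
have cl0 : 0 < c * l by rewrite mulr_gt0.
have [|Z' Z's HZ'] := @list_lower R j (h 0%N) (h 1%N) (h 2%N) (c * l) Z x y xy cl0
  (hd 0%N) (hd 1%N).
  by move=> z /HZ [w wZ hw]; exists w; rewrite ?inE ?wZ ?orbT.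
exists Z'.
  by apply: (leq_trans Z's); rewrite leq_mul2l/= leq_exp2l.
move=> z /HZ' [w wZ hw]; exists w => //; apply: le_trans hw.
rewrite ler_wpM2r ?exprn_ge0// mulrAC ler_pM2r//; apply: (le_trans m2).
by rewrite ler_pM2l// lef_pV2 ?posrE ?exprn_gt0// ler_eXn2l ?ltr1n.
Qed.

(** * Uniform lower bounds over the circle of directions *)

Lemma derivable_bigsum (R : realType) (n : nat) (F : nat -> R -> R) (x : R) :
  (forall j, derivable (F j) x 1) -> derivable (fun s => \sum_(j < n) F j s) x 1.
Proof.
move=> dF; elim: n => [|n IH].
  rewrite (_ : (fun s => _) = cst 0); first exact: derivable_cst.
  by apply/funext => s; rewrite big_ord0.
rewrite (_ : (fun s => _) = (fun s => \sum_(j < n) F j s) + F n); first exact: derivableD.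
by apply/funext => s; rewrite big_ord_recr.
Qed.

Lemma derivable_bounded (R : realType) (f : R -> R) (c d : R) : c <= d ->
  (forall z, c <= z <= d -> derivable f z 1) ->
  exists2 M, 0 < M & forall z, c <= z <= d -> `|f z| <= M.
Proof.
move=> cd fd.
have cf : {within `[c, d], continuous f}.
  by apply: derivable_within_continuous => z; rewrite in_itv/=; exact: fd.
have [u _ Hu] := EVT_max cd cf; have [v _ Hv] := EVT_min cd cf.
exists (`|f u| + `|f v| + 1); first by rewrite ltr_wpDl// addr_ge0.
move=> z hz; have zi : z \in `[c, d]%R by rewrite in_itv/=.
have := Hu z zi; have := Hv z zi; have := ler_norm (f u); have := ler_norm (- f v).
by rewrite normrN ler_norml; have := normr_ge0 (f u); have := normr_ge0 (f v); lra.
Qed.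

Lemma derivable_pos_lower (R : realType) (f : R -> R) (c d : R) : c <= d ->
  (forall z, c <= z <= d -> derivable f z 1) ->
  (forall z, c <= z <= d -> 0 < f z) ->
  exists2 M, 0 < M & forall z, c <= z <= d -> M <= f z.
Proof.
move=> cd fd fp.
have cf : {within `[c, d], continuous f}.
  by apply: derivable_within_continuous => z; rewrite in_itv/=; exact: fd.
have [v vcd Hv] := EVT_min cd cf.
exists (f v); first by apply: fp; rewrite in_itv in vcd.
by move=> z hz; apply: Hv; rewrite in_itv.
Qed.

(** By Cayley-Hamilton, trace times quadratic form minus determinant times [z1^2 + z2^2] is the
    squared length of the image of [(z1, z2)] under the matrix. On the unit circle the form is thus
    bounded below through determinant and trace, with no compactness argument in the direction. *)
Lemma gram_lower (R : realType) (E F G z1 z2 : R) :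
  (E * G - F ^+ 2) * (z1 ^+ 2 + z2 ^+ 2) <=
  (E + G) * (z1 ^+ 2 * E + 2 * z1 * z2 * F + z2 ^+ 2 * G).
Proof.
rewrite -subr_ge0.
rewrite (_ : _ - _ = (E * z1 + F * z2) ^+ 2 + (F * z1 + G * z2) ^+ 2); last by ring.
by rewrite addr_ge0// sqr_ge0.
Qed.

Lemma sum_sq_pencil (R : realType) (n : nat) (u v : nat -> R) (z1 z2 : R) :
  \sum_(j < n) (z1 * u j + z2 * v j) ^+ 2 =
  z1 ^+ 2 * (\sum_(j < n) u j ^+ 2) + 2 * z1 * z2 * (\sum_(j < n) u j * v j) +
  z2 ^+ 2 * (\sum_(j < n) v j ^+ 2).
Proof.
rewrite !mulr_sumr -!big_split/=; apply: eq_bigr => j _; ring.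
Qed.

Lemma sum_sq_le0 (R : realType) (n : nat) (u : nat -> R) :
  \sum_(j < n) u j ^+ 2 <= 0 -> forall j, (j < n)%N -> u j = 0.
Proof.
move=> h j jn; have : \sum_(j < n) u j ^+ 2 = 0.
  by apply/eqP; rewrite eq_le h sumr_ge0// => i _; rewrite sqr_ge0.
move/eqP; rewrite psumr_eq0; last by move=> i _; rewrite sqr_ge0.
by move/allP/(_ (Ordinal jn)); rewrite mem_index_enum => /(_ isT)/= /eqP/eqP; rewrite sqrf_eq0 => /eqP.
Qed.

(** Positivity of a Gram determinant of two independent vectors: the quadratic form at [(- F, E)]
    equals [E] times the determinant. *)
Lemma gram_pos (R : realType) (n : nat) (u v : nat -> R) :
  (forall z1 z2 : R, z1 ^+ 2 + z2 ^+ 2 = 1 ->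
    exists2 j, (j < n)%N & z1 * u j + z2 * v j != 0) ->
  0 < (\sum_(j < n) u j ^+ 2) * (\sum_(j < n) v j ^+ 2) - (\sum_(j < n) u j * v j) ^+ 2.
Proof.
move=> H.
have H' (z1 z2 : R) : z1 != 0 \/ z2 != 0 ->
    0 < \sum_(j < n) (z1 * u j + z2 * v j) ^+ 2.
  move=> z0; rewrite ltNge; apply/negP => /(@sum_sq_le0 R n (fun j => z1 * u j + z2 * v j)) h.
  have s0 : 0 < z1 ^+ 2 + z2 ^+ 2.
    case: z0 => z0; [rewrite ltr_pwDl ?sqr_ge0//|rewrite ltr_wpDl ?sqr_ge0//];
    by rewrite lt_neqAle sqr_ge0 eq_sym sqrf_eq0 z0.
  set t := Num.sqrt (z1 ^+ 2 + z2 ^+ 2).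
  have t0 : 0 < t by rewrite sqrtr_gt0.
  have t2 : t ^+ 2 = z1 ^+ 2 + z2 ^+ 2 by rewrite sqr_sqrtr// ltW.
  have [|j jn] := H (z1 / t) (z2 / t).
    by rewrite !expr_div_n -mulrDl -t2 divff// expf_neq0// gt_eqF.
  by rewrite mulrAC [z2 / t * _]mulrAC -mulrDl (h j jn) mul0r eqxx.
set E := \sum_(j < n) u j ^+ 2; set G := \sum_(j < n) v j ^+ 2.
set F := \sum_(j < n) u j * v j.
have Epos : 0 < E.
  have := H' 1 0 (or_introl (oner_neq0 _)); congr (0 < _).
  by apply: eq_bigr => j _; rewrite mul1r mul0r addr0.
have := H' (- F) E (or_intror (lt0r_neq0 Epos)).
rewrite sum_sq_pencil -/E -/F -/G.
rewrite (_ : _ + _ + _ = E * (E * G - F ^+ 2)); last by ring.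
by rewrite pmulr_rgt0.
Qed.

Lemma sum_sq_large (R : realType) (n : nat) (u : nat -> R) (q : R) :
  0 < q -> q <= \sum_(j < n) u j ^+ 2 ->
  exists2 j, (j < n)%N & Num.min 1 (q / n.+1%:R) <= `|u j|.
Proof.
(* [e <= 1] gives [e^2 <= e] and avoids a square root; dividing by [n.+1] covers [n = 0] and makes
   the final comparison strict. *)
move=> q0 qs; set e := Num.min _ _.
have e0 : 0 < e by rewrite lt_min ltr01 divr_gt0// ltr0n.
have e1 : e <= 1 by rewrite ge_min lexx.
have eq : e <= q / n.+1%:R by rewrite ge_min lexx orbT.
have [//|hn] := pselect (exists2 j, (j < n)%N & e <= `|u j|).
exfalso; move: qs; apply/negP; rewrite -ltNge.
apply: (@le_lt_trans _ _ (\sum_(j < n) e)).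
  apply: ler_sum => j _; have uj : `|u j| < e.
    by rewrite ltNge; apply/negP => h; apply: hn; exists j.
  rewrite -real_normK ?num_real// expr2; apply: (@le_trans _ _ (e * e)).
    by rewrite ler_pM// ltW.
  by rewrite ler_piMl// ltW.
rewrite sumr_const card_ord -[e *+ n]mulr_natr.
rewrite ler_pdivlMr ?ltr0n// in eq; apply: lt_le_trans eq.
by rewrite ltr_pM2l// ltr_nat.
Qed.

(** Projection onto [[c, d]] when [c <= d]. It moves centres into the interval without increasing
    their distance to its points, and it extends functions continuously from [[c, d]] to the
    line. *)
Definition clamp (R : realType) (c d w : R) : R := Num.max c (Num.min d w).

Lemma clamp_in (R : realType) (c d w : R) : c <= d -> c <= clamp R c d w <= d.
Proof. by move=> cd; rewrite /clamp le_max lexx ge_max cd ge_min lexx. Qed.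

Lemma clamp_closer (R : realType) (c d w s : R) : c <= s <= d ->
  `|s - clamp R c d w| <= `|s - w|.
Proof.
move=> /andP[cs sd]; rewrite /clamp; case: (leP d w) => dw.
  case: (leP c d) => cd; last by have := le_lt_trans (le_trans cs sd) cd; rewrite ltxx.
  exact: closer_right.
by case: (leP c w) => // cw; apply: closer_left => //; exact: ltW.
Qed.

(** The Gram determinant of the derivatives up to order [K] is continuous and positive, so it has a
    positive minimum on [[c, d]]. Hence, for every direction and every [s], some derivative of order
    at most [K] is at least [e]. It stays above [e / 2] on a cell whose length is independent of the
    direction; [finite_type_lower] applies there, and the centres of all cells are collected. *)
Lemma uniform_lower (R : realType) (K : nat) (G1 G2 : nat -> R -> R) (c d : R) :
  c < d ->
  (forall i z, c <= z <= d -> is_derive z 1 (G1 i) (G1 i.+1 z)) ->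
  (forall i z, c <= z <= d -> is_derive z 1 (G2 i) (G2 i.+1 z)) ->
  (forall s z1 z2, c <= s <= d -> z1 ^+ 2 + z2 ^+ 2 = 1 ->
    exists2 j, (j < K.+1)%N & z1 * G1 j s + z2 * G2 j s != 0) ->
  exists (N : nat) (c2 : R), 0 < c2 /\ forall z1 z2, z1 ^+ 2 + z2 ^+ 2 = 1 ->
    exists2 Z : seq R, (size Z <= N)%N & forall s, c <= s <= d ->
      exists w, [/\ w \in Z, c <= w <= d &
        c2 * `|s - w| ^+ K <= `|z1 * G1 0%N s + z2 * G2 0%N s|].
Proof.
move=> cd d1 d2 H; have cd' := ltW cd.
have D1 i z : c <= z <= d -> derivable (G1 i) z 1 by move=> /(d1 i)[].
have D2 i z : c <= z <= d -> derivable (G2 i) z 1 by move=> /(d2 i)[].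
pose E s := \sum_(j < K.+1) G1 j s ^+ 2.
pose G s := \sum_(j < K.+1) G2 j s ^+ 2.
pose F s := \sum_(j < K.+1) G1 j s * G2 j s.
have DE z : c <= z <= d -> derivable E z 1.
  move=> hz; apply: (@derivable_bigsum R _ (fun j s => G1 j s ^+ 2)) => j.
  by apply: (@derivableX R R (G1 j) 2); exact: D1.
have DG z : c <= z <= d -> derivable G z 1.
  move=> hz; apply: (@derivable_bigsum R _ (fun j s => G2 j s ^+ 2)) => j.
  by apply: (@derivableX R R (G2 j) 2); exact: D2.
have DF z : c <= z <= d -> derivable F z 1.
  move=> hz; apply: (@derivable_bigsum R _ (fun j s => G1 j s * G2 j s)) => j.
  by apply: (@derivableM R R (G1 j) (G2 j)); [exact: D1|exact: D2].
have [De De0 HDe] : exists2 M, 0 < M & forall z, c <= z <= d -> M <= E z * G z - F z ^+ 2.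
  apply: (@derivable_pos_lower R (fun z => E z * G z - F z ^+ 2) c d cd') => z hz.
    apply: (@derivableB R R R (E * G) (F ^+ 2)).
      by apply: derivableM; [exact: DE|exact: DG].
    by apply: derivableX; exact: DF.
  by apply: (@gram_pos R K.+1 (G1 ^~ z) (G2 ^~ z)) => z1 z2 hz12; exact: H.
have [B B0 HB] : exists2 M, 0 < M & forall z, c <= z <= d -> `|E z + G z| <= M.
  by apply: (@derivable_bounded R (fun z => E z + G z) c d cd') => z hz; apply: (@derivableD R R R E G); [exact: DE|exact: DG].
pose q := De / B; have q0 : 0 < q by rewrite divr_gt0.
pose e := Num.min 1 (q / K.+2%:R).
have e0 : 0 < e by rewrite lt_min ltr01 divr_gt0// ltr0n.
have big s z1 z2 : c <= s <= d -> z1 ^+ 2 + z2 ^+ 2 = 1 ->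
    exists2 j, (j < K.+1)%N & e <= `|z1 * G1 j s + z2 * G2 j s|.
  move=> hs hz; apply: (@sum_sq_large R K.+1 (fun j => z1 * G1 j s + z2 * G2 j s) q) => //.
  rewrite (@sum_sq_pencil R K.+1 (G1 ^~ s) (G2 ^~ s)) -/(E s) -/(F s) -/(G s) /q ler_pdivrMr//.
  apply: le_trans (HDe _ hs) _; rewrite -[leLHS]mulr1 -[X in _ * X <= _]hz.
  apply: (le_trans (gram_lower R _ _ _ _ _)); rewrite [leLHS]mulrC ler_wpM2l//.
    by rewrite /E /F /G -(@sum_sq_pencil R K.+1 (G1 ^~ s) (G2 ^~ s)) sumr_ge0// => j _; rewrite sqr_ge0.
  by apply: le_trans (HB _ hs); exact: ler_norm.
(* Orders up to [K + 1], since the variation of the derivative of order [K] over a cell is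
   controlled by the next one. *)
have [M M0 HM] : exists2 M, 0 < M & forall j z, (j < K.+2)%N -> c <= z <= d ->
    `|G1 j z| + `|G2 j z| <= M.
  elim: (K.+2) => [|n [M M0 HM]]; first by exists 1.
  have [M1 M10 HM1] := @derivable_bounded R (G1 n) c d cd' (D1 n).
  have [M2 M20 HM2] := @derivable_bounded R (G2 n) c d cd' (D2 n).
  exists (M + M1 + M2); first by rewrite !addr_gt0.
  move=> j z; rewrite ltnS leq_eqVlt => /orP[/eqP ->|jn] hz.
    have := HM1 z hz; have := HM2 z hz; clear -M0; lra.
  have := HM j z jn hz; clear -M10 M20; lra.
have [N [cF [cF0 FT]]] := finite_type_lower R K.
pose n := (Num.truncn ((d - c) * (2 * M) / e)).+1.
pose L := (d - c) / n%:R.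
have n0 : 0 < n%:R :> R by rewrite ltr0n.
have dc0 : 0 < d - c by rewrite subr_gt0.
have L0 : 0 < L by rewrite divr_gt0.
have ML : M * L <= e / 2.
  rewrite /L mulrA ler_pdivrMr// -ler_pdivrMl ?divr_gt0//.
  apply: (@le_trans _ _ ((d - c) * (2 * M) / e)); last by apply: ltW; exact: truncnS_gt.
  by rewrite le_eqVlt; apply/orP; left; apply/eqP; field; rewrite gt_eqF.
have nL : c + n%:R * L = d by rewrite /L mulrCA divff ?gt_eqF// mulr1 addrC subrK.
(* An upper bound for all distances involved; its powers convert the exponent [j <= K] of a cell
   into the common exponent [K]. *)
pose D0 := Num.max 1 (d - c).
have D01 : 1 <= D0 by rewrite le_max lexx.
have D0d : d - c <= D0 by rewrite le_max lexx orbT.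
have D0K : 0 < D0 ^+ K by rewrite exprn_gt0//; apply: lt_le_trans D01.
pose c2 := cF * (e / 2) / D0 ^+ K.
have c20 : 0 < c2 by rewrite divr_gt0// mulr_gt0// divr_gt0.
exists (n * N)%N, c2; split => // z1 z2 hz.
have z1b : `|z1| <= 1 /\ `|z2| <= 1.
  have := sqr_ge0 z1; have := sqr_ge0 z2 => z20 z10.
  by split; rewrite -(@ler_pXn2r _ 2)// ?nnegrE// expr1n real_normK ?num_real//;
    clear -hz z20 z10; lra.
case: z1b => z1b z2b.
pose h j s := z1 * G1 j s + z2 * G2 j s.
have hd i z : c <= z <= d -> is_derive z 1 (h i) (h i.+1 z).
  move=> hz'; have k1 := d1 i z hz'; have k2 := d2 i z hz'.
  by rewrite /h; apply: is_derive_eq; rewrite /GRing.scale/=; ring.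
have hM j z : (j < K.+2)%N -> c <= z <= d -> `|h j z| <= M.
  move=> jK hz'; apply: le_trans (HM j z jK hz').
  apply: (le_trans (ler_normD _ _)); rewrite !normrM lerD//.
    by rewrite ler_piMl.
  by rewrite ler_piMl.
(* Cells are added from the left. With none, the range is the single point [c] and no centre exists,
   whence the alternative [i = 0]; it is excluded at the end because [n] is a successor. *)
suff : forall i, (i <= n)%N -> exists2 Z : seq R, (size Z <= i * N)%N &
    forall s, c <= s <= c + i%:R * L -> s <= d -> i = 0%N \/
      exists w, [/\ w \in Z, c <= w <= d & c2 * `|s - w| ^+ K <= `|h 0%N s|].
  move=> /(_ n (leqnn n)) [Z Zs HZ]; exists Z => // s /andP[cs sd].
  by have [|//|//] := HZ s _ sd; rewrite cs nL.
elim=> [|i IH] iN; first by exists [::] => // s _ _; left.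
have [Z Zs HZ] := IH (ltnW iN).
pose x := c + i%:R * L; pose y := c + i.+1%:R * L.
have yE : y = x + L by rewrite /y /x -natr1; ring.
have xc : c <= x by rewrite /x lerDl mulr_ge0// ltW.
have yd : y <= d by rewrite -nL /y lerD2l ler_pM2r// ler_nat.
have xy : x <= y by rewrite yE lerDl ltW.
have sub z : x <= z <= y -> c <= z <= d.
  by move=> /andP[xz zy]; rewrite (le_trans xc xz) (le_trans zy yd).
have [j jK hj] := big x z1 z2 (sub x ltac:(by rewrite lexx xy)) hz.
have hj2 z : x <= z <= y -> e / 2 <= `|h j z|.
  move=> hz'; have /andP[xz zy] := hz'.
  have : `|h j z - h j x| <= M * (z - x).
    apply: (@mvt_norm_le R (h j) (h j.+1)) => // t /andP[xt tz].
      by apply: hd; apply: sub; rewrite xt (le_trans tz zy).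
    by apply: hM => //; apply: sub; rewrite xt (le_trans tz zy).
  have MzL : M * (z - x) <= M * L by rewrite ler_pM2l// lerBlDl -yE.
  have := ler_normB (h j z) (h j z - h j x); rewrite subKr.
  by move: hj ML MzL; rewrite -/(h j x); clear; lra.
have e20 : 0 < e / 2 by rewrite divr_gt0.
have hd' i0 z : x <= z <= y -> is_derive z 1 (h i0) (h i0.+1 z) by move=> /sub; exact: hd.
have [Z2 Z2s HZ2] := FT j ltac:(by rewrite -ltnS) h x y (e / 2) xy e20 hd' hj2.
exists ([seq clamp R c d w | w <- Z2] ++ Z).
  by rewrite size_cat size_map mulSn leq_add.
move=> s /andP[cs sy] sd.
right; have [xs|sx] := leP x s; last first.
  have [|i0|[w [wZ wcd hw]]] := HZ s _ sd; first by rewrite cs ltW.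
    by move: sx; rewrite ltNge /x i0 mul0r addr0 cs.
  by exists w; split => //; rewrite mem_cat wZ orbT.
have [|w wZ2 hw] := HZ2 s; first by rewrite xs.
exists (clamp R c d w); split; [by rewrite mem_cat map_f|exact: clamp_in|].
apply: le_trans hw; have scd : c <= s <= d by rewrite cs.
have cw := @clamp_closer R c d w s scd.
apply: (@le_trans _ _ (cF * (e / 2) * `|s - clamp R c d w| ^+ j)); last first.
  by rewrite ler_pM2l ?mulr_gt0// lerXn2r ?nnegrE.
have cD : `|s - clamp R c d w| <= D0.
  have /andP[k1 k2] := @clamp_in R c d w cd'; apply: le_trans D0d.
  by rewrite ler_norml; clear -k1 k2 cs sd; lra.
rewrite /c2 -mulrA ler_pM2l ?mulr_gt0// mulrC ler_pdivrMr//.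
rewrite -(subnKC (_ : j <= K)%N) 1?exprD; last by rewrite -ltnS.
rewrite ler_wpM2l ?exprn_ge0//; apply: (@le_trans _ _ (D0 ^+ (K - j))).
  by rewrite lerXn2r ?nnegrE// (le_trans ler01).
by rewrite exprD ler_peMl ?exprn_ege1// exprn_ge0// (le_trans ler01).
Qed.

(** * Smoothness of power series *)

Lemma is_cvg_series_shift (R : realType) (w : nat -> R) :
  cvgn (series w) -> cvgn (series (fun n => w n.+1)).
Proof.
move=> cw.
have -> : series (fun n => w n.+1) = (fun n => series w n.+1 - w 0%N).
  by apply/funext => n; rewrite /series/= big_nat_recl// addrC addKr.
apply: is_cvgB; last exact: is_cvg_cst.
by move/cvg_ex : cw => [l hl]; apply/cvg_ex; exists l; rewrite cvg_shiftS.
Qed.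

Lemma natr_geometric_bound (R : realType) (t : R) (n : nat) : 0 <= t -> t < 1 ->
  n.+1%:R * t ^+ n <= (1 - t)^-1.
Proof.
move=> t0 t1; have t1' : 0 < 1 - t by rewrite subr_gt0.
rewrite -[leRHS]mul1r ler_pdivlMr// mulrC.
have h : n.+1%:R * t ^+ n <= \sum_(i < n.+1) t ^+ i.
  rewrite mulr_natl -[X in _ *+ X]card_ord -sumr_const; apply: ler_sum => i _.
  by rewrite ler_wiXn2l// ?(ltW t1)// -ltnS.
apply: (le_trans (ler_wpM2l (ltW t1') h)).
by rewrite -opprB mulNr -subrX1 opprB lerBlDr lerDl exprn_ge0.
Qed.

(** With [y] strictly between [|z|] and [|x|], the factor [n + 1] is absorbed by [(|z| / y)^n], and
    the original series converges absolutely at [y]. *)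
Lemma is_cvg_pseries_diffs (R : realType) (c : nat -> R) (x z : R) :
  cvgn (pseries c x) -> `|z| < `|x| -> cvgn (pseries (pseries_diffs c) z).
Proof.
move=> cx zx; pose y := (`|z| + `|x|) / 2.
have zy : `|z| < y by rewrite /y; lra.
have yx : y < `|x| by rewrite /y; lra.
have y0 : 0 < y by apply: le_lt_trans zy.
have cy : cvgn (pseries (fun i => `|c i|) y).
  by apply: is_cvg_pseries_inside_norm cx _; rewrite ger0_norm// ltW.
pose t := `|z| / y.
have t0 : 0 <= t by rewrite divr_ge0// ltW.
have t1 : t < 1 by rewrite ltr_pdivrMr// mul1r.
apply: normed_cvg.
pose C := (1 - t)^-1 / y.
have C0 : 0 <= C by rewrite divr_ge0 ?invr_ge0 ?subr_ge0 ?(ltW t1) ?(ltW y0).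
apply: (@series_le_cvg _ _ (fun n => C * (`|c n.+1| * y ^+ n.+1))) => [n|n|n|].
- exact: normr_ge0.
- by apply: mulr_ge0 => //; apply: mulr_ge0 => //; rewrite exprn_ge0// ltW.
- rewrite /pseries_diffs/= !normrM normrX ger0_norm//.
  have -> : `|z| ^+ n = t ^+ n * y ^+ n.
    by rewrite -exprMn /t divfK// gt_eqF.
  have -> : C * (`|c n.+1| * y ^+ n.+1) = (1 - t)^-1 * (`|c n.+1| * y ^+ n).
    by rewrite /C exprS mulrCA -mulrA (mulKf (lt0r_neq0 y0)) mulrCA.
  have -> : n.+1%:R * `|c n.+1| * (t ^+ n * y ^+ n) =
    (n.+1%:R * t ^+ n) * (`|c n.+1| * y ^+ n) by ring.
  by rewrite ler_wpM2r ?natr_geometric_bound// mulr_ge0// exprn_ge0// ltW.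
- have h := @is_cvg_series_shift R (fun n => `|c n| * y ^+ n) cy.
  rewrite (_ : series _ = (fun n => C * series (fun n => `|c n.+1| * y ^+ n.+1) n)).
    by apply: is_cvgM => //; exact: is_cvg_cst.
  by apply/funext => n; rewrite /series/= mulr_sumr.
Qed.

(** Real analyticity on []a, b[] in a form that the derivative inherits, which permits induction on
    the order of differentiation. *)
Definition locally_pseries (R : realType) (a b : R) (g : R -> R) :=
  forall p, a < p < b -> exists r : R, 0 < r /\ exists c : nat -> R,
    forall y, `|y - p| < r -> pseries c (y - p) @ \oo --> g y.

Lemma locally_pseries_derive (R : realType) (a b : R) (g : R -> R) :
  locally_pseries R a b g ->
  (forall p, a < p < b -> is_derive p 1 g (derive1 g p)) /\ locally_pseries R a b (derive1 g).
Proof.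
move=> Hg.
have key p : a < p < b -> exists r : R, 0 < r /\ exists c : nat -> R,
    forall y, `|y - p| < r -> is_derive y 1 g (limn (pseries (pseries_diffs c) (y - p))) /\
     cvgn (pseries (pseries_diffs c) (y - p)).
  move=> /Hg [r [r0 [c Hc]]]; exists r; split => //; exists c => y yr.
  (* Differentiating the sum at [y - p] calls for the series and its first two derived series at the
     common point [x1]. Each termwise differentiation costs some radius, hence the spare radii [x2]
     and [x3]. *)
  pose x1 := (`|y - p| + r) / 2; pose x2 := (x1 + r) / 2; pose x3 := (x2 + r) / 2.
  have n0 := normr_ge0 (y - p).
  have h1 : `|y - p| < x1 by rewrite /x1; lra.
  have h2 : x1 < x2 by rewrite /x2 /x1; lra.
  have h3 : x2 < x3 by rewrite /x3 /x2 /x1; lra.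
  have h4 : x3 < r by rewrite /x3 /x2 /x1; lra.
  have x1p : 0 <= x1 by lra.
  have x2p : 0 <= x2 by lra.
  have x3p : 0 <= x3 by lra.
  have c3 : cvgn (pseries c x3).
    have := Hc (p + x3); rewrite addrC addKr ger0_norm// => /(_ h4) h.
    by apply/cvg_ex; exists (g (p + x3)).
  have d2 : cvgn (pseries (pseries_diffs c) x2).
    by apply: is_cvg_pseries_diffs c3 _; rewrite !ger0_norm.
  have dd1 : cvgn (pseries (pseries_diffs (pseries_diffs c)) x1).
    by apply: is_cvg_pseries_diffs d2 _; rewrite !ger0_norm.
  have d1 : cvgn (pseries (pseries_diffs c) x1).
    by apply: is_cvg_pseries_inside d2 _; rewrite !ger0_norm.
  have c1 : cvgn (pseries c x1).
    by apply: is_cvg_pseries_inside c3 _; rewrite !ger0_norm// (lt_trans h2).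
  split; last by apply: is_cvg_pseries_inside d2 _; rewrite (ger0_norm x2p) (lt_trans h1).
  have D : is_derive (y - p) (1 : R) (fun x => limn (pseries c x))
      (limn (pseries (pseries_diffs c) (y - p))).
    by apply: pseries_snd_diffs c1 d1 dd1 _; rewrite (ger0_norm x1p).
  have Ds : is_derive y (1 : R) (fun y => y - p) 1.
    by apply: is_derive_eq; rewrite oppr0 addr0.
  have := @is_derive1_comp R (fun x => limn (pseries c x)) (fun y => y - p) y _ 1 D Ds; rewrite mulr1.
  apply: near_eq_is_derive.
  have : \forall t \near y, `|t - p| < r.
    have rr : 0 < r - `|y - p| by rewrite subr_gt0.
    near=> t; have ty : `|y - t| < r - `|y - p|.
      by near: t; apply: cvgr_dist_lt => //; exact: cvg_id.
    have -> : t - p = (t - y) + (y - p) by ring.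
    by rewrite (le_lt_trans (ler_normD _ _))// distrC -ltrBrDr.
  apply: filterS => t tr /=.
  by apply/cvg_lim => //; exact: Hc.
have D p : a < p < b -> is_derive p 1 g (derive1 g p).
  move=> hp; have [r [r0 [c /(_ p)]]] := key p hp.
  rewrite subrr normr0 => /(_ r0) [h _].
  by rewrite derive1E; apply: DeriveDef; first exact: ex_derive.
split=> // p hp; have [r [r0 [c Hc]]] := key p hp; exists r; split => //.
exists (pseries_diffs c) => y /Hc [h hc].
by rewrite derive1E derive_val.
Unshelve. all: by end_near. Qed.

Lemma locally_pseries_smooth (R : realType) (a b : R) (g : R -> R) :
  locally_pseries R a b g ->
  forall (n : nat) p, a < p < b -> is_derive p 1 (derive1n n g) (derive1n n.+1 g p).
Proof.
move=> Hg n; have : locally_pseries R a b (derive1n n g).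
  elim: n => [//|n IH]; rewrite derive1nS.
  by have [] := @locally_pseries_derive R a b _ IH.
by move=> /locally_pseries_derive[h _] p /h; rewrite derive1nS.
Qed.

(** In the double series around [(1, p)] every term with a positive power of the first increment
    vanishes on the line, which leaves the row [c 0]. *)
Lemma real_analytic_slice (R : realType) (a1 a2 a b : R) (phi : R * R -> R) :
  real_analytic_on (Vcone a1 a2 a b) phi -> locally_pseries R a b (fun s => phi (1, s)).
Proof.
move=> H p /andP[ap pb].
have [|r [r0 [c Hc]]] := H (1, p).
  by exists 1, p; split => //; split => //; split => //; rewrite /dil/= !powR1 !mul1r.
exists r; split => //; exists (c 0%N) => y yr.
have [|//|_] := Hc (1, y); first by rewrite /= subrr normr0.
apply: cvg_trans; apply: near_eq_cvg; exists 1%N => // -[//|N] _.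
rewrite /= subrr /pseries /series/= big_ord_recl/= [X in _ + X]big1 ?addr0.
  by rewrite big_mkord; apply: eq_bigr => i _; rewrite expr0 mulr1.
by move=> i _; rewrite big1// => j _; rewrite exprS mul0r mulr0 mul0r.
Qed.

(** * The Hessian of a homogeneous function *)

Lemma is_derive_cts (R : realType) (f : R -> R) (x l : R) :
  is_derive x 1 f l -> f @ x --> f x.
Proof. by move=> [h _]; exact/differentiable_continuous/derivable1_diffP. Qed.

(** The cone [V^{a,b}] without its dilation parameter: if [x] is the dilate of [(1, s)] by [t] and
    [al = a2 / a1], then [s = x2 x1^(-al)]. In this form membership is visibly an open condition, as
    differentiation requires. *)
Definition cone_chart (R : realType) (al a b : R) : set (R * R) :=
  [set x | 0 < x.1 /\ a < x.2 * x.1 `^ (- al) < b].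

(** Both partial derivatives are again a power of [x1] times a function of [s], so a second
    application produces the Hessian. The formula for [F] holds in the chart only, hence derivatives
    are compared through a neighbourhood. *)
Lemma dpart_homog (R : realType) (al a b be : R) (k dk : R -> R) (F : R * R -> R) :
  (forall s, a < s < b -> is_derive s 1 k (dk s)) ->
  (forall x, cone_chart R al a b x -> F x = x.1 `^ be * k (x.2 * x.1 `^ (- al))) ->
  forall x, cone_chart R al a b x ->
    dpart 1 F x = x.1 `^ (be - al) * dk (x.2 * x.1 `^ (- al)) /\
    dpart 0 F x = x.1 `^ (be - 1) *
      (be * k (x.2 * x.1 `^ (- al)) -
       al * (x.2 * x.1 `^ (- al)) * dk (x.2 * x.1 `^ (- al))).
Proof.
move=> kd FE [x1 x2] [/= x10 /andP[sa sb]].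
set s := x2 * x1 `^ (- al); have kds := kd s ltac:(by rewrite sa sb).
split.
  have D1 : is_derive x2 1 (fun t : R => t * x1 `^ (- al)) (x1 `^ (- al)).
    by apply: is_derive_eq; rewrite /GRing.scale/=; ring.
  have D2 := @is_derive1_comp R k (fun t => t * x1 `^ (- al)) x2 _ _ kds D1.
  have D3 : is_derive x2 1 (fun t => x1 `^ be * k (t * x1 `^ (- al)))
      (x1 `^ (be - al) * dk s).
    have -> : x1 `^ (be - al) * dk s = x1 `^ be * (dk s * x1 `^ (- al)).
      by rewrite powRD; [ring|rewrite (gt_eqF x10) implybT].
    have := D2; set f := k \o _ => D2'.
    have : is_derive x2 1 (fun t => x1 `^ be * f t) (x1 `^ be * (dk s * x1 `^ (- al))).
      by apply: is_derive_eq; rewrite /GRing.scale/=; ring.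
    by [].
  rewrite /dpart/= derive1E; have -> : x1 `^ (be - al) * dk s =
     'D_(1 : R) (fun t : R => x1 `^ be * k (t * x1 `^ (- al))) x2 by rewrite derive_val.
  apply: near_eq_derive.
  have c1 := @is_derive_cts R _ _ _ D1.
  near=> t; apply: FE; split => //=.
  by apply/andP; split; near: t; [exact: (cvgr_gt _ c1)|exact: (cvgr_lt _ c1)].
have P1 := @is_derive_powR R (- al) x1 x10; have P2 := @is_derive_powR R be x1 x10.
have D1 : is_derive x1 1 (fun t : R => x2 * t `^ (- al)) (x2 * (- al * x1 `^ (- al - 1))).
  by apply: is_derive_eq; rewrite /GRing.scale/=; ring.
have D2 := @is_derive1_comp R k (fun t => x2 * t `^ (- al)) x1 _ _ kds D1.
have D3 : is_derive x1 1 (fun t => t `^ be * k (x2 * t `^ (- al)))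
    (x1 `^ (be - 1) * (be * k s - al * s * dk s)).
  have -> : x1 `^ (be - 1) * (be * k s - al * s * dk s) =
      x1 `^ be * (dk s * (x2 * (- al * x1 `^ (- al - 1)))) + k s * (be * x1 `^ (be - 1)).
    have e1 : x1 `^ (be - 1) = x1 `^ be / x1.
      by rewrite powRB ?powRr1 ?(ltW x10)// (gt_eqF x10) implybT.
    have e2 : x1 `^ (- al - 1) = x1 `^ (- al) / x1.
      by rewrite powRB ?powRr1 ?(ltW x10)// (gt_eqF x10) implybT.
    by rewrite e1 e2 {2}/s; ring.
  have := D2; set f := k \o _ => D2'.
  have : is_derive x1 1 (fun t => t `^ be * f t)
     (x1 `^ be * (dk s * (x2 * (- al * x1 `^ (- al - 1)))) + k s * (be * x1 `^ (be - 1))).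
    by apply: is_derive_eq; rewrite /GRing.scale/=.
  by [].
rewrite /dpart/= derive1E.
have -> : x1 `^ (be - 1) * (be * k s - al * s * dk s) =
   'D_(1 : R) (fun t : R => t `^ be * k (x2 * t `^ (- al))) x1 by rewrite derive_val.
apply: near_eq_derive.
have c1 := @is_derive_cts R _ _ _ D1.
near=> t; apply: FE; split => //=.
  by near: t; apply: (cvgr_gt x1) => //; exact: cvg_id.
by apply/andP; split; near: t; [exact: (cvgr_gt _ c1)|exact: (cvgr_lt _ c1)].
Unshelve. all: by end_near. Qed.

Lemma hessian_homog (R : realType) (al a b M : R) (g : nat -> R -> R) (phi : R * R -> R) :
  (forall n s, a < s < b -> is_derive s 1 (g n) (g n.+1 s)) ->
  (forall x, cone_chart R al a b x -> phi x = x.1 `^ M * g 0%N (x.2 * x.1 `^ (- al))) ->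
  forall s, a < s < b ->
  let H := hessian phi (1, s) in
  [/\ H 0 0 = (M - 1) * (M * g 0%N s - al * s * g 1%N s) -
              al * s * (M * g 1%N s - al * g 1%N s - al * s * g 2%N s),
      H 0 1 = (M - al) * g 1%N s - al * s * g 2%N s,
      H 1 0 = (M - al) * g 1%N s - al * s * g 2%N s &
      H 1 1 = g 2%N s].
Proof.
move=> gd phiE s sab H.
pose k2 s := M * g 0%N s - al * s * g 1%N s.
pose dk2 s := M * g 1%N s - al * g 1%N s - al * s * g 2%N s.
have k2d t : a < t < b -> is_derive t 1 k2 (dk2 t).
  move=> ht; have h0 := gd 0%N t ht; have h1 := gd 1%N t ht.
  by rewrite /k2 /dk2; apply: is_derive_eq; rewrite /GRing.scale/=; ring.
have E := @dpart_homog R al a b M (g 0%N) (g 1%N) phi (gd 0%N) phiE.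
have E0 x : cone_chart R al a b x -> dpart 0 phi x = x.1 `^ (M - 1) * k2 (x.2 * x.1 `^ (- al)).
  by move=> /E[].
have E1 x : cone_chart R al a b x -> dpart 1 phi x = x.1 `^ (M - al) * g 1%N (x.2 * x.1 `^ (- al)).
  by move=> /E[].
have s1 : cone_chart R al a b (1, s) by split => //=; rewrite powR1 mulr1.
have [a01 a00] := @dpart_homog R al a b (M - 1) k2 dk2 (dpart 0 phi) k2d E0 _ s1.
have [a11 a10] := @dpart_homog R al a b (M - al) (g 1%N) (g 2%N) (dpart 1 phi) (gd 1%N) E1 _ s1.
move: a01 a00 a11 a10; rewrite /= !powR1 !mulr1 !mul1r => a01 a00 a11 a10.
rewrite /H /hessian !mxE a00 a01 a10 a11 /k2 /dk2; split => //; ring.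
Qed.

Lemma det_mx2 (R : realType) (A : 'M[R]_2) : \det A = A 0 0 * A 1 1 - A 0 1 * A 1 0.
Proof.
rewrite (expand_det_row _ ord0) !big_ord_recl big_ord0 /cofactor !det_mx11 !mxE.
rewrite /= addr0 expr0 mul1r expr1 mulN1r mulrN.
by congr (_ * A _ _ - A _ _ * A _ _); exact/val_inj.
Qed.

(** The terms in [s^2 h2^2] cancel in the determinant. This decides the vanishing order: if all
    derivatives of [h] up to order [K] vanish at a point, the surviving products vanish there to
    order at least [2 K - 1], whereas [h2^2] would guarantee only [2 K - 2]. *)
Lemma Qform_homog (R : realType) (al a b M : R) (g1 g2 : nat -> R -> R)
    (phi1 phi2 : R * R -> R) :
  (forall n s, a < s < b -> is_derive s 1 (g1 n) (g1 n.+1 s)) ->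
  (forall n s, a < s < b -> is_derive s 1 (g2 n) (g2 n.+1 s)) ->
  (forall x, cone_chart R al a b x -> phi1 x = x.1 `^ M * g1 0%N (x.2 * x.1 `^ (- al))) ->
  (forall x, cone_chart R al a b x -> phi2 x = x.1 `^ M * g2 0%N (x.2 * x.1 `^ (- al))) ->
  forall s z, a < s < b ->
  let h n := z.1 * g1 n s + z.2 * g2 n s in
  Qform phi1 phi2 (1, s) z = M * (M - 1) * h 0%N * h 2%N - (M - al) ^+ 2 * h 1%N ^+ 2 +
    al * (1 - al) * s * h 1%N * h 2%N.
Proof.
move=> d1 d2 e1 e2 s z sab h.
have [p00 p01 p10 p11] := @hessian_homog R al a b M g1 phi1 d1 e1 s sab.
have [q00 q01 q10 q11] := @hessian_homog R al a b M g2 phi2 d2 e2 s sab.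
rewrite /Qform det_mx2; move: p00 p01 p10 p11 q00 q01 q10 q11.
move: (hessian phi1 (1, s)) (hessian phi2 (1, s)) => A B p00 p01 p10 p11 q00 q01 q10 q11.
have mE i j : (z.1 *: A + z.2 *: B) i j = z.1 * A i j + z.2 * B i j by rewrite !mxE.
by rewrite !mE p00 p01 p10 p11 q00 q01 q10 q11 /h; ring.
Qed.

Lemma minQ_le (R : realType) (phi1 phi2 : R * R -> R) (x z : R * R) :
  z.1 ^+ 2 + z.2 ^+ 2 = 1 -> minQ phi1 phi2 x <= `|Qform phi1 phi2 x z|.
Proof.
move=> hz; apply: ge_inf; last by exists z.
by exists 0 => _ [w _ <-]; exact: normr_ge0.
Qed.

(** Induction on [i], from order [K + 1] downwards: the top derivative is bounded, and each mean
    value step lowers the order by one and gains a factor [|s - sg|]. *)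
Lemma taylor_vanish (R : realType) (h : nat -> R -> R) (x y sg : R) (K : nat) :
  x <= sg <= y ->
  (forall i z, x <= z <= y -> is_derive z 1 (h i) (h i.+1 z)) ->
  (forall j, (j <= K)%N -> h j sg = 0) ->
  exists2 C : R, 0 < C & forall i s, (i <= K.+1)%N -> x <= s <= y ->
    `|h (K.+1 - i)%N s| <= C * `|s - sg| ^+ i.
Proof.
move=> /andP[xs sy] hd h0.
have [C C0 HC] := @derivable_bounded R (h K.+1) x y (le_trans xs sy)
  (fun z hz => @ex_derive _ _ _ _ _ _ _ (hd K.+1 z hz)).
exists C => //; elim=> [|i IH] s iK hs.
  by rewrite subn0 expr0 mulr1 HC.
have jE : (K.+1 - i)%N = (K.+1 - i.+1).+1 by rewrite -subSn.
have {}IH := fun t => IH t (ltnW iK); rewrite jE in IH.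
have hv : h (K.+1 - i.+1)%N sg = 0 by apply: h0; rewrite subSS leq_subr.
set j := (K.+1 - i.+1)%N in IH hv *.
have /andP[xs' sy'] := hs.
have -> : h j s = h j s - h j sg by rewrite hv subr0.
rewrite exprSr mulrA.
have [ss|ss] := leP sg s.
  rewrite [X in _ <= _ * X]ger0_norm ?subr_ge0//.
  apply: (@mvt_norm_le R (h j) (h j.+1)) => // z /andP[z1 z2].
    by apply: hd; rewrite (le_trans xs z1) (le_trans z2 sy').
  apply: le_trans (IH z _) _; first by rewrite (le_trans xs z1) (le_trans z2 sy').
  rewrite ler_pM2l// lerXn2r ?nnegrE// !ger0_norm ?subr_ge0// ?(le_trans z1)// lerB//.
rewrite distrC [X in _ <= _ * X]distrC [X in _ <= _ * X]ger0_norm ?subr_ge0 ?(ltW ss)//.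
apply: (@mvt_norm_le R (h j) (h j.+1)) => //; first exact: ltW.
  by move=> z /andP[z1 z2]; apply: hd; rewrite (le_trans xs' z1) (le_trans z2 sy).
move=> z /andP[z1 z2].
apply: le_trans (IH z _) _; first by rewrite (le_trans xs' z1) (le_trans z2 sy).
by rewrite ler_pM2l// lerXn2r ?nnegrE// ![`|_ - sg|]distrC !ger0_norm ?subr_ge0// ?(le_trans z1)// lerB.
Qed.

(** Near [sg] the functions [h 0], [h 1], [h 2] are of orders [K + 1], [K], [K - 1], so the worst
    product is [h 1] times [h 2]. With [rho <= 1] the higher powers are replaced by the power
    [2 K - 1]. *)
Lemma degenerate_bound (R : realType) (al a b M sg : R) (h : nat -> R -> R) (K : nat) :
  a < sg < b -> (2 <= K)%N ->
  (forall n s, a < s < b -> is_derive s 1 (h n) (h n.+1 s)) ->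
  (forall j, (j <= K)%N -> h j sg = 0) ->
  exists C rho : R, [/\ 0 < C, 0 < rho, rho <= 1 & forall s, `|s - sg| <= rho ->
    a < s < b /\ `|M * (M - 1) * h 0%N s * h 2%N s - (M - al) ^+ 2 * h 1%N s ^+ 2 +
      al * (1 - al) * s * h 1%N s * h 2%N s| <= C * `|s - sg| ^+ (2 * K - 1)].
Proof.
move=> /andP[asg sgb] K2 hd h0.
pose rho := Num.min 1 (Num.min ((sg - a) / 2) ((b - sg) / 2)).
have r0 : 0 < rho by rewrite !lt_min ltr01 !divr_gt0// subr_gt0.
have r1 : rho <= 1 by rewrite ge_min lexx.
have ra : rho <= (sg - a) / 2 by rewrite !ge_min lexx orbT.
have rb : rho <= (b - sg) / 2 by rewrite !ge_min lexx !orbT.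
have sub s : sg - rho <= s <= sg + rho -> a < s < b.
  by move=> /andP[s1 s2]; apply/andP; split; clear -s1 s2 ra rb asg sgb; lra.
have sgin : sg - rho <= sg <= sg + rho by apply/andP; split; clear -r0; lra.
have [C C0 HC] := @taylor_vanish R h (sg - rho) (sg + rho) sg K sgin
  (fun i z hz => hd i z (sub z hz)) h0.
pose B := `|M * (M - 1)| + (M - al) ^+ 2 + `|al * (1 - al)| * (`|sg| + 1).
have B0 : 0 <= B by rewrite !addr_ge0 ?sqr_ge0// mulr_ge0// addr_ge0.
exists (C ^+ 2 * B + 1), rho; split => //.
  by rewrite ltr_wpDl// mulr_ge0// sqr_ge0.
move=> s hs; have hs' : sg - rho <= s <= sg + rho.
  by move: hs; rewrite ler_norml; clear; lra.
split; first exact: sub.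
set u := `|s - sg|; have u0 : 0 <= u by exact: normr_ge0.
have u1 : u <= 1 by exact: le_trans r1.
have b0 : `|h 0%N s| <= C * u ^+ K.+1.
  by have := HC K.+1 s (leqnn _) hs'; rewrite subnn.
have b1 : `|h 1%N s| <= C * u ^+ K.
  by have := HC K s (leqnSn _) hs'; rewrite subSnn.
have b2 : `|h 2%N s| <= C * u ^+ K.-1.
  have := HC K.-1 s _ hs'; rewrite (_ : (K.+1 - K.-1 = 2)%N); last first.
    by clear -K2; lia.
  by apply; apply: leq_trans (leq_pred _) _.
have prod (i j : nat) (v w : R) : (2 * K - 1 <= i + j)%N -> `|v| <= C * u ^+ i ->
    `|w| <= C * u ^+ j -> `|v| * `|w| <= C ^+ 2 * u ^+ (2 * K - 1).
  move=> ij hv hw; apply: (le_trans (ler_pM _ _ hv hw)) => //.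
  have -> : C * u ^+ i * (C * u ^+ j) = C ^+ 2 * u ^+ (i + j) by rewrite exprD; ring.
  by rewrite ler_pM2l ?exprn_gt0// ler_wiXn2l.
have p02 : `|h 0%N s| * `|h 2%N s| <= C ^+ 2 * u ^+ (2 * K - 1).
  by apply: (prod K.+1 K.-1) => //; clear -K2; lia.
have p12 : `|h 1%N s| * `|h 2%N s| <= C ^+ 2 * u ^+ (2 * K - 1).
  by apply: (prod K K.-1) => //; clear -K2; lia.
have p11 : `|h 1%N s| * `|h 1%N s| <= C ^+ 2 * u ^+ (2 * K - 1).
  by apply: (prod K K) => //; clear; lia.
have sb : `|s| <= `|sg| + 1.
  have -> : s = (s - sg) + sg by ring.
  by apply: (le_trans (ler_normD _ _)); rewrite addrC lerD2l.
apply: (@le_trans _ _ (B * (C ^+ 2 * u ^+ (2 * K - 1)))); last first.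
  by rewrite mulrA ler_wpM2r ?exprn_ge0// mulrC lerDl.
apply: (le_trans (ler_normD _ _)); rewrite /B mulrDl; apply: lerD.
  apply: (le_trans (ler_normB _ _)); rewrite mulrDl; apply: lerD.
    by rewrite -mulrA !normrM ler_wpM2l ?mulr_ge0// -normrM.
  by rewrite normrM (ger0_norm (sqr_ge0 _)) ler_wpM2l ?sqr_ge0// expr2 normrM.
rewrite -[X in `|X|]mulrA normrM [`|h 1%N s * _|]normrM normrM.
by rewrite ler_pM ?mulr_ge0// ler_wpM2l.
Qed.

Lemma small_power_absurd (R : realType) (D C rho : R) (n k : nat) :
  0 < D -> 0 < C -> 0 < rho -> rho <= 1 -> (n < k)%N ->
  exists u, [/\ 0 < u, u < rho & C * u ^+ k < D * u ^+ n].
Proof.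
move=> D0 C0 r0 r1 nk; pose u := Num.min (rho / 2) (D / (2 * C)).
have u0 : 0 < u by rewrite lt_min !divr_gt0// mulr_gt0.
have ur : u <= rho / 2 by rewrite ge_min lexx.
have uD : u <= D / (2 * C) by rewrite ge_min lexx orbT.
exists u; split => //; first by clear -ur r0; lra.
have u1 : u <= 1 by clear -ur r1 r0; lra.
rewrite -(subnK nk) addnC exprD exprSr -mulrA.
rewrite [ltRHS]mulrC [ltLHS]mulrCA ltr_pM2l ?exprn_gt0//.
rewrite mulrCA; apply: (@le_lt_trans _ _ (u * C)).
  by rewrite ler_wpM2l ?(ltW u0)// ler_piMr ?(ltW C0)// exprn_ile1// ltW.
apply: (@le_lt_trans _ _ (D / (2 * C) * C)); first by rewrite ler_pM2r.
have -> : D / (2 * C) * C = D / 2 by field; rewrite gt_eqF.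
by clear -D0; lra.
Qed.

(** Suppose all derivatives up to order [K] vanish at [s] in some direction. If [s != sg], then [Q]
    vanishes in this direction, against ellipticity. If [s = sg], then [Q] is [O(u^(2K - 1))] at
    distance [u], against the lower bound [D u^n]. One side of [sg] suffices; the sign [e] selects
    it. *)
Lemma nondegenerate (R : realType) (al a b c d M sg D del e : R) (g1 g2 : nat -> R -> R)
    (phi1 phi2 : R * R -> R) (n K : nat) :
  a < c -> d < b -> c <= sg <= d -> 0 < D -> 0 < del -> `|e| = 1 ->
  (2 <= K)%N -> (n < 2 * K - 1)%N ->
  (forall n s, a < s < b -> is_derive s 1 (g1 n) (g1 n.+1 s)) ->
  (forall n s, a < s < b -> is_derive s 1 (g2 n) (g2 n.+1 s)) ->
  (forall x, cone_chart R al a b x -> phi1 x = x.1 `^ M * g1 0%N (x.2 * x.1 `^ (- al))) ->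
  (forall x, cone_chart R al a b x -> phi2 x = x.1 `^ M * g2 0%N (x.2 * x.1 `^ (- al))) ->
  (forall s, c <= s <= d -> s != sg -> 0 < minQ phi1 phi2 (1, s)) ->
  (forall u, 0 < u < del -> a < sg + e * u < b ->
     D * u ^+ n <= minQ phi1 phi2 (1, sg + e * u)) ->
  forall s z1 z2, c <= s <= d -> z1 ^+ 2 + z2 ^+ 2 = 1 ->
    exists2 j, (j < K.+1)%N & z1 * g1 j s + z2 * g2 j s != 0.
Proof.
move=> ac db sgcd D0 del0 e1 K2 nK d1 d2 f1 f2 ell low s z1 z2 scd hz.
pose h j s := z1 * g1 j s + z2 * g2 j s.
have [//|hn] := pselect (exists2 j, (j < K.+1)%N & h j s != 0).
exfalso; have h0 j : (j <= K)%N -> h j s = 0.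
  by move=> jK; apply/eqP; apply: contra_notT hn => hj; exists j.
have cdab t : c <= t <= d -> a < t < b.
  by move=> /andP[t1 t2]; rewrite (lt_le_trans ac t1) (le_lt_trans t2 db).
have hd i t : a < t < b -> is_derive t 1 (h i) (h i.+1 t).
  move=> ht; have k1 := d1 i t ht; have k2 := d2 i t ht.
  by rewrite /h; apply: is_derive_eq; rewrite /GRing.scale/=; ring.
have QE t : a < t < b -> minQ phi1 phi2 (1, t) <= `|M * (M - 1) * h 0%N t * h 2%N t -
    (M - al) ^+ 2 * h 1%N t ^+ 2 + al * (1 - al) * t * h 1%N t * h 2%N t|.
  move=> ht; have := @minQ_le R phi1 phi2 (1, t) (z1, z2) hz.
  by rewrite (@Qform_homog R al a b M g1 g2 phi1 phi2 d1 d2 f1 f2 t (z1, z2) ht).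
have [ssg|ssg] := eqVneq s sg; last first.
  have := lt_le_trans (ell s scd ssg) (QE s (cdab s scd)).
  have K1 : (1 <= K)%N by exact: ltnW.
  by rewrite (h0 0%N)// (h0 1%N)// !(mulr0, mul0r) expr0n/= !(mulr0, subr0, addr0) normr0 ltxx.
rewrite ssg in h0.
have [C [rho [C0 r0 r1 HC]]] := @degenerate_bound R al a b M sg h K (cdab _ sgcd) K2 hd h0.
pose rr := Num.min rho del.
have rr0 : 0 < rr by rewrite lt_min r0.
have rr1 : rr <= 1 by rewrite ge_min r1.
have [u [u0 ur hu]] := @small_power_absurd R D C rr n (2 * K - 1) D0 C0 rr0 rr1 nK.
have ur1 : u < rho by apply: lt_le_trans ur _; rewrite ge_min lexx.
have ur2 : u < del by apply: lt_le_trans ur _; rewrite ge_min lexx orbT.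
have nu : `|sg + e * u - sg| = u by rewrite addrC addKr normrM e1 mul1r gtr0_norm.
have [hab] := HC (sg + e * u) ltac:(by rewrite nu ltW).
rewrite nu => hC; have := low u ltac:(by rewrite u0 ur2) hab.
move=> /le_trans/(_ (QE _ hab))/le_trans/(_ hC) hle.
by have := le_lt_trans hle hu; rewrite ltxx.
Qed.

(** * Reduction to one-dimensional integrals *)

Lemma bounded_integrable (d : measure_display) (T : measurableType d) (R : realType)
    (mu : {measure set T -> \bar R}) (A : set T) (f : T -> R) (B : R) :
  measurable A -> (mu A < +oo)%E -> measurable_fun A f ->
  (forall x, A x -> `|f x| <= B) -> mu.-integrable A (EFin \o f).
Proof.
move=> mA muA mf fB; apply: measurable_bounded_integrable => //.
exists B; split; first exact: num_real.
by move=> M BM x Ax; apply: (le_trans (fB x Ax)); exact: ltW.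
Qed.

Lemma measurable_cos (R : realType) : measurable_fun [set: R] (@cos R).
Proof. by apply: continuous_measurable_fun; exact: continuous_cos. Qed.

(** The integrand of the inner integral [J]: [x^al] is the Jacobian of the coordinates [(x, s)], and
    the shift [th] is 0 for the real part and [- pi / 2] for the imaginary part. *)
Definition osc_amp (R : realType) (al M A B C th x : R) : R :=
  x `^ al * cos (A * x + B * x `^ al + C * x `^ M + th).

Lemma measurable_osc_amp (R : realType) (al M A B C th : R) :
  measurable_fun [set: R] (osc_amp R al M A B C th).
Proof.
apply: measurable_funM; first exact: measurable_powR.
apply: measurableT_comp; first exact: measurable_cos.
apply: measurable_funD; last exact: measurable_cst.
apply: measurable_funD; last first.
  by apply: measurable_funM; [exact: measurable_cst|exact: measurable_powR].
apply: measurable_funD.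
  by apply: measurable_funM; [exact: measurable_cst|exact: measurable_id].
by apply: measurable_funM; [exact: measurable_cst|exact: measurable_powR].
Qed.

Lemma osc_amp_le (R : realType) (al M A B C th x u : R) : 0 <= al -> 0 <= x -> x <= u ->
  `|osc_amp R al M A B C th x| <= u `^ al.
Proof.
move=> al0 x0 xu; rewrite /osc_amp normrM (ger0_norm (powR_ge0 _ _)).
rewrite -[leRHS]mulr1 ler_pM ?powR_ge0//.
  by apply: ge0_ler_powR; rewrite ?nnegrE// (le_trans x0).
by rewrite ler_norml cos_le1 cos_geN1.
Qed.

Lemma integrable_osc_amp (R : realType) (al M A B C th u : R) : 0 <= al ->
  (@lebesgue_measure R).-integrable `[0, u] (EFin \o osc_amp R al M A B C th).
Proof.
move=> al0; apply: (@bounded_integrable _ _ R _ _ _ (u `^ al)) => //.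
- by rewrite /= lebesgue_measure_itv/=; case: ifP => _; rewrite ?ltry.
- by apply: measurable_funTS; exact: measurable_osc_amp.
- by move=> x /=; rewrite in_itv/= => /andP[x0 xu]; exact: osc_amp_le.
Qed.

Lemma Rintegral_osc_amp_le (R : realType) (al M A B C th u : R) : 0 <= al -> 0 <= u ->
  `|Rintegral (@lebesgue_measure R) `[0, u] (osc_amp R al M A B C th)| <= u `^ al * u.
Proof.
move=> al0 u0; have iu := @integrable_osc_amp R al M A B C th u al0.
apply: (le_trans (le_normr_Rintegral _ iu)) => //.
have lu : lebesgue_measure (`[0, u]%classic : set R) = u%:E.
  rewrite lebesgue_measure_itv/= lte_fin; case: ltP => [_|u0'].
    by rewrite oppr0 addr0.
  by congr EFin; apply/eqP; rewrite eq_le u0 u0'.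
have -> : u `^ al * u = \int[lebesgue_measure]_(x in `[0, u]) (u `^ al).
  by rewrite Rintegral_cst//= lu.
apply: le_Rintegral => //.
- exact: (integrable_norm iu).
- apply: (@bounded_integrable _ _ R _ _ _ (u `^ al)) => //.
  + by rewrite /= lu ltry.
  + by move=> x _; rewrite ger0_norm// powR_ge0.
- by move=> x /=; rewrite in_itv/= => /andP[x0 xu]; exact: osc_amp_le.
Qed.

Lemma osc_amp_cts (R : realType) (al M A B C th x : R) : 0 < x ->
  {for x, continuous (osc_amp R al M A B C th)}.
Proof.
move=> x0; have h1 := @is_derive_powR R al x x0; have h2 := @is_derive_powR R M x x0.
have : is_derive x 1 (osc_amp R al M A B C th) (derive1 (osc_amp R al M A B C th) x).
  have D : derivable (osc_amp R al M A B C th) x 1 by apply: ex_derive.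
  by rewrite derive1E; exact: DeriveDef.
by move=> [h _]; exact/differentiable_continuous/derivable1_diffP.
Qed.

(** The substitution [x = u^p] with [p = 1 / (1 + al)] absorbs the weight: [Phi] has a pure cosine
    as derivative, with exponents [p], [q = al p] and [r = M p]. Here [al != 1] separates [p] from
    [q], and [3 (1 + al) <= M] is [r >= 3]. *)
Lemma osc_inner (R : realType) (al M : R) : 0 < al -> al != 1 -> 3 * (1 + al) <= M ->
  exists2 K : R, 0 < K & forall A B C th : R, C != 0 ->
  `|Rintegral (@lebesgue_measure R) `[0, 1] (osc_amp R al M A B C th)|
    <= K * `|C| `^ (- ((1 + al) / M)).
Proof.
move=> al0 al1 M3; have al10 : 0 < 1 + al by lra.
have M0 : 0 < M by lra.
pose p := (1 + al)^-1; pose q := al / (1 + al); pose r := M / (1 + al).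
have p0 : 0 < p by rewrite invr_gt0.
have p1 : p < 1 by rewrite invf_lt1//; lra.
have q0 : 0 < q by rewrite divr_gt0.
have q1 : q < 1 by rewrite ltr_pdivrMr//; lra.
have pq : p != q.
  apply: contra_neq al1 => h; have : p * (1 + al) = q * (1 + al) by rewrite h.
  by rewrite /p /q mulVf ?gt_eqF// divfK ?gt_eqF.
have r3 : 3 <= r by rewrite ler_pdivlMr.
have [K K0 HK] := @osc_trinomial R p q r p0 p1 q0 q1 pq r3.
exists K => // A B C th C0.
pose Psi x := Rintegral (@lebesgue_measure R) `[0, x] (osc_amp R al M A B C th).
pose Phi u := (1 + al) * Psi (u `^ p).
have Psi0 : Psi 0 = 0 by rewrite /Psi set_itv1 Rintegral_set1.
have Phi0 : Phi 0 = 0 by rewrite /Phi powR0 ?gt_eqF// Psi0 mulr0.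
have DPsi (x : R) : 0 < x -> is_derive x 1 Psi (osc_amp R al M A B C th x).
  move=> x0; have xu : x < x + 1 by rewrite ltrDl.
  have [h1 h2] := @continuous_FTC1_closed R (osc_amp R al M A B C th) 0 x (x + 1) xu
    (@integrable_osc_amp R al M A B C th (x + 1) (ltW al0)) x0 (@osc_amp_cts R al M A B C th x x0).
  by rewrite -h2 derive1E; apply: DeriveDef.
have DPhi (z : R) : 0 < z -> is_derive z 1 Phi (cos (A * z `^ p + B * z `^ q + C * z `^ r + th)).
  move=> z0; have zp0 : 0 < z `^ p by rewrite powR_gt0.
  have D1 := DPsi _ zp0; have D2 := @is_derive_powR R p z z0.
  have D3 := @is_derive1_comp R Psi (fun z => z `^ p) z _ _ D1 D2.
  have : is_derive z 1 (fun z => (1 + al) * (Psi \o (fun z => z `^ p)) z)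
      ((1 + al) * (osc_amp R al M A B C th (z `^ p) * (p * z `^ (p - 1)))).
    by apply: is_derive_eq; rewrite /GRing.scale/=; ring.
  rewrite (_ : (1 + al) * _ = cos (A * z `^ p + B * z `^ q + C * z `^ r + th))//.
  rewrite /osc_amp -!powRrM.
  have -> : p * al = q by rewrite /p /q mulrC.
  have -> : p * M = r by rewrite /p /r mulrC.
  have -> : z `^ (p - 1) = (z `^ q)^-1.
    by rewrite -powRN; congr (_ `^ _); rewrite /p /q; field; rewrite gt_eqF.
  have zq : z `^ q != 0 by rewrite gt_eqF// powR_gt0.
  by rewrite /p; field; rewrite zq gt_eqF.
have P0 u : 0 < u -> `|Phi u - Phi 0| <= u.
  move=> u0; apply/ler_addgt0Pr => eps eps0.
  (* The derivative of [Phi] is known only away from 0, so the mean value bound starts at a small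
     [v]; what remains is at most [(1 + al) v <= eps] by the size of the integrand. *)
  pose v := Num.min u (eps / (1 + al)).
  have v0 : 0 < v by rewrite lt_min u0 divr_gt0.
  have vu : v <= u by rewrite ge_min lexx.
  have ve : v <= eps / (1 + al) by rewrite ge_min lexx orbT.
  have h1 : `|Phi u - Phi v| <= u - v.
    apply: (@mvt_cos_le R Phi (fun z => A * z `^ p + B * z `^ q + C * z `^ r + th)) => //.
    by move=> z /andP[vz _]; apply: DPhi; exact: lt_le_trans vz.
  have h2 : `|Phi v| <= eps.
    rewrite /Phi normrM gtr0_norm// -ler_pdivlMl// mulrC; apply: le_trans ve.
    apply: (le_trans (@Rintegral_osc_amp_le R al M A B C th _ (ltW al0) (powR_ge0 v p))).
    rewrite -powRrM -powRD; last by rewrite (gt_eqF v0) implybT.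
    by rewrite (_ : p * al + p = 1) ?powRr1 ?(ltW v0)//; rewrite /p; field; rewrite gt_eqF.
  rewrite Phi0 subr0 -[Phi u](subrK (Phi v)); apply: (le_trans (ler_normD _ _)).
  by clear -h1 h2 v0; lra.
have := HK A B C th Phi C0 DPhi P0; rewrite Phi0 subr0 /Phi powR1 normrM gtr0_norm//.
have -> : r^-1 = (1 + al) / M by rewrite /r invf_div.
apply: le_trans; rewrite -[leLHS]mul1r ler_wpM2r//; clear -al0; lra.
Qed.

Lemma measurable_lt_set (d : measure_display) (T : measurableType d) (R : realType)
    (f g : T -> R) : measurable_fun [set: T] f -> measurable_fun [set: T] g ->
  measurable [set x | f x < g x].
Proof.
move=> mf mg; have -> : [set x | f x < g x] = setT `&` (g \- f) @^-1` `]0, +oo[%classic.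
  by apply/seteqP; split => x /=; rewrite in_itv/= andbT subr_gt0; [|case].
by apply: measurable_funB => //; exact: measurable_itv.
Qed.

Lemma scale_integral (R : realType) (k c d : R) (G : R -> R) : 0 < k -> c <= d ->
  continuous G ->
  (\int[@lebesgue_measure R]_(y in `](k * c)%R, (k * d)%R[) (G y)%:E =
   \int[@lebesgue_measure R]_(s in `]c, d[) (G (k * s)%R * k)%R%:E)%E.
Proof.
move=> k0 cd cG.
have dF (s : R) : is_derive s 1 (fun s : R => k * s) k.
  by apply: is_derive_eq; rewrite /GRing.scale/= mulr1.
have DF : derive1 (fun s : R => k * s) = cst k.
  by apply/funext => s; rewrite derive1E derive_val.
have cF (s : R) : {for s, continuous (fun s : R => k * s)}.
  by have [h _] := dF s; exact/differentiable_continuous/derivable1_diffP.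
have cGk : continuous (fun s => G (k * s) * k).
  move=> s; apply: cvgM; last exact: cvg_cst.
  by apply: (@continuous_comp _ _ _ (fun s => k * s) G); [exact: cF|exact: cG].
rewrite -(@integral_itv_bndoo R (k * c) (k * d) (EFin \o G) true false); last first.
  by apply/measurable_EFinP; apply: measurable_funTS; exact: continuous_measurable_fun.
rewrite -(@integral_itv_bndoo R c d (fun s => (G (k * s) * k)%:E) true false); last first.
  by apply/measurable_EFinP; apply: measurable_funTS; exact: continuous_measurable_fun.
have := @integration_by_substitution_increasing R (fun s => k * s) G c d cd.
rewrite DF; apply.
- by move=> x y _ _ xy; rewrite ltr_pM2l.
- by move=> x _; exact: cvg_cst.
- exact: is_cvg_cst.
- exact: is_cvg_cst.
- split.
  + by move=> x _; have [] := dF x.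
  + by apply: cvg_at_right_filter; exact: cF.
  + by apply: cvg_at_left_filter; exact: cF.
- by apply: continuous_subspaceT.
Qed.

Lemma leb2_box_lt_pinfty (R : realType) (A : set (R * R)) (L : R) :
  measurable A -> (forall p, A p -> 0 <= p.1 <= 1 /\ - L <= p.2 <= L) ->
  (@leb2 R A < +oo)%E.
Proof.
move=> mA Asub.
have mB : measurable (`[0%R, 1%R]%classic `*` `[- L, L]%classic : set (R * R)).
  by apply: measurableX.
apply: (@le_lt_trans _ _ (@leb2 R (`[0%R, 1%R]%classic `*` `[- L, L]%classic))).
  apply: le_measure; [by rewrite inE|by rewrite inE|].
  by move=> p /Asub[h1 h2]; split => /=; rewrite in_itv/=.
rewrite /leb2 product_measure1E//= !lebesgue_measure_itv/=.
by do 2 case: ifP => _; rewrite ?mul0e ?mule0 -?EFinD -?EFinM ltry.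
Qed.

Lemma Vcone1P (R : realType) (a1 a2 c d : R) (p : R * R) : 0 < a1 ->
  Vcone1 a1 a2 c d p <-> [/\ 0 < p.1, p.1 < 1, p.1 `^ (a2 / a1) * c < p.2 &
    p.2 < p.1 `^ (a2 / a1) * d].
Proof.
move=> a10; split.
  move=> [t [s [t0 [t1 [cs [sd ->]]]]]]; rewrite /dil/= mulr1.
  have -> : (t `^ a1) `^ (a2 / a1) = t `^ a2.
    by rewrite -powRrM mulrCA divff ?gt_eqF// mulr1.
  have ta2 : 0 < t `^ a2 by rewrite powR_gt0.
  split; rewrite ?powR_gt0 ?ltr_pM2l//.
  rewrite [ltRHS](_ : _ = 1 `^ a1); last by rewrite powR1.
  by apply: gt0_ltr_powR; rewrite ?nnegrE ?ltW.
case: p => x y [/= x0 x1 h1 h2].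
have xa : 0 < x `^ (a2 / a1) by rewrite powR_gt0.
exists (x `^ a1^-1), (y / x `^ (a2 / a1)); split; first exact: powR_gt0.
split.
  rewrite [ltRHS](_ : _ = 1 `^ a1^-1); last by rewrite powR1.
  by apply: gt0_ltr_powR; rewrite ?nnegrE ?invr_gt0 ?ltW.
split; first by rewrite ltr_pdivlMr// mulrC.
split; first by rewrite ltr_pdivrMr// mulrC.
rewrite /dil/= mulr1 -!powRrM mulVf ?gt_eqF// powRr1 ?ltW// [a1^-1 * a2]mulrC.
by rewrite mulrCA divff ?gt_eqF// mulr1.
Qed.

(** The profile [H] lives on the whole line, so that for continuous [H] the integrand is measurable
    on all of the plane. *)
Definition cone_phase_cos (R : realType) (al M xi1 xi2 th : R) (H : R -> R) (p : R * R) : R :=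
  cos (xi1 * p.1 + xi2 * p.2 + H (p.2 * p.1 `^ (- al)) * p.1 `^ M + th).

Definition polar_phase_cos (R : realType) (al M xi1 xi2 th : R) (H : R -> R) (p : R * R) : R :=
  osc_amp R al M xi1 (xi2 * p.2) (H p.2) th p.1.

Lemma measurable_cone_phase_cos (R : realType) (al M xi1 xi2 th : R) (H : R -> R) :
  continuous H -> measurable_fun [set: R * R] (cone_phase_cos R al M xi1 xi2 th H).
Proof.
move=> cH; apply: measurableT_comp; first exact: measurable_cos.
have mf : measurable_fun [set: R * R] (fst : R * R -> R) by exact: measurable_fst.
have ms : measurable_fun [set: R * R] (snd : R * R -> R) by exact: measurable_snd.
have mp (e : R) : measurable_fun [set: R * R] (fun p : R * R => p.1 `^ e).
  exact: (measurableT_comp (@measurable_powR R e) mf).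
apply: measurable_funD; last exact: measurable_cst.
apply: measurable_funD.
  by apply: measurable_funD; apply: measurable_funM => //; exact: measurable_cst.
apply: measurable_funM; last exact: mp.
have mH : measurable_fun [set: R] H by exact: continuous_measurable_fun.
have ma : measurable_fun [set: R * R] (fun p : R * R => p.2 * p.1 `^ (- al)).
  by apply: measurable_funM; [exact: ms|exact: mp].
exact: (measurableT_comp mH ma).
Qed.

Lemma measurable_polar_phase_cos (R : realType) (al M xi1 xi2 th : R) (H : R -> R) :
  continuous H -> measurable_fun [set: R * R] (polar_phase_cos R al M xi1 xi2 th H).
Proof.
move=> cH.
have mf : measurable_fun [set: R * R] (fst : R * R -> R) by exact: measurable_fst.
have ms : measurable_fun [set: R * R] (snd : R * R -> R) by exact: measurable_snd.
have mp (e : R) : measurable_fun [set: R * R] (fun p : R * R => p.1 `^ e).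
  exact: (measurableT_comp (@measurable_powR R e) mf).
apply: measurable_funM; first exact: mp.
apply: measurableT_comp; first exact: measurable_cos.
apply: measurable_funD; last exact: measurable_cst.
apply: measurable_funD; last first.
  apply: measurable_funM; last exact: mp.
  have mH : measurable_fun [set: R] H by exact: continuous_measurable_fun.
  exact: (measurableT_comp mH ms).
apply: measurable_funD.
  by apply: measurable_funM => //; exact: measurable_cst.
apply: measurable_funM; last exact: mp.
by apply: measurable_funM => //; exact: measurable_cst.
Qed.

Lemma cos_norm_le1 (R : realType) (x : R) : `|cos x| <= 1.
Proof. by rewrite ler_norml cos_le1 cos_geN1. Qed.

Lemma integrable_restrict (d : measure_display) (T : measurableType d) (R : realType)
    (mu : {measure set T -> \bar R}) (A : set T) (f : T -> \bar R) :
  measurable A -> mu.-integrable A f -> mu.-integrable setT (f \_ A).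
Proof. by move=> mA; apply: (integrable_mkcond f mA).1. Qed.

Definition unit_box (R : realType) (c d : R) : set (R * R) :=
  [set p | [/\ 0 < p.1, p.1 < 1, c < p.2 & p.2 < d]].

Lemma measurable_unit_box (R : realType) (c d : R) : measurable (unit_box R c d).
Proof.
have -> : unit_box R c d = `]0, 1[%classic `*` `]c, d[%classic.
  apply/seteqP; split => -[x y].
    by move=> [/= h1 h2 h3 h4]; split; rewrite /= in_itv/= ?h1 ?h3.
  by move=> [/= + +]; rewrite !in_itv/= => /andP[h1 h2] /andP[h3 h4]; split.
exact: measurableX.
Qed.

Lemma measurable_Vcone1 (R : realType) (a1 a2 c d : R) : 0 < a1 ->
  measurable (Vcone1 a1 a2 c d).
Proof.
move=> a10.
have mf : measurable_fun [set: R * R] (fst : R * R -> R) by exact: measurable_fst.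
have ms : measurable_fun [set: R * R] (snd : R * R -> R) by exact: measurable_snd.
have mp (e k : R) : measurable_fun [set: R * R] (fun p : R * R => p.1 `^ e * k).
  by apply: measurable_funM => //; exact: (measurableT_comp (@measurable_powR R e) mf).
have -> : Vcone1 a1 a2 c d =
    ([set p : R * R | 0 < p.1] `&` [set p | p.1 < 1]) `&`
    ([set p | p.1 `^ (a2 / a1) * c < p.2] `&` [set p | p.2 < p.1 `^ (a2 / a1) * d]).
  apply/seteqP; split => p.
    by move=> /(Vcone1P R a1 a2 c d p a10)[].
  by move=> [[h1 h2] [h3 h4]]; apply/(Vcone1P R a1 a2 c d p a10).
by apply: measurableI; apply: measurableI; apply: measurable_lt_set.
Qed.

(** For [x] in []0, 1[] the substitution [y = x^al s] straightens the slice of the cone, and its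
    Jacobian becomes the weight in [osc_amp]. For other [x] both slices are empty. *)
Lemma polar_slice (R : realType) (a1 a2 c d M xi1 xi2 th : R) (H : R -> R) (x : R) :
  0 < a1 -> c <= d -> continuous H ->
  (\int[@lebesgue_measure R]_y
     ((EFin \o cone_phase_cos R (a2 / a1) M xi1 xi2 th H) \_ (Vcone1 a1 a2 c d)) (x, y) =
   \int[@lebesgue_measure R]_s
     ((EFin \o polar_phase_cos R (a2 / a1) M xi1 xi2 th H) \_ (unit_box R c d)) (x, s))%E.
Proof.
move=> a10 cd cH; set al := a2 / a1.
have [/andP[x0 x1]|xn] := boolP (0 < x < 1); last first.
  apply: eq_integral => y _; rewrite !patchE !memNset//.
    by move=> [h1 h2 _ _]; rewrite h1 h2 in xn.
  by move=> /(Vcone1P R a1 a2 c d _ a10)[h1 h2 _ _]; rewrite /= in h1 h2; rewrite h1 h2 in xn.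
pose k := x `^ al; have k0 : 0 < k by rewrite powR_gt0.
pose G y := cone_phase_cos R al M xi1 xi2 th H (x, y).
have cG : continuous G.
  move=> y; apply: (@continuous_comp _ _ _ (fun y : R => xi1 * x + xi2 * y +
    H (y * x `^ (- al)) * x `^ M + th) (@cos R)); last exact: continuous_cos.
  apply: cvgD; last exact: cvg_cst.
  apply: cvgD.
    apply: cvgD; first exact: cvg_cst.
    by apply: cvgM; [exact: cvg_cst|exact: cvg_id].
  apply: cvgM; last exact: cvg_cst.
  apply: (@continuous_comp _ _ _ (fun y : R => y * x `^ (- al)) H); last exact: cH.
  by apply: cvgM; [exact: cvg_id|exact: cvg_cst].
transitivity (\int[@lebesgue_measure R]_(y in `](k * c)%R, (k * d)%R[) (G y)%:E)%E.
  rewrite [RHS]integral_mkcond; apply: eq_integral => y _; rewrite !patchE.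
  congr (if _ then _ else _); apply/idP/idP; rewrite !inE/=.
    by move=> /(Vcone1P R a1 a2 c d _ a10)[_ _ h1 h2]; rewrite in_itv/= h1 h2.
  by rewrite in_itv/= => /andP[h1 h2]; apply/(Vcone1P R a1 a2 c d _ a10); split.
rewrite scale_integral// [LHS]integral_mkcond; apply: eq_integral => s _; rewrite !patchE.
have -> : (s \in [set` `]c, d[]) = ((x, s) \in unit_box R c d).
  apply/idP/idP; rewrite !inE/= in_itv/=.
    by move=> /andP[h1 h2]; split.
  by move=> [_ _ /= -> ->].
case: ifP => // _; congr EFin.
rewrite /G /cone_phase_cos /polar_phase_cos /osc_amp/= mulrC -/k; congr (_ * cos _).
have -> : k * s * x `^ (- al) = s.
  by rewrite powRN -/k mulrAC divff ?gt_eqF// mul1r.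
by ring.
Qed.

Lemma abs_fine_le (R : realType) (X : \bar R) (B : R) :
  (`|X| <= B%:E)%E -> `|fine X| <= B.
Proof. by case: X => [r| |] /=; rewrite ?lee_fin// leNgt ltry. Qed.

(** Fubini is applied twice: first with the second coordinate inside, to change it into [s] slice by
    slice, then with [s] outside, so that the inner integral is the one bounded by [w s]. *)
Lemma polar_bound (R : realType) (a1 a2 c d M xi1 xi2 th B : R) (H w : R -> R) :
  0 < a1 -> 0 < a2 -> c <= d -> continuous H ->
  measurable_fun [set: R] w -> (forall s, 0 <= w s) ->
  (forall s, c < s < d ->
    `|Rintegral (@lebesgue_measure R) `[0, 1]
       (osc_amp R (a2 / a1) M xi1 (xi2 * s) (H s) th)| <= w s) ->
  (\int[@lebesgue_measure R]_(s in `[c, d]) (w s)%:E <= B%:E)%E ->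
  `|Rintegral (@leb2 R) (Vcone1 a1 a2 c d) (cone_phase_cos R (a2 / a1) M xi1 xi2 th H)| <= B.
Proof.
move=> a10 a20 cd cH mw w0 Jw wB; set al := a2 / a1.
have al0 : 0 < al by rewrite divr_gt0.
set F := cone_phase_cos R al M xi1 xi2 th H.
set T := polar_phase_cos R al M xi1 xi2 th H.
set V := Vcone1 a1 a2 c d.
have mV : measurable V by exact: measurable_Vcone1.
pose L := `|c| + `|d|.
have cL : - L <= c.
  by have := ler_norm (- c); have := normr_ge0 d; rewrite normrN /L; lra.
have dL : d <= L by have := ler_norm d; have := normr_ge0 c; rewrite /L; lra.
have iF : (@lebesgue_measure R \x @lebesgue_measure R)%E.-integrable V (EFin \o F).
  apply: (@bounded_integrable _ _ R _ _ _ 1) => //.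
  - apply: (@leb2_box_lt_pinfty R V L) => // p /(Vcone1P R a1 a2 c d p a10)[h1 h2 h3 h4].
    have k1 : p.1 `^ al <= 1.
      by rewrite -(powRr0 p.1); apply: ger_powR; rewrite ?h1 ?ltW.
    have k0 := powR_ge0 p.1 al.
    have L0 : 0 <= L by rewrite addr_ge0.
    have kL : p.1 `^ al * L <= L by rewrite ler_piMl.
    have kc : - (p.1 `^ al * L) <= p.1 `^ al * c by rewrite -mulrN ler_wpM2l.
    have kd : p.1 `^ al * d <= p.1 `^ al * L by rewrite ler_wpM2l.
    split; apply/andP; split; clear -h1 h2 h3 h4 kL kc kd; rewrite -/al in h3 h4; lra.
  - by apply: measurable_funTS; exact: measurable_cone_phase_cos.
  - by move=> p _; exact: cos_norm_le1.
have iT : (@lebesgue_measure R \x @lebesgue_measure R)%E.-integrable (unit_box R c d) (EFin \o T).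
  apply: (@bounded_integrable _ _ R _ _ _ 1).
  - exact: measurable_unit_box.
  - apply: (@leb2_box_lt_pinfty R _ L); first exact: measurable_unit_box.
    by move=> p [h1 h2 h3 h4]; split; apply/andP; split; clear -h1 h2 h3 h4 cL dL; lra.
  - by apply: measurable_funTS; exact: measurable_polar_phase_cos.
  - move=> p [h1 h2 _ _]; have := @osc_amp_le R al M xi1 (xi2 * p.2) (H p.2) th p.1 1.
    by rewrite powR1; apply; rewrite ?ltW.
have mV' : measurable (V : set (measurableTypeR R * measurableTypeR R)) by exact: mV.
have mU' : measurable (unit_box R c d : set (measurableTypeR R * measurableTypeR R)).
  exact: measurable_unit_box.
have iF' : (@lebesgue_measure R \x @lebesgue_measure R)%E.-integrable setT ((EFin \o F) \_ V).
  by apply: integrable_restrict.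
have iT' : (@lebesgue_measure R \x @lebesgue_measure R)%E.-integrable setT
    ((EFin \o T) \_ (unit_box R c d)).
  by apply: integrable_restrict.
apply: abs_fine_le.
rewrite integral_mkcond /leb2 -(integral12_prod_meas1 iF') /fubini_F.
under eq_integral do rewrite polar_slice//.
rewrite (Fubini iT').
apply: (le_trans (le_abse_integral _ _ _)) => //.
  exact: (measurable_fubini_G iT').
apply: le_trans wB; rewrite [leRHS]integral_mkcond.
apply: ge0_le_integral => //.
- by apply: measurableT_comp => //; exact: (measurable_fubini_G iT').
- apply/(measurable_restrictT _ _).1 => //.
  by apply/measurable_EFinP; apply: measurable_funTS.
move=> s _; rewrite patchE.
have [/andP[cs sd]|sn] := boolP (c < s < d); last first.
  rewrite integral0_eq ?abse0.
    by case: ifP => //; rewrite lee_fin.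
  move=> x _; rewrite patchE memNset// => -[_ _ /= h1 h2].
  by rewrite h1 h2 in sn.
rewrite mem_set/=; last by rewrite in_itv/= !ltW.
have -> : (\int[@lebesgue_measure R]_x ((EFin \o T) \_ (unit_box R c d)) (x, s) =
    \int[@lebesgue_measure R]_(x in `[0%R, 1%R]) (osc_amp R al M xi1 (xi2 * s) (H s) th x)%:E)%E.
  rewrite (@integral_itv_bndoo R 0 1
    (fun x => (osc_amp R al M xi1 (xi2 * s) (H s) th x)%:E) true false); last first.
    by apply/measurable_EFinP; apply: measurable_funTS; exact: measurable_osc_amp.
  rewrite [RHS]integral_mkcond; apply: eq_integral => x _; rewrite !patchE.
  congr (if _ then _ else _); apply/idP/idP; rewrite !inE/=.
    by move=> [/= h1 h2 _ _]; rewrite in_itv/= h1 h2.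
  by rewrite in_itv/= => /andP[h1 h2]; split.
rewrite -EFin_normr_Rintegral//; last exact: integrable_osc_amp (ltW al0).
by rewrite lee_fin Jw// cs.
Qed.

(** * Integrals of power weights around a centre *)

Lemma is_derive_affine_powR (R : realType) (e t u s : R) : e < 1 -> 0 < t + u * s ->
  is_derive s 1 (fun s => (t + u * s) `^ (1 - e) / (1 - e)) (u * (t + u * s) `^ (- e)).
Proof.
move=> e1 p0; have e10 : 1 - e != 0 by rewrite gt_eqF// subr_gt0.
have D1 : is_derive s 1 (fun s : R => t + u * s) u.
  by apply: is_derive_eq; rewrite /GRing.scale/=; ring.
have D2 := @is_derive_powR R (1 - e) _ p0.
have D3 := @is_derive1_comp R (fun x => x `^ (1 - e)) (fun s => t + u * s) s _ _ D2 D1.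
rewrite (_ : (fun s => (t + u * s) `^ (1 - e) / (1 - e)) =
  (fun s => (1 - e)^-1 * ((fun x => x `^ (1 - e)) \o (fun s => t + u * s)) s)); last first.
  by apply/funext => x /=; rewrite mulrC.
apply: is_derive_eq; rewrite /GRing.scale/= (_ : 1 - e - 1 = - e); last by ring.
by field.
Qed.

(** [u = 1] and [u = -1] serve the two sides of a centre; bounding by the sum of the endpoint terms
    instead of their difference covers both signs at once. *)
Lemma affine_powR_integral (R : realType) (e t u x y : R) : 0 < e -> e < 1 -> x <= y ->
  `|u| = 1 -> (forall s, x <= s <= y -> 0 < t + u * s) ->
  (\int[@lebesgue_measure R]_(s in `[x, y]) ((t + u * s) `^ (- e))%:E <=
   (((t + u * x) `^ (1 - e) + (t + u * y) `^ (1 - e)) / (1 - e))%:E)%E.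
Proof.
move=> e0 e1 xy u1 pos; have e10 : 0 < 1 - e by rewrite subr_gt0.
move: xy; rewrite le_eqVlt => /predU1P[<-|xy].
  rewrite set_itv1 integral_set1 lee_fin; apply: divr_ge0; last exact: ltW.
  by rewrite addr_ge0 ?powR_ge0.
have uu : u * u = 1 by rewrite -expr2 -real_normK ?num_real// u1 expr1n.
pose F s := u * ((t + u * s) `^ (1 - e) / (1 - e)).
have dF (s : R) : x <= s <= y -> is_derive s 1 F ((t + u * s) `^ (- e)).
  move=> hs; have h := @is_derive_affine_powR R e t u s e1 (pos s hs).
  rewrite /F; move: h; set f := (fun s => _) => h.
  have : is_derive s 1 (fun s => u * f s) ((t + u * s) `^ (- e)).
    apply: is_derive_eq; rewrite /GRing.scale/= mulrA uu mul1r.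
    by [].
  by [].
have cF (s : R) : x <= s <= y -> {for s, continuous F}.
  by move=> /dF[h _]; exact/differentiable_continuous/derivable1_diffP.
have cf : {within `[x, y], continuous (fun s => (t + u * s) `^ (- e))}.
  apply: derivable_within_continuous => s; rewrite in_itv/= => hs.
  have D1 : is_derive s 1 (fun s : R => t + u * s) u.
    by apply: is_derive_eq; rewrite /GRing.scale/=; ring.
  have D2 := @is_derive_powR R (- e) _ (pos s hs).
  by have [] := @is_derive1_comp R (fun x => x `^ (- e)) (fun s => t + u * s) s _ _ D2 D1.
have xx : x <= x <= y by rewrite lexx ltW.
have yy : x <= y <= y by rewrite lexx ltW.
rewrite (@continuous_FTC2 R _ F x y xy cf).
- rewrite -EFinB lee_fin /F -mulrBr -mulrBl.
  apply: (le_trans (ler_norm _)); rewrite normrM u1 mul1r normrM [`|(1 - e)^-1|]ger0_norm.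
    rewrite ler_wpM2r ?invr_ge0 ?(ltW e10)//; apply: (le_trans (ler_normB _ _)).
    by rewrite !ger0_norm ?powR_ge0// addrC.
  by rewrite invr_ge0 ltW.
- split.
  + by move=> s; rewrite in_itv/= => /andP[h1 h2]; have [] := dF s ltac:(by rewrite !ltW).
  + by apply: cvg_at_right_filter; exact: cF.
  + by apply: cvg_at_left_filter; exact: cF.
- move=> s; rewrite in_itv/= => /andP[h1 h2]; rewrite derive1E.
  by have D := dF s ltac:(by rewrite !ltW); rewrite derive_val.
Qed.

Lemma measurable_weight (R : realType) (tau z e : R) :
  measurable_fun [set: R] (fun s : R => (tau + `|s - z|) `^ (- e)).
Proof.
have m1 : measurable_fun [set: R] (fun s : R => tau + `|s - z|).
  apply: measurable_funD; first exact: measurable_cst.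
  apply: (@measurableT_comp _ _ _ _ _ _ (@Num.norm R R)); first exact: normr_measurable.
  by apply: measurable_funB.
exact: (measurableT_comp (@measurable_powR R (- e)) m1).
Qed.

(** Splitting at [z] removes the absolute value. Because [e < 1] the bound is independent of [tau]
    and [z]; the factor 4 counts two endpoint terms on each side. *)
Lemma weight_integral (R : realType) (c d e tau z : R) : 0 < e -> e < 1 ->
  0 < tau -> tau <= 1 -> c <= z <= d ->
  (\int[@lebesgue_measure R]_(s in `[c, d]) ((tau + `|s - z|) `^ (- e))%:E <=
   (4 * (1 + (d - c)) `^ (1 - e) / (1 - e))%:E)%E.
Proof.
move=> e0 e1 t0 t1 /andP[cz zd].
have e10 : 0 < 1 - e by rewrite subr_gt0.
have mE (A : set R) : measurable_fun A (fun s : R => ((tau + `|s - z|) `^ (- e))%:E).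
  by apply/measurable_EFinP; apply: measurable_funTS; exact: measurable_weight.
have pb (x : R) : 0 <= x -> x <= 1 + (d - c) -> x `^ (1 - e) <= (1 + (d - c)) `^ (1 - e).
  by move=> x0 xx; apply: ge0_ler_powR; rewrite ?nnegrE ?(ltW e10)// (le_trans x0).
have -> : `[c, d]%classic = `[c, z]%classic `|` `]z, d]%classic :> set R.
  by rewrite -itv_bndbnd_setU ?bnd_simp.
rewrite ge0_integral_setU//=; [|exact: mE| |]; last 2 first.
  by move=> s _; rewrite lee_fin powR_ge0.
  by apply/disj_setPS => s [] /=; rewrite !in_itv/= => /andP[_ h1] /andP[h2 _];
    move: h2; rewrite ltNge h1.
rewrite integral_itv_obnd_cbnd; last exact: mE.
set W := (1 + (d - c)) `^ (1 - e).
have -> : 4 * W / (1 - e) = (W + W) / (1 - e) + (W + W) / (1 - e).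
  by field; rewrite gt_eqF.
rewrite EFinD; apply: leeD.
  have -> : (\int[@lebesgue_measure R]_(s in `[c, z]) ((tau + `|s - z|) `^ (- e))%R%:E =
      \int[@lebesgue_measure R]_(s in `[c, z]) ((tau + z + -1 * s) `^ (- e))%R%:E)%E.
    apply: eq_integral => s; rewrite inE/= in_itv/= => /andP[_ sz].
    by rewrite distrC ger0_norm ?subr_ge0//; congr ((_ `^ _)%:E); ring.
  apply: (le_trans (@affine_powR_integral R e (tau + z) (-1) c z e0 e1 cz _ _)).
  - by rewrite normrN1.
  - by move=> s /andP[_ sz]; clear -sz t0; lra.
  - rewrite lee_fin ler_pM2r ?invr_gt0//; apply: lerD; apply: pb; clear -cz zd t0 t1; lra.
have -> : (\int[@lebesgue_measure R]_(s in `[z, d]) ((tau + `|s - z|) `^ (- e))%R%:E =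
    \int[@lebesgue_measure R]_(s in `[z, d]) ((tau - z + 1 * s) `^ (- e))%R%:E)%E.
  apply: eq_integral => s; rewrite inE/= in_itv/= => /andP[zs _].
  by rewrite ger0_norm ?subr_ge0//; congr ((_ `^ _)%:E); ring.
apply: (le_trans (@affine_powR_integral R e (tau - z) 1 z d e0 e1 zd _ _)).
- by rewrite normr1.
- by move=> s /andP[sz _]; clear -sz t0; lra.
- rewrite lee_fin ler_pM2r ?invr_gt0//; apply: lerD; apply: pb; clear -cz zd t0 t1; lra.
Qed.

Lemma sum_weight_integral (R : realType) (c d W : R) (f : R -> R -> R) (Z : seq R) :
  (forall z, z \in Z -> (\int[@lebesgue_measure R]_(s in `[c, d]) (f z s)%:E <= W%:E)%E) ->
  (forall z, measurable_fun [set: R] (f z)) -> (forall z s, 0 <= f z s) ->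
  (\int[@lebesgue_measure R]_(s in `[c, d]) (\sum_(z <- Z) f z s)%:E <= ((size Z)%:R * W)%:E)%E.
Proof.
move=> H mf f0.
have -> : (\int[@lebesgue_measure R]_(s in `[c, d]) (\sum_(z <- Z) f z s)%R%:E =
    \sum_(z <- Z) \int[@lebesgue_measure R]_(s in `[c, d]) (f z s)%R%:E)%E.
  rewrite -(@ge0_integral_sum _ _ _ (@lebesgue_measure R) `[c, d]%classic _ R
    (fun z s => (f z s)%:E)).
  - by apply: eq_integral => s _; rewrite sumEFin.
  - exact: measurable_itv.
  - by move=> z; apply/measurable_EFinP; apply: measurable_funTS; exact: mf.
  - by move=> z s _; rewrite lee_fin.
elim: Z H => [|z Z IH] H; first by rewrite big_nil mul0r.
rewrite big_cons /= -[(size Z).+1]add1n natrD mulrDl mul1r EFinD; apply: leeD.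
  by apply: H; rewrite mem_head.
by apply: IH => y yZ; apply: H; rewrite inE yZ orbT.
Qed.

(** * Assembly of the decay estimate *)

Lemma homog_chart (R : realType) (a1 a2 a b m : R) (phi : R * R -> R) : 0 < a1 ->
  (forall x t, Vcone a1 a2 a b x -> 0 < t -> phi (dil a1 a2 t x) = t `^ m * phi x) ->
  forall x, cone_chart R (a2 / a1) a b x ->
    phi x = x.1 `^ (m / a1) * phi (1, x.2 * x.1 `^ (- (a2 / a1))).
Proof.
move=> a10 hom [x1 x2] [/= x10 /andP[h1 h2]].
set s := x2 * _ in h1 h2 *.
have sV : Vcone a1 a2 a b (1, s).
  by exists 1, s; rewrite /dil !powR1 !mul1r.
have t0 : 0 < x1 `^ a1^-1 by rewrite powR_gt0.
have := hom _ _ sV t0; rewrite /dil/= -!powRrM mulVf ?gt_eqF// powRr1 ?ltW// mulr1.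
rewrite [a1^-1 * a2]mulrC [a1^-1 * m]mulrC /s powRN.
by rewrite mulrCA divff ?mulr1// gt_eqF// powR_gt0.
Qed.

(** Ellipticity is assumed on the closure of the cone, and the end values [s = c] and [s = d] are
    needed as well. Moving [s] slightly towards the midpoint produces points of the cone nearby. *)
Lemma closure_Vcone_slice (R : realType) (a1 a2 c d s : R) : c < d -> c <= s <= d ->
  (closure (Vcone a1 a2 c d) `\` [set (0, 0)]) (1, s).
Proof.
move=> cd /andP[cs sd]; split; last by case=> /eqP; rewrite oner_eq0.
move=> B /nbhs_ballP[ep /= ep0 epB].
pose k := `|(c + d) / 2 - s| + 1.
have k0 : 0 < k by rewrite ltr_wpDl.
pose t := Num.min (1 / 2) (ep / (2 * k)).
have t0 : 0 < t by rewrite lt_min !divr_gt0// mulr_gt0.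
have t1 : t < 1 by apply: (@le_lt_trans _ _ (1 / 2)); [rewrite ge_min lexx|lra].
exists (1, s + ((c + d) / 2 - s) * t); split; last first.
  apply: epB; split => /=; first exact: ballxx.
  rewrite /ball/= opprD addNKr normrN normrM (gtr0_norm t0).
  apply: (@le_lt_trans _ _ (k * (ep / (2 * k)))).
    by rewrite ler_pM// ?(ltW t0)// ?lerDl// ge_min lexx orbT.
  have -> : k * (ep / (2 * k)) = ep / 2 by field; rewrite gt_eqF.
  by clear -ep0; lra.
exists 1, (s + ((c + d) / 2 - s) * t); split=> //; rewrite /dil !powR1 !mul1r.
have h1 : 0 <= (s - c) * (1 - t) by rewrite mulr_ge0// subr_ge0// ltW.
have h2 : 0 <= (d - s) * (1 - t) by rewrite mulr_ge0// subr_ge0// ltW.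
have h3 : 0 < (d - c) * t by rewrite mulr_gt0// subr_gt0.
by split; [clear -h1 h3; lra|split; [clear -h2 h3; lra|]].
Qed.

(** [tau = rho^(-1/K)] is the distance [y] at which [rho * y^K] is 1, and
    [rho^(-kap) * tau^(-e) = 1]. For [y <= tau] the bound [J <= 1] is used; beyond, [Ha] is positive
    and its decay estimate applies. Writing [tau + y] for the larger of the two costs the factor
    [2^e]. *)
Lemma inner_weight (R : realType) (K0 c2 rho kap y Ha J : R) (K : nat) :
  0 < K0 -> 0 < c2 -> 0 < rho -> 0 < kap -> (0 < K)%N -> 0 <= y ->
  J <= 1 -> (0 < Ha -> J <= K0 * Ha `^ (- kap)) -> rho * (c2 * y ^+ K) <= Ha ->
  J <= 2 `^ (K%:R * kap) * (1 + K0 * c2 `^ (- kap)) *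
    (rho `^ (- kap) * (rho `^ (- K%:R^-1) + y) `^ (- (K%:R * kap))).
Proof.
move=> K00 c20 r0 kap0 Kpos y0 J1 JH HaL.
set e := K%:R * kap; set tau := rho `^ (- K%:R^-1).
have K'0 : 0 < K%:R :> R by rewrite ltr0n.
have e0 : 0 < e by rewrite mulr_gt0.
have t0 : 0 < tau by rewrite powR_gt0.
have te : tau `^ (- e) = rho `^ kap.
  by rewrite /tau /e -powRrM; congr (_ `^ _); field; rewrite gt_eqF.
have two (x : R) : 0 < x -> tau + y <= 2 * x -> x `^ (- e) <= 2 `^ e * (tau + y) `^ (- e).
  move=> x0 h; have ty : 0 < tau + y by rewrite ltr_wpDr.
  rewrite !powRN ler_pdivlMr ?powR_gt0// ler_pdivrMl ?powR_gt0// -powRM ?ler0n ?(ltW x0)//.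
  apply: ge0_ler_powR; rewrite ?nnegrE ?(ltW e0) ?(ltW ty)//.
    by rewrite mulr_ge0 ?ler0n// ltW.
  by rewrite mulrC.
have A0 : 0 <= K0 * c2 `^ (- kap) by rewrite mulr_ge0 ?powR_ge0// ltW.
have P0 : 0 <= 2 `^ e * (rho `^ (- kap) * (tau + y) `^ (- e)).
  by rewrite !mulr_ge0 ?powR_ge0.
have -> : 2 `^ e * (1 + K0 * c2 `^ (- kap)) * (rho `^ (- kap) * (tau + y) `^ (- e)) =
   2 `^ e * (rho `^ (- kap) * (tau + y) `^ (- e)) +
   K0 * c2 `^ (- kap) * (2 `^ e * (rho `^ (- kap) * (tau + y) `^ (- e))) by ring.
have [yt|ty] := leP y tau.
  apply: (le_trans J1); apply: ler_wpDr; first exact: mulr_ge0.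
  rewrite [leLHS](_ : _ = rho `^ (- kap) * tau `^ (- e)); last first.
    by rewrite te powRN mulVf// gt_eqF// powR_gt0.
  rewrite [leRHS]mulrCA ler_wpM2l ?powR_ge0//; apply: two => //.
  by rewrite mulr_natl mulr2n lerD2l.
have yp : 0 < y by apply: lt_trans ty.
have B0 : 0 < rho * (c2 * y ^+ K) by rewrite !mulr_gt0// exprn_gt0.
have Ha0 : 0 < Ha by apply: lt_le_trans HaL.
apply: (le_trans (JH Ha0)); apply: ler_wpDl => //.
apply: (@le_trans _ _ (K0 * (rho * (c2 * y ^+ K)) `^ (- kap))).
  rewrite ler_pM2l// !powRN lef_pV2 ?posrE ?powR_gt0//.
  by apply: ge0_ler_powR; rewrite ?nnegrE ?(ltW kap0) ?(ltW B0) ?(ltW Ha0).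
have yK0 : 0 <= y ^+ K by rewrite exprn_ge0.
rewrite !powRM ?mulr_ge0 ?(ltW r0) ?(ltW c20)// -powR_mulrn// -powRrM mulrN -/e.
have -> : K0 * (rho `^ (- kap) * (c2 `^ (- kap) * y `^ (- e))) =
  K0 * c2 `^ (- kap) * (rho `^ (- kap) * y `^ (- e)) by ring.
rewrite ler_wpM2l// [leRHS]mulrCA ler_wpM2l ?powR_ge0//; apply: two => //.
by rewrite mulr_natl mulr2n lerD2r ltW.
Qed.

Lemma clamp_cts (R : realType) (c d : R) : continuous (clamp R c d).
Proof.
move=> x; apply: continuous_max; first exact: cvg_cst.
by apply: continuous_min; [exact: cvg_cst|exact: cvg_id].
Qed.

Lemma clamp_id (R : realType) (c d s : R) : c <= s <= d -> clamp R c d s = s.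
Proof. by move=> /andP[cs sd]; rewrite /clamp (min_idPr sd) (max_idPr cs). Qed.

Lemma cone_decay (R : realType) (a1 a2 a b c d m : R) (K : nat) (g1 g2 : nat -> R -> R)
    (phi1 phi2 : R * R -> R) :
  0 < a1 -> 0 < a2 -> a1 != a2 -> 3 * (a1 + a2) <= m -> a < c -> c < d -> d < b ->
  (0 < K)%N -> K%:R * ((a1 + a2) / m) < 1 ->
  (forall n s, a < s < b -> is_derive s 1 (g1 n) (g1 n.+1 s)) ->
  (forall n s, a < s < b -> is_derive s 1 (g2 n) (g2 n.+1 s)) ->
  (forall x, cone_chart R (a2 / a1) a b x ->
    phi1 x = x.1 `^ (m / a1) * g1 0%N (x.2 * x.1 `^ (- (a2 / a1)))) ->
  (forall x, cone_chart R (a2 / a1) a b x ->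
    phi2 x = x.1 `^ (m / a1) * g2 0%N (x.2 * x.1 `^ (- (a2 / a1)))) ->
  (forall s z1 z2, c <= s <= d -> z1 ^+ 2 + z2 ^+ 2 = 1 ->
    exists2 j, (j < K.+1)%N & z1 * g1 j s + z2 * g2 j s != 0) ->
  exists2 C : R, 0 < C & forall th (xi1 xi2 : R * R), xi2 != (0, 0) ->
    `|Rintegral (@leb2 R) (Vcone1 a1 a2 c d) (fun x => cos (phase phi1 phi2 xi1 xi2 x + th))|
      <= C * enorm xi2 `^ (- ((a1 + a2) / m)).
Proof.
move=> a10 a20 a12 m3 ac cd db Kpos Kkap d1 d2 e1 e2 nd.
set kap := (a1 + a2) / m in Kkap *; set al := a2 / a1 in e1 e2; set M := m / a1 in e1 e2.
have a120 : 0 < a1 + a2 by rewrite addr_gt0.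
have m0 : 0 < m by apply: lt_le_trans m3; rewrite mulr_gt0.
have kap0 : 0 < kap by rewrite divr_gt0.
have al0 : 0 < al by rewrite divr_gt0.
have al1 : al != 1 by apply: contra_neq a12 => h; rewrite -[LHS]mul1r -h divfK ?gt_eqF.
have alE : 1 + al = (a1 + a2) / a1 by rewrite mulrDl divff ?gt_eqF.
have M3 : 3 * (1 + al) <= M by rewrite alE mulrA ler_pM2r ?invr_gt0.
have [K0 K00 HK0] := @osc_inner R al M al0 al1 M3.
have kapE : (1 + al) / M = kap.
  by rewrite alE /M /kap; field; rewrite !gt_eqF.
rewrite kapE in HK0.
have cdab t : c <= t <= d -> a < t < b.
  by move=> /andP[t1 t2]; rewrite (lt_le_trans ac t1) (le_lt_trans t2 db).
have [N [c2 [c20 HZ]]] := @uniform_lower R K g1 g2 c d cd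
  (fun i z hz => d1 i z (cdab z hz)) (fun i z hz => d2 i z (cdab z hz)) nd.
set e := K%:R * kap in Kkap.
have e0 : 0 < e by rewrite mulr_gt0// ltr0n.
have e10 : 0 < 1 - e by rewrite subr_gt0.
pose C0 := 2 `^ e * (1 + K0 * c2 `^ (- kap)).
have C00 : 0 < C0.
  by rewrite mulr_gt0 ?powR_gt0// ltr_pwDl// mulr_ge0 ?powR_ge0// ltW.
pose W := 4 * (1 + (d - c)) `^ (1 - e) / (1 - e).
have dc0 : 0 < d - c by rewrite subr_gt0.
have W0 : 0 < W by rewrite divr_gt0// mulr_gt0// powR_gt0// addr_gt0.
pose C := (d - c) + C0 * (N%:R * W).
have NW0 : 0 <= C0 * (N%:R * W) by rewrite mulr_ge0 ?(ltW C00)// mulr_ge0 ?(ltW W0).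
exists C; first by rewrite ltr_pwDl.
move=> th xi1 xi2 xi20.
set rho := enorm xi2.
have r2 : rho ^+ 2 = xi2.1 ^+ 2 + xi2.2 ^+ 2.
  by rewrite sqr_sqrtr// addr_ge0// sqr_ge0.
have r0 : 0 < rho.
  rewrite sqrtr_gt0 lt_neqAle addr_ge0 ?sqr_ge0// andbT eq_sym.
  rewrite paddr_eq0 ?sqr_ge0// !sqrf_eq0; apply: contra xi20 => /andP[/eqP h1 /eqP h2].
  by rewrite [xi2]surjective_pairing h1 h2.
pose z1 := xi2.1 / rho; pose z2 := xi2.2 / rho.
have hz : z1 ^+ 2 + z2 ^+ 2 = 1.
  by rewrite !expr_div_n -mulrDl -r2 divff// expf_neq0// gt_eqF.
have [Z ZN HZs] := HZ z1 z2 hz.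
(* Composition with [clamp] makes [H] continuous on the whole line and leaves it unchanged on
   [[c, d]]. *)
pose H s := xi2.1 * g1 0%N (clamp R c d s) + xi2.2 * g2 0%N (clamp R c d s).
have cH : continuous H.
  have gc (g : nat -> R -> R) : (forall n s, a < s < b -> is_derive s 1 (g n) (g n.+1 s)) ->
      continuous (fun s => g 0%N (clamp R c d s)).
    move=> gd s; apply: (@continuous_comp _ _ _ (clamp R c d) (g 0%N)); first exact: clamp_cts.
    by apply: (@is_derive_cts R _ _ (g 1%N (clamp R c d s))); apply: gd; apply: cdab;
      apply: clamp_in; exact: ltW.
  move=> s; apply: cvgD; (apply: cvgM; first exact: cvg_cst); [exact: gc|exact: gc].
have FE : Rintegral (@leb2 R) (Vcone1 a1 a2 c d) (fun x => cos (phase phi1 phi2 xi1 xi2 x + th)) =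
    Rintegral (@leb2 R) (Vcone1 a1 a2 c d) (cone_phase_cos R al M xi1.1 xi1.2 th H).
  apply: eq_Rintegral => x; rewrite inE => /(Vcone1P R a1 a2 c d x a10)[x0 x1 h1 h2].
  rewrite -/al in h1 h2.
  have xal : 0 < x.1 `^ al by rewrite powR_gt0.
  have s1 : c < x.2 * x.1 `^ (- al) by rewrite powRN ltr_pdivlMr// mulrC.
  have s2 : x.2 * x.1 `^ (- al) < d by rewrite powRN ltr_pdivrMr// mulrC.
  have xch : cone_chart R al a b x.
    by split => //; rewrite (lt_trans ac s1) (lt_trans s2 db).
  rewrite /phase /dot/= (e1 x xch) (e2 x xch) /cone_phase_cos /H clamp_id ?(ltW s1) ?(ltW s2)//.
  by congr cos; ring.
rewrite FE.
have J1 s : `|Rintegral (@lebesgue_measure R) `[0, 1]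
    (osc_amp R al M xi1.1 (xi1.2 * s) (H s) th)| <= 1.
  by have := @Rintegral_osc_amp_le R al M xi1.1 (xi1.2 * s) (H s) th 1 (ltW al0) ler01;
    rewrite powR1 mulr1.
(* For [rho < 1] the factor [rho^(- kap)] is at least 1 and the trivial bound on [J] suffices. The
   other case has [tau <= 1], as [weight_integral] demands. *)
have [r1|r1] := ltP rho 1.
  apply: (@polar_bound R a1 a2 c d M xi1.1 xi1.2 th _ H (fun=> 1) a10 a20 (ltW cd) cH) => //.
  rewrite /= integral_cst//= mul1e lebesgue_measure_itv/= lte_fin cd -EFinB lee_fin.
  have rk : 1 <= rho `^ (- kap).
    rewrite powRN invf_ge1 ?powR_gt0//.
    by rewrite -[leRHS](powRr0 rho); apply: ger_powR; rewrite ?r0 ?ltW.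
  apply: (@le_trans _ _ C); first by rewrite /C lerDl.
  by rewrite ler_peMr// addr_ge0// ltW.
pose tau := rho `^ (- K%:R^-1).
have t0 : 0 < tau by rewrite powR_gt0.
have t1 : tau <= 1.
  by rewrite -[leRHS](powRr0 rho); apply: ler_powR => //; rewrite oppr_le0 invr_ge0.
pose Z' := [seq z <- Z | c <= z <= d].
pose f (z s : R) := C0 * (rho `^ (- kap) * (tau + `|s - z|) `^ (- e)).
have f0 z s : 0 <= f z s by rewrite mulr_ge0 ?(ltW C00)// mulr_ge0 ?powR_ge0.
have mf z : measurable_fun [set: R] (f z).
  apply: measurable_funM => //; apply: measurable_funM => //.
  exact: measurable_weight.
apply: (@polar_bound R a1 a2 c d M xi1.1 xi1.2 th _ H (fun s => \sum_(z <- Z') f z s)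
  a10 a20 (ltW cd) cH).
- by apply: measurable_sum => z; exact: mf.
- by move=> s; rewrite sumr_ge0.
- move=> s /andP[cs sd]; have scd : c <= s <= d by rewrite !ltW.
  have [w [wZ wcd hw]] := HZs s scd.
  have wZ' : w \in Z' by rewrite mem_filter wcd wZ.
  (* Only the term of [w] matters for this [s]. Summing over all centres gives a majorant measurable
     in [s] without a measurable choice of [w]. *)
  rewrite (perm_big _ (perm_to_rem wZ'))/= big_cons; apply: ler_wpDr; first by rewrite sumr_ge0.
  apply: (@inner_weight R K0 c2 rho kap `|s - w| `|H s|) => //.
  + by move=> Hs0; apply: HK0; rewrite -normr_gt0.
  + have -> : H s = rho * (z1 * g1 0%N s + z2 * g2 0%N s).
      by rewrite /H clamp_id// /z1 /z2; field; rewrite gt_eqF.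
    by rewrite normrM (gtr0_norm r0) ler_pM2l.
have zi z : z \in Z' -> (\int[@lebesgue_measure R]_(s in `[c, d]) (f z s)%:E <=
    (C0 * (rho `^ (- kap) * W))%:E)%E.
  rewrite mem_filter => /andP[zcd _].
  under eq_integral do rewrite /f mulrA EFinM.
  rewrite ge0_integralZl_EFin//; last 3 first.
  - by move=> s _; rewrite lee_fin powR_ge0.
  - by apply/measurable_EFinP; apply: measurable_funTS; exact: measurable_weight.
  - by rewrite mulr_ge0 ?powR_ge0// ltW.
  rewrite mulrA [X in (_ <= X)%E]EFinM lee_wpmul2l//.
    by rewrite lee_fin mulr_ge0 ?powR_ge0// ltW.
  exact: (@weight_integral R c d e tau z e0 Kkap t0 t1 zcd).
apply: (le_trans (@sum_weight_integral R c d _ f Z' zi mf f0)).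
rewrite lee_fin.
have ZN' : (size Z')%:R <= N%:R :> R.
  by rewrite ler_nat; apply: leq_trans ZN; rewrite size_filter count_size.
apply: (@le_trans _ _ (N%:R * (C0 * (rho `^ (- kap) * W)))).
  by rewrite ler_wpM2r// mulr_ge0 ?(ltW C00)// mulr_ge0 ?powR_ge0 ?(ltW W0).
have -> : N%:R * (C0 * (rho `^ (- kap) * W)) = C0 * (N%:R * W) * rho `^ (- kap) by ring.
by rewrite ler_wpM2r ?powR_ge0// lerDr ltW.
Qed.

Theorem theorem3p8 (R : realType) (a1 a2 a b c d m sigma D delta : R)
  (n1 n2 : nat) (phi1 phi2 : R * R -> R) :
  0 < a1 -> 0 < a2 -> a1 != a2 ->
  (* (H1) *)
  real_analytic_on (Vcone a1 a2 a b) phi1 ->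
  real_analytic_on (Vcone a1 a2 a b) phi2 ->
  (* (H2) *)
  3 * (a1 + a2) <= m ->
  (forall x t, Vcone a1 a2 a b x -> 0 < t ->
     phi1 (dil a1 a2 t x) = t `^ m * phi1 x /\
     phi2 (dil a1 a2 t x) = t `^ m * phi2 x) ->
  (* (H3) *)
  a < c -> c < d -> d < b -> c <= sigma -> sigma <= d ->
  (forall x, (closure (Vcone a1 a2 c d) `\` [set (0, 0)]) x ->
     (~ elliptic phi1 phi2 x <-> curve a1 a2 sigma x)) ->
  (* (H4), with beta = 2 (m - a1 - a2) *)
  (0 < n1)%N -> (0 < n2)%N -> 0 < D -> 0 < delta ->
  (c < sigma -> forall s t, sigma - delta < s -> s < sigma -> a < s -> 0 < t ->
     D * t `^ (2 * (m - a1 - a2)) * `|s - sigma| ^+ n1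
       <= minQ phi1 phi2 (dil a1 a2 t (1, s))) ->
  (sigma < d -> forall s t, sigma < s -> s < sigma + delta -> s < b -> 0 < t ->
     D * t `^ (2 * (m - a1 - a2)) * `|s - sigma| ^+ n2
       <= minQ phi1 phi2 (dil a1 a2 t (1, s))) ->
  (maxn n1 n2)%:R < 2 * m / (a1 + a2) - 3 ->
  (* conclusion *)
  exists C : R, 0 < C /\
    forall xi1 xi2 : R * R, xi2 != (0, 0) ->
      muhat_abs a1 a2 c d phi1 phi2 xi1 xi2
        <= C * enorm xi2 `^ (- ((a1 + a2) / m)).
Proof.
move=> a10 a20 a12 an1 an2 m3 hom ac cd db csg sgd ell n10 n20 D0 del0 low1 low2 nmax.
have a120 : 0 < a1 + a2 by rewrite addr_gt0.
have m0 : 0 < m by apply: lt_le_trans m3; rewrite mulr_gt0.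
pose g1 n := derive1n n (fun s => phi1 (1, s)).
pose g2 n := derive1n n (fun s => phi2 (1, s)).
have d1 n s : a < s < b -> is_derive s 1 (g1 n) (g1 n.+1 s).
  by apply: locally_pseries_smooth; exact: real_analytic_slice an1.
have d2 n s : a < s < b -> is_derive s 1 (g2 n) (g2 n.+1 s).
  by apply: locally_pseries_smooth; exact: real_analytic_slice an2.
have e1 x : cone_chart R (a2 / a1) a b x ->
    phi1 x = x.1 `^ (m / a1) * g1 0%N (x.2 * x.1 `^ (- (a2 / a1))).
  by apply: homog_chart => // y t yV t0; have [] := hom y t yV t0.
have e2 x : cone_chart R (a2 / a1) a b x ->
    phi2 x = x.1 `^ (m / a1) * g2 0%N (x.2 * x.1 `^ (- (a2 / a1))).
  by apply: homog_chart => // y t yV t0; have [] := hom y t yV t0.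
(* The least integer with [n1] and [n2] below [2 K - 1]. Since [2 K] is at most [maxn n1 n2 + 3],
   the last inequality of (H4) gives [K (a1 + a2) / m < 1]. *)
pose K := (maxn n1 n2 + 3)./2.
have K2 : (2 <= K)%N by rewrite /K; clear -n10; lia.
have n1K : (n1 < 2 * K - 1)%N by rewrite /K; clear; lia.
have n2K : (n2 < 2 * K - 1)%N by rewrite /K; clear; lia.
have Kkap : K%:R * ((a1 + a2) / m) < 1.
  rewrite mulrA ltr_pdivrMr// mul1r -ltr_pdivlMr//.
  have h : (2 * K)%:R <= (maxn n1 n2 + 3)%:R :> R.
    by rewrite ler_nat /K; clear; lia.
  move: nmax h; rewrite natrM natrD -mulrA; move: (maxn n1 n2)%:R (m / (a1 + a2)).
  by clear => x y; lra.
have dil1 s : dil a1 a2 1 (1, s) = (1, s) by rewrite /dil/= !powR1 !mul1r.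
have ell' s : c <= s <= d -> s != sigma -> 0 < minQ phi1 phi2 (1, s).
  move=> scd ssg; have h := ell _ (@closure_Vcone_slice R a1 a2 c d s cd scd).
  (* A nonelliptic [(1, s)] would lie on the curve; the first coordinate gives [t^a1 = 1], so
     [t = 1] and [s = sigma]. *)
  have [//|/h [t [t0]]] := pselect (elliptic phi1 phi2 (1, s)).
  rewrite /dil/= !mulr1 => -[/esym t1 sE].
  have : t == 1 by move/eqP : t1; rewrite powR_eq1 (gt_eqF a10) orbF ltNge (ltW t0) orbF.
  by move=> /eqP t1'; rewrite sE t1' powR1 mul1r eqxx in ssg.
have sgcd : c <= sigma <= d by rewrite csg sgd.
have nd : forall s z1 z2, c <= s <= d -> z1 ^+ 2 + z2 ^+ 2 = 1 ->
    exists2 j, (j < K.+1)%N & z1 * g1 j s + z2 * g2 j s != 0.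
  (* The left side of [sigma] is used when [c < sigma]; otherwise [sigma = c < d] and the right side
     is available. *)
  have [csg'|sgc] := ltP c sigma.
    have h := low1 csg'.
    apply: (@nondegenerate R (a2 / a1) a b c d (m / a1) sigma D delta (-1) g1 g2
      phi1 phi2 n1 K) => //; first by rewrite normrN1.
    move=> u /andP[u0 ud] /andP[au _]; rewrite mulN1r in au *.
    have nu : `|sigma - u - sigma| = u by rewrite addrAC subrr sub0r normrN gtr0_norm.
    have := h (sigma - u) 1; rewrite powR1 mulr1 dil1 nu.
    by apply; rewrite ?ltr01// ?ltrD2l ?ltrN2// gtrDl oppr_lt0.
  have sgd' : sigma < d by apply: le_lt_trans cd.
  have h := low2 sgd'.
  apply: (@nondegenerate R (a2 / a1) a b c d (m / a1) sigma D delta 1 g1 g2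
    phi1 phi2 n2 K) => //; first by rewrite normr1.
  move=> u /andP[u0 ud] /andP[_ ub]; rewrite mul1r in ub *.
  have nu : `|sigma + u - sigma| = u by rewrite addrAC subrr add0r gtr0_norm.
  have := h (sigma + u) 1; rewrite powR1 mulr1 dil1 nu.
  by apply; rewrite ?ltr01// ?ltrD2l// ltrDl.
have [C C0 HC] := @cone_decay R a1 a2 a b c d m K g1 g2 phi1 phi2 a10 a20 a12 m3 ac cd db
  (ltnW K2) Kkap d1 d2 e1 e2 nd.
(* Real and imaginary part are each at most [B], and 2 leaves room for the factor [sqrt 2] in the
   modulus. *)
exists (2 * C); split; first by rewrite mulr_gt0.
move=> xi1 xi2 xi20; rewrite /muhat_abs.
have re : `|muhat_re a1 a2 c d phi1 phi2 xi1 xi2| <= C * enorm xi2 `^ (- ((a1 + a2) / m)).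
  have := HC 0 xi1 xi2 xi20; apply: le_trans; rewrite le_eqVlt; apply/orP; left; apply/eqP.
  by congr `|_|; apply: eq_Rintegral => x _; rewrite addr0.
(* The shift [th = - pi / 2] turns the cosine into a sine. *)
have im : `|muhat_im a1 a2 c d phi1 phi2 xi1 xi2| <= C * enorm xi2 `^ (- ((a1 + a2) / m)).
  have := HC (- (pi / 2)) xi1 xi2 xi20; apply: le_trans; rewrite /muhat_im normrN.
  rewrite le_eqVlt; apply/orP; left; apply/eqP.
  by congr `|_|; apply: eq_Rintegral => x _; rewrite cosBpihalf.
move: re im; move: (muhat_re _ _ _ _ _ _ _ _) (muhat_im _ _ _ _ _ _ _ _).
rewrite -mulrA; move: (C * _) => B x y hx hy.
have B0 : 0 <= B by apply: le_trans hx.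
rewrite -(@ler_pXn2r _ 2)// ?nnegrE ?sqrtr_ge0 ?mulr_ge0//.
rewrite sqr_sqrtr ?addr_ge0 ?sqr_ge0// exprMn -[x ^+ 2]real_normK ?num_real//.
rewrite -[y ^+ 2]real_normK ?num_real//.
have h1 : `|x| ^+ 2 <= B ^+ 2 by rewrite lerXn2r ?nnegrE.
have h2 : `|y| ^+ 2 <= B ^+ 2 by rewrite lerXn2r ?nnegrE.
have := sqr_ge0 B; move: h1 h2; move: (`|x| ^+ 2) (`|y| ^+ 2) (B ^+ 2); clear => X Y Z.
by move=> hX hY hZ; lra.
Qed.
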